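(* Let $\mathbb{C}$ be an internal category in a cartesian category $\mathcal{C}$, let $X$ be an object of $\mathcal{C}$, and let $P_0$ and $P_1$ be principal $c\mathbb{C}$-bundles over $X$. Then morphisms $P_0\to P_1$ of $Prin_{\mathbb{C}}(X)$ are in bijection with isomorphism classes of triples $(\beta_0,P,\beta_1)$, where $P$ is a principal $c\mathbb{C}^{\uparrow}$-bundle over $X$ and $\beta_0:P_0\to\Sigma_{D_0}P$ and $\beta_1:\Sigma_{D_1}P\to P_1$ are principal $c\mathbb{C}$-bundle morphisms (necessarily isomorphisms). Here $D_0,D_1:c\mathbb{C}^{\uparrow}\rightrightarrows c\mathbb{C}$ are the internal functors determined by the domain and codomain morphisms of $\mathbb{C}$.
   Context: A cartesian category is a finitely complete category. ``Elements'' are shorthand for generalized elements. A morphism $f:Y\to X$ of $\mathcal{C}$ is of effective descent if $f^*:\mathcal{C}/X\to\mathcal{C}/Y$ is monadic. For an internal category $\mathbb{C}=(C_1\rightrightarrows C_0,\dots)$: its core $c\mathbb{C}$ is the internal groupoid with the same object of objects and only the isomorphisms as morphisms; $\mathbb{C}^{\uparrow}$ is its arrow category (object of objects $C_1$, morphisms the commuting squares); $c\mathbb{C}^{\uparrow}$ denotes the core of $\mathbb{C}^{\uparrow}$. Principal bundles. Let $\mathbb{G}=(d_0,d_1:G_1\rightrightarrows G_0,\dots)$ be an internal groupoid in $\mathcal{C}$. A principal $\mathbb{G}$-bundle over $X$ is an object $P$ with a map $x_P:P\to G_0$, an action $a:G_1\times_{G_0}P\to P$ of $\mathbb{G}$ (defined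 on pairs $(g,p)$ with $d_0g=x_P(p)$, and $x_P(a(g,p))=d_1g$), and an effective descent morphism $p:P\to X$ invariant under the action, such that $(a,\pi_2):G_1\times_{G_0}P\to P\times_XP$ is an isomorphism. Morphisms of principal $\mathbb{G}$-bundles over $X$ are equivariant maps over $X$ and $G_0$; they are all isomorphisms. The cocycle of $P$ is the internal functor $\psi^P:\mathbb{P}\to\mathbb{G}$, where $\mathbb{P}$ is the groupoid $\pi_1,\pi_2:P\times_XP\rightrightarrows P$, acting as $x_P$ on objects and with $\psi^P(p,p'):x_P(p)\to x_P(p')$ the unique $g$ such that $a(g,p)=p'$. More generally a cocycle is an internal functor $\psi:\mathbb{Y}\to\mathbb{G}$ where $\mathbb{Y}$ is the groupoid $Y\times_XY\rightrightarrows Y$ of an effective descent morphism $Y\to X$; write $x_\psi$ for its action on objects. It corresponds to a principal $\mathbb{G}$-bundle $Q$ over $X$, determined up to isomorphism by having a morphism $s:Y\to Q$ over $X$ with $x_Qs=x_\psi$ and $\psi^Q(s(y),s(y'))=\psi(y,y')$. For an internal functor $\mathbb{F}:\mathbb{H}\to\mathbb{G}$ between internal groupoids and a principal $\mathbb{H}$-bundle $P$ over $X$, $\Sigma_{\mathbb{F}}(P)$ is the principal $\mathbb{G}$-bundle over $X$ corresponding to the cocycle $\mathbb{F}\psi^P$; this is functorial in $P$. Morphisms of $Prin_{\mathbb{C}}(X)$. The cocycle of a principal $c\mathbb{C}$-bundle $P$ is regarded as an internal functor $\psi^P:\mathbb{P}\to\mathbb{C}$. A morphism $P_0\to P_1$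 of $Prin_{\mathbb{C}}(X)$ is an internal natural transformation $\psi^{P_0}\pi_1\to\psi^{P_1}\pi_2$ between functors $\mathbb{P}_0\times_{\mathbb{X}}\mathbb{P}_1\to\mathbb{C}$, where $\pi_1,\pi_2$ are the projections to $\mathbb{P}_0,\mathbb{P}_1$ and $\mathbb{P}_0\times_{\mathbb{X}}\mathbb{P}_1$ is the groupoid of the kernel pair of $P_0\times_XP_1\to X$; it is given by a map $P_0\times_XP_1\to C_1$. An isomorphism of triples $(\beta_0,P,\beta_1)\to(\beta_0',P',\beta_1')$ is a morphism $\phi:P\to P'$ of principal $c\mathbb{C}^{\uparrow}$-bundles over $X$ with $\Sigma_{D_0}(\phi)\beta_0=\beta_0'$ and $\beta_1'\Sigma_{D_1}(\phi)=\beta_1$. *)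

(* Defs.v *)
From mathcomp Require Import ssreflect ssrfun ssrbool.
From mathcomp Require Import boolp.

Set Implicit Arguments.
Unset Strict Implicit.
Unset Printing Implicit Defensive.
#[local] Obligation Tactic := idtac.

Declare Scope cat_scope.
Delimit Scope cat_scope with cat.
Local Open Scope cat_scope.

(** * Categories, monads and monadic functors *)

Record category := Category {
  ob :> Type;
  hom : ob -> ob -> Type;
  idm : forall A, hom A A;
  comp : forall A B C, hom B C -> hom A B -> hom A C;
  compA : forall A B C D (h : hom C D) (g : hom B C) (f : hom A B),
    comp h (comp g f) = comp (comp h g) f;
  comp1m : forall A B (f : hom A B), comp (idm B) f = f;
  compm1 : forall A B (f : hom A B), comp f (idm A) = f }.

Arguments hom {c} A B.
Arguments idm {c} A.
Arguments comp {c A B C} g f.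
Arguments compA {c A B C D} h g f.
Arguments comp1m {c A B} f.
Arguments compm1 {c A B} f.
Notation "g ∘ f" := (comp g f) (at level 40, left associativity) : cat_scope.

Definition is_iso (C : category) (A B : C) (f : hom A B) : Prop :=
  exists g : hom B A, g ∘ f = idm A /\ f ∘ g = idm B.

Record functor (C D : category) := Functor {
  fobj :> C -> D;
  fmap : forall A B : C, hom A B -> hom (fobj A) (fobj B);
  fmap1 : forall A : C, fmap (idm A) = idm (fobj A);
  fmapM : forall (A B E : C) (g : hom B E) (f : hom A B),
    fmap (g ∘ f) = fmap g ∘ fmap f }.

Arguments fmap {C D} f {A B} _ : rename.

Definition functor_id (C : category) : functor C C :=
  @Functor C C (fun A => A) (fun _ _ f => f) (fun _ => erefl)
    (fun _ _ _ _ _ => erefl).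

Program Definition functor_comp (C D E : category)
    (G : functor D E) (F : functor C D) : functor C E :=
  @Functor C E (fun A => G (F A)) (fun _ _ f => fmap G (fmap F f)) _ _.
Next Obligation. by move=> * /=; rewrite !fmap1. Qed.
Next Obligation. by move=> * /=; rewrite !fmapM. Qed.

Record nattrans (C D : category) (F G : functor C D) := NatTrans {
  ntcomp :> forall A : C, hom (F A) (G A);
  ntnat : forall (A B : C) (f : hom A B),
    fmap G f ∘ ntcomp A = ntcomp B ∘ fmap F f }.

Record adjunction (C D : category) (F : functor C D) (U : functor D C) :=
  Adjunction {
  adj_unit : nattrans (functor_id C) (functor_comp U F);
  adj_counit : nattrans (functor_comp F U) (functor_id D);
  adj_triL : forall A : C,
    adj_counit (F A) ∘ fmap F (adj_unit A) = idm (F A);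
  adj_triR : forall B : D,
    fmap U (adj_counit B) ∘ adj_unit (U B) = idm (U B) }.

Record monad (C : category) := Monad {
  mnd_functor :> functor C C;
  mnd_unit : nattrans (functor_id C) mnd_functor;
  mnd_mul : nattrans (functor_comp mnd_functor mnd_functor) mnd_functor;
  mnd_unitL : forall A : C,
    mnd_mul A ∘ mnd_unit (mnd_functor A) = idm (mnd_functor A);
  mnd_unitR : forall A : C,
    mnd_mul A ∘ fmap mnd_functor (mnd_unit A) = idm (mnd_functor A);
  mnd_mulA : forall A : C,
    mnd_mul A ∘ mnd_mul (mnd_functor A)
    = mnd_mul A ∘ fmap mnd_functor (mnd_mul A) }.

Section AdjunctionMonad.
Variables (C D : category) (F : functor C D) (U : functor D C).
Variable adj : adjunction F U.

Program Definition adj_mul :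
    nattrans (functor_comp (functor_comp U F) (functor_comp U F))
             (functor_comp U F) :=
  @NatTrans _ _ _ _ (fun A => fmap U (adj_counit adj (F A))) _.
Next Obligation.
by move=> A B f /=; rewrite -!fmapM; congr fmap; apply: (ntnat (adj_counit adj)).
Qed.

Program Definition adj_monad : monad C :=
  @Monad C (functor_comp U F) (adj_unit adj) adj_mul _ _ _.
Next Obligation. by move=> A /=; apply: adj_triR. Qed.
Next Obligation. by move=> A /=; rewrite -fmapM adj_triL fmap1. Qed.
Next Obligation.
move=> A /=; rewrite -!fmapM; congr fmap.
by rewrite (ntnat (adj_counit adj)).
Qed.

End AdjunctionMonad.

Section EilenbergMoore.
Variables (C : category) (T : monad C).

Record algebra := Algebra {
  alg_ob :> C;
  alg_str : hom (T alg_ob) alg_ob;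
  alg_unit : alg_str ∘ mnd_unit T alg_ob = idm alg_ob;
  alg_mul : alg_str ∘ mnd_mul T alg_ob = alg_str ∘ fmap T alg_str }.

Definition algebra_hom (A B : algebra) : Type :=
  {f : hom A B | f ∘ alg_str A = alg_str B ∘ fmap T f}.

Program Definition algebra_category : category :=
  @Category algebra algebra_hom
    (fun A => exist _ (idm A) _)
    (fun A B E g f => exist _ (sval g ∘ sval f) _) _ _ _.
Next Obligation. by move=> A /=; rewrite fmap1 comp1m compm1. Qed.
Next Obligation.
move=> A B E [g hg] [f hf] /=.
by rewrite -compA hf compA hg -compA fmapM.
Qed.
Next Obligation. by move=> * ; apply: eq_exist; apply: compA. Qed.
Next Obligation. by move=> A B [f hf]; apply: eq_exist; apply: comp1m. Qed.
Next Obligation. by move=> A B [f hf]; apply: eq_exist; apply: compm1. Qed.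

End EilenbergMoore.

Program Definition comparison (C D : category) (F : functor C D)
    (U : functor D C) (adj : adjunction F U) :
    functor D (algebra_category (adj_monad adj)) :=
  @Functor D (algebra_category (adj_monad adj))
    (fun B => @Algebra _ (adj_monad adj) (U B)
                (fmap U (adj_counit adj B)) _ _)
    (fun A B f => exist _ (fmap U f) _) _ _.
Next Obligation. by move=> *; apply: adj_triR. Qed.
Next Obligation.
move=> C D F U adj B /=; rewrite -!fmapM; congr fmap.
by rewrite (ntnat (adj_counit adj)).
Qed.
Next Obligation.
move=> C D F U adj A B f /=; rewrite -!fmapM; congr fmap.
exact: (ntnat (adj_counit adj)).
Qed.
Next Obligation. by move=> *; apply: eq_exist; apply: fmap1. Qed.
Next Obligation. by move=> *; apply: eq_exist; apply: fmapM. Qed.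

Definition fully_faithful (C D : category) (F : functor C D) : Prop :=
  forall A B : C, bijective (fun f : hom A B => fmap F f).

Definition essentially_surjective (C D : category) (F : functor C D) : Prop :=
  forall B : D, exists (A : C) (f : hom (F A) B), is_iso f.

Definition is_equivalence (C D : category) (F : functor C D) : Prop :=
  fully_faithful F /\ essentially_surjective F.

Definition monadic (C D : category) (U : functor D C) : Prop :=
  exists (F : functor C D) (adj : adjunction F U),
    is_equivalence (comparison adj).

Lemma monadic_faithful (D E : category) (U : functor D E) :
  monadic U -> forall (A B : D) (f g : hom A B), fmap U f = fmap U g -> f = g.
Proof.
move=> [F [adj [ff _]]] A B f g e.
by apply: (bij_inj (ff A B)); apply: eq_exist.
Qed.

Lemma monadic_conservative (D E : category) (U : functor D E) :
  monadic U -> forall (A B : D) (f : hom A B), is_iso (fmap U f) -> is_iso f.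
Proof.
move=> monU A B f [g [gf fg]].
have faith := monadic_faithful monU; move: monU => [F [adj [ff _]]].
have hg : g ∘ fmap U (adj_counit adj B)
        = fmap U (adj_counit adj A) ∘ fmap U (fmap F g).
  rewrite -[RHS]comp1m -gf -compA; congr comp.
  have nat_f : fmap U f ∘ fmap U (adj_counit adj A)
      = fmap U (adj_counit adj B) ∘ fmap U (fmap F (fmap U f)).
    by rewrite -!fmapM; congr fmap; apply: (ntnat (adj_counit adj)).
  by rewrite compA nat_f -compA -!fmapM fg !fmap1 compm1.
have [r _ rK] := ff B A.
have := congr1 sval (rK (exist _ g hg)).
set k := r _ => /= Uk.
by exists k; split; apply: faith; rewrite fmapM fmap1 Uk.
Qed.

(** * Cartesian categories and effective descent *)

(** Finite completeness, given by a terminal object and (chosen) pullbacks. *)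
Record cartesian := Cartesian {
  cart_cat :> category;
  one : cart_cat;
  bang : forall A : cart_cat, hom A one;
  bang_uniq : forall (A : cart_cat) (f g : hom A one), f = g;
  pb : forall A B E : cart_cat, hom A E -> hom B E -> cart_cat;
  pb1 : forall (A B E : cart_cat) (f : hom A E) (g : hom B E),
    hom (pb f g) A;
  pb2 : forall (A B E : cart_cat) (f : hom A E) (g : hom B E),
    hom (pb f g) B;
  pb_sq : forall (A B E : cart_cat) (f : hom A E) (g : hom B E),
    f ∘ pb1 f g = g ∘ pb2 f g;
  pbpair : forall (A B E : cart_cat) (f : hom A E) (g : hom B E) (T : cart_cat)
    (u : hom T A) (v : hom T B), f ∘ u = g ∘ v -> hom T (pb f g);
  pb1_pair : forall (A B E : cart_cat) (f : hom A E) (g : hom B E)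
    (T : cart_cat) (u : hom T A) (v : hom T B) (h : f ∘ u = g ∘ v),
    pb1 f g ∘ pbpair h = u;
  pb2_pair : forall (A B E : cart_cat) (f : hom A E) (g : hom B E)
    (T : cart_cat) (u : hom T A) (v : hom T B) (h : f ∘ u = g ∘ v),
    pb2 f g ∘ pbpair h = v;
  pb_ext : forall (A B E : cart_cat) (f : hom A E) (g : hom B E)
    (T : cart_cat) (w w' : hom T (pb f g)),
    pb1 f g ∘ w = pb1 f g ∘ w' -> pb2 f g ∘ w = pb2 f g ∘ w' -> w = w' }.

Arguments one {c}.
Arguments bang {c} A.
Arguments pb {c A B E} f g.
Arguments pb1 {c A B E} f g.
Arguments pb2 {c A B E} f g.
Arguments pb_sq {c A B E} f g.
Arguments pbpair {c A B E f g T u v} h.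

Section Pullbacks.
Variable C : cartesian.

Lemma pbpair_pre (A B E : C) (f : hom A E) (g : hom B E) (S T : C)
    (u : hom T A) (v : hom T B) (h : f ∘ u = g ∘ v) (t : hom S T)
    (h' : f ∘ (u ∘ t) = g ∘ (v ∘ t)) :
  pbpair h ∘ t = pbpair h'.
Proof.
by apply: pb_ext; rewrite compA ?pb1_pair ?pb2_pair.
Qed.

Lemma pbpair_eq (A B E : C) (f : hom A E) (g : hom B E) (T : C)
    (u u' : hom T A) (v v' : hom T B)
    (h : f ∘ u = g ∘ v) (h' : f ∘ u' = g ∘ v') :
  u = u' -> v = v' -> pbpair h = pbpair h'.
Proof. by move=> uu' vv'; apply: pb_ext; rewrite ?pb1_pair ?pb2_pair. Qed.

Definition cprod (A B : C) : C := pb (bang A) (bang B).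
Definition cpair (T A B : C) (u : hom T A) (v : hom T B) :
  hom T (cprod A B) := pbpair (bang_uniq (bang A ∘ u) (bang B ∘ v)).

Record slice_ob (X : C) := SliceOb { sl_dom : C; sl_map : hom sl_dom X }.

Program Definition slice (X : C) : category :=
  @Category (slice_ob X)
    (fun A B => {f : hom (sl_dom A) (sl_dom B) | sl_map B ∘ f = sl_map A})
    (fun A => exist _ (idm _) _)
    (fun A B E g f => exist _ (sval g ∘ sval f) _) _ _ _.
Next Obligation. by move=> *; apply: compm1. Qed.
Next Obligation. by move=> X A B E [g hg] [f hf] /=; rewrite compA hg. Qed.
Next Obligation. by move=> *; apply: eq_exist; apply: compA. Qed.
Next Obligation. by move=> X A B [f hf]; apply: eq_exist; apply: comp1m. Qed.
Next Obligation. by move=> X A B [f hf]; apply: eq_exist; apply: compm1. Qed.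

Lemma pullback_map_subproof (X Y : C) (f : hom Y X) (A B : slice X)
    (k : hom A B) :
  f ∘ pb1 f (sl_map A) = sl_map B ∘ (sval k ∘ pb2 f (sl_map A)).
Proof. by case: k => k hk /=; rewrite compA hk pb_sq. Qed.

Program Definition pullback_functor (X Y : C) (f : hom Y X) :
    functor (slice X) (slice Y) :=
  @Functor (slice X) (slice Y)
    (fun A => SliceOb (pb1 f (sl_map A)))
    (fun A B k => exist _ (pbpair (pullback_map_subproof f k)) _) _ _.
Next Obligation. by move=> *; apply: pb1_pair. Qed.
Next Obligation.
move=> X Y f A; apply: eq_exist; apply: pb_ext;
by rewrite ?pb1_pair ?pb2_pair /= ?comp1m ?compm1.
Qed.
Next Obligation.
move=> X Y f A B E g k; apply: eq_exist; apply: pb_ext; rewrite /= !compA.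
  by rewrite !pb1_pair.
by rewrite !pb2_pair -!compA pb2_pair.
Qed.

Definition effective_descent (X Y : C) (f : hom Y X) : Prop :=
  monadic (pullback_functor f).

End Pullbacks.

Arguments cprod {C} A B.
Arguments cpair {C T A B} u v.

(** * Internal categories *)

(** Composition is diagrammatic: [icm] sends a pair [(f, g)] with
    [d1 f = d0 g] to the composite "f, then g".  Laws are stated for
    generalized elements; the proofs of composability they quantify over
    always exist, and no statement depends on which proof is used. *)
Section InternalCategories.
Variable C : cartesian.

Record icat_data := ICatData {
  ic0 : C;
  ic1 : C;
  icd0 : hom ic1 ic0;
  icd1 : hom ic1 ic0;
  ici : hom ic0 ic1;
  icm : hom (pb icd1 icd0) ic1 }.

Definition mulc (A : icat_data) (T : C) (f g : hom T (ic1 A))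
  (h : icd1 A ∘ f = icd0 A ∘ g) : hom T (ic1 A) := icm A ∘ pbpair h.

Record icat := ICat {
  icat_dat :> icat_data;
  icd0i : icd0 icat_dat ∘ ici icat_dat = idm _;
  icd1i : icd1 icat_dat ∘ ici icat_dat = idm _;
  icd0m : icd0 icat_dat ∘ icm icat_dat = icd0 icat_dat ∘ pb1 _ _;
  icd1m : icd1 icat_dat ∘ icm icat_dat = icd1 icat_dat ∘ pb2 _ _;
  icm1l : forall (T : C) (f : hom T (ic1 icat_dat))
    (h : icd1 icat_dat ∘ (ici icat_dat ∘ (icd0 icat_dat ∘ f))
         = icd0 icat_dat ∘ f),
    mulc h = f;
  icm1r : forall (T : C) (f : hom T (ic1 icat_dat))
    (h : icd1 icat_dat ∘ f
         = icd0 icat_dat ∘ (ici icat_dat ∘ (icd1 icat_dat ∘ f))),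
    mulc h = f;
  icmA : forall (T : C) (f g k : hom T (ic1 icat_dat))
    (hfg : icd1 icat_dat ∘ f = icd0 icat_dat ∘ g)
    (hgk : icd1 icat_dat ∘ g = icd0 icat_dat ∘ k)
    (h1 : icd1 icat_dat ∘ f = icd0 icat_dat ∘ mulc hgk)
    (h2 : icd1 icat_dat ∘ mulc hfg = icd0 icat_dat ∘ k),
    mulc h1 = mulc h2 }.

Record igroupoid := IGroupoid {
  igr_cat :> icat;
  igr_inv : hom (ic1 igr_cat) (ic1 igr_cat);
  igr_d0inv : icd0 igr_cat ∘ igr_inv = icd1 igr_cat;
  igr_d1inv : icd1 igr_cat ∘ igr_inv = icd0 igr_cat;
  igr_mulV : forall (T : C) (f : hom T (ic1 igr_cat))
    (h : icd1 igr_cat ∘ f = icd0 igr_cat ∘ (igr_inv ∘ f)),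
    mulc h = ici igr_cat ∘ (icd0 igr_cat ∘ f);
  igr_mulVl : forall (T : C) (f : hom T (ic1 igr_cat))
    (h : icd1 igr_cat ∘ (igr_inv ∘ f) = icd0 igr_cat ∘ f),
    mulc h = ici igr_cat ∘ (icd1 igr_cat ∘ f) }.

Record ifunctor (A B : icat) := IFunctor {
  if0 : hom (ic0 A) (ic0 B);
  if1 : hom (ic1 A) (ic1 B);
  if_d0 : icd0 B ∘ if1 = if0 ∘ icd0 A;
  if_d1 : icd1 B ∘ if1 = if0 ∘ icd1 A;
  if_i : if1 ∘ ici A = ici B ∘ if0;
  if_m : forall (T : C) (f g : hom T (ic1 A)) (h : icd1 A ∘ f = icd0 A ∘ g)
    (h' : icd1 B ∘ (if1 ∘ f) = icd0 B ∘ (if1 ∘ g)),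
    if1 ∘ mulc h = mulc h' }.

Record inattrans (A B : icat) (F G : ifunctor A B) := INatTrans {
  intc : hom (ic0 A) (ic1 B);
  intc_d0 : icd0 B ∘ intc = if0 F;
  intc_d1 : icd1 B ∘ intc = if0 G;
  intc_nat : forall (T : C) (f : hom T (ic1 A))
    (h : icd1 B ∘ (if1 F ∘ f) = icd0 B ∘ (intc ∘ (icd1 A ∘ f)))
    (h' : icd1 B ∘ (intc ∘ (icd0 A ∘ f)) = icd0 B ∘ (if1 G ∘ f)),
    mulc h = mulc h' }.

(** ** Calculus of generalized elements *)

Lemma mulc_pre (A : icat_data) (S T : C) (f g : hom T (ic1 A))
    (h : icd1 A ∘ f = icd0 A ∘ g) (t : hom S T)
    (h' : icd1 A ∘ (f ∘ t) = icd0 A ∘ (g ∘ t)) :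
  mulc h ∘ t = mulc h'.
Proof. by rewrite /mulc -compA (pbpair_pre _ h'). Qed.

Lemma mulc_eq (A : icat_data) (T : C) (f f' g g' : hom T (ic1 A))
    (h : icd1 A ∘ f = icd0 A ∘ g) (h' : icd1 A ∘ f' = icd0 A ∘ g') :
  f = f' -> g = g' -> mulc h = mulc h'.
Proof. by move=> ff gg; congr comp; apply: pbpair_eq. Qed.

Lemma d0mulc (A : icat) (T : C) (f g : hom T (ic1 A))
    (h : icd1 A ∘ f = icd0 A ∘ g) : icd0 A ∘ mulc h = icd0 A ∘ f.
Proof. by rewrite /mulc compA icd0m -compA pb1_pair. Qed.

Lemma d1mulc (A : icat) (T : C) (f g : hom T (ic1 A))
    (h : icd1 A ∘ f = icd0 A ∘ g) : icd1 A ∘ mulc h = icd1 A ∘ g.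
Proof. by rewrite /mulc compA icd1m -compA pb2_pair. Qed.

Lemma d0i (A : icat) (T : C) (x : hom T (ic0 A)) : icd0 A ∘ (ici A ∘ x) = x.
Proof. by rewrite compA icd0i comp1m. Qed.

Lemma d1i (A : icat) (T : C) (x : hom T (ic0 A)) : icd1 A ∘ (ici A ∘ x) = x.
Proof. by rewrite compA icd1i comp1m. Qed.

Lemma mulc_idl (A : icat) (T : C) (e f : hom T (ic1 A))
    (h : icd1 A ∘ e = icd0 A ∘ f) :
  e = ici A ∘ (icd0 A ∘ f) -> mulc h = f.
Proof. by move=> he; subst e; apply: icm1l. Qed.

Lemma mulc_idr (A : icat) (T : C) (e f : hom T (ic1 A))
    (h : icd1 A ∘ f = icd0 A ∘ e) :
  e = ici A ∘ (icd1 A ∘ f) -> mulc h = f.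
Proof. by move=> he; subst e; apply: icm1r. Qed.

Program Definition ifunctor_comp (A B E : icat) (G : ifunctor B E)
    (F : ifunctor A B) : ifunctor A E :=
  @IFunctor A E (if0 G ∘ if0 F) (if1 G ∘ if1 F) _ _ _ _.
Next Obligation. by move=> *; rewrite compA if_d0 -!compA if_d0. Qed.
Next Obligation. by move=> *; rewrite compA if_d1 -!compA if_d1. Qed.
Next Obligation. by move=> *; rewrite -compA if_i !compA if_i. Qed.
Next Obligation.
move=> A B E G F T f g h h'.
have k : icd1 B ∘ (if1 F ∘ f) = icd0 B ∘ (if1 F ∘ g).
  by rewrite !compA if_d1 if_d0 -!compA h.
have k' : icd1 E ∘ (if1 G ∘ (if1 F ∘ f)) = icd0 E ∘ (if1 G ∘ (if1 F ∘ g)).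
  by rewrite compA if_d1 [in RHS]compA if_d0 -!(compA (if0 G)) k.
by rewrite -compA (if_m _ k) (if_m _ k'); apply: mulc_eq; rewrite compA.
Qed.

(** ** The arrow category *)

(** A generalized element of [pb m m] is a commuting square
    [((u, k), (h, v))], [u; k = h; v]: a morphism from [u] to [v] with
    domain component [h] and codomain component [k]. *)
Section ArrowCategory.
Variable A : icat.

Definition arr1 : C := pb (icm A) (icm A).
Definition arr_src : hom arr1 (ic1 A) := pb1 _ _ ∘ pb1 _ _.
Definition arr_cod : hom arr1 (ic1 A) := pb2 _ _ ∘ pb1 _ _.
Definition arr_dom : hom arr1 (ic1 A) := pb1 _ _ ∘ pb2 _ _.
Definition arr_tgt : hom arr1 (ic1 A) := pb2 _ _ ∘ pb2 _ _.

Definition square (T : C) (u k h v : hom T (ic1 A))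
    (huk : icd1 A ∘ u = icd0 A ∘ k) (hhv : icd1 A ∘ h = icd0 A ∘ v)
    (e : mulc huk = mulc hhv) : hom T arr1 := pbpair e.

Lemma src_square (T : C) (u k h v : hom T (ic1 A)) huk hhv e :
  arr_src ∘ @square T u k h v huk hhv e = u.
Proof. by rewrite /arr_src -compA !pb1_pair. Qed.
Lemma cod_square (T : C) (u k h v : hom T (ic1 A)) huk hhv e :
  arr_cod ∘ @square T u k h v huk hhv e = k.
Proof. by rewrite /arr_cod -compA pb1_pair pb2_pair. Qed.
Lemma dom_square (T : C) (u k h v : hom T (ic1 A)) huk hhv e :
  arr_dom ∘ @square T u k h v huk hhv e = h.
Proof. by rewrite /arr_dom -compA pb2_pair pb1_pair. Qed.
Lemma tgt_square (T : C) (u k h v : hom T (ic1 A)) huk hhv e :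
  arr_tgt ∘ @square T u k h v huk hhv e = v.
Proof. by rewrite /arr_tgt -compA !pb2_pair. Qed.

Lemma square_ext (T : C) (s s' : hom T arr1) :
  arr_src ∘ s = arr_src ∘ s' -> arr_cod ∘ s = arr_cod ∘ s' ->
  arr_dom ∘ s = arr_dom ∘ s' -> arr_tgt ∘ s = arr_tgt ∘ s' -> s = s'.
Proof.
rewrite /arr_src /arr_cod /arr_dom /arr_tgt -!compA => *.
by apply: pb_ext; apply: pb_ext.
Qed.

Lemma src_cod (T : C) (s : hom T arr1) :
  icd1 A ∘ (arr_src ∘ s) = icd0 A ∘ (arr_cod ∘ s).
Proof. by rewrite /arr_src /arr_cod !compA pb_sq. Qed.

Lemma dom_tgt (T : C) (s : hom T arr1) :
  icd1 A ∘ (arr_dom ∘ s) = icd0 A ∘ (arr_tgt ∘ s).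
Proof. by rewrite /arr_dom /arr_tgt !compA pb_sq. Qed.

Lemma square_comm (T : C) (s : hom T arr1) : mulc (src_cod s) = mulc (dom_tgt s).
Proof.
have -> : mulc (src_cod s) = icm A ∘ (pb1 _ _ ∘ s).
  by congr comp; apply: pb_ext; rewrite ?pb1_pair ?pb2_pair !compA.
have -> : mulc (dom_tgt s) = icm A ∘ (pb2 _ _ ∘ s).
  by congr comp; apply: pb_ext; rewrite ?pb1_pair ?pb2_pair !compA.
by rewrite !compA pb_sq.
Qed.

Lemma d0src (T : C) (s : hom T arr1) :
  icd0 A ∘ (arr_src ∘ s) = icd0 A ∘ (arr_dom ∘ s).
Proof. by have := congr1 (comp (icd0 A)) (square_comm s); rewrite !d0mulc. Qed.

Lemma d1cod (T : C) (s : hom T arr1) :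
  icd1 A ∘ (arr_cod ∘ s) = icd1 A ∘ (arr_tgt ∘ s).
Proof. by have := congr1 (comp (icd1 A)) (square_comm s); rewrite !d1mulc. Qed.

Section SquareComposition.
Variables (T : C) (s s' : hom T arr1).
Hypothesis hs : arr_tgt ∘ s = arr_src ∘ s'.

Lemma sqm_cod : icd1 A ∘ (arr_cod ∘ s) = icd0 A ∘ (arr_cod ∘ s').
Proof. by rewrite d1cod hs src_cod. Qed.
Lemma sqm_dom : icd1 A ∘ (arr_dom ∘ s) = icd0 A ∘ (arr_dom ∘ s').
Proof. by rewrite dom_tgt hs d0src. Qed.
Lemma sqm_src : icd1 A ∘ (arr_src ∘ s) = icd0 A ∘ mulc sqm_cod.
Proof. by rewrite d0mulc src_cod. Qed.
Lemma sqm_tgt : icd1 A ∘ mulc sqm_dom = icd0 A ∘ (arr_tgt ∘ s').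
Proof. by rewrite d1mulc dom_tgt. Qed.

Lemma sqm_comm : mulc sqm_src = mulc sqm_tgt.
Proof.
have h1 : icd1 A ∘ mulc (src_cod s) = icd0 A ∘ (arr_cod ∘ s').
  by rewrite d1mulc sqm_cod.
rewrite (icmA (hfg := src_cod s) _ h1).
have h2 : icd1 A ∘ mulc (dom_tgt s) = icd0 A ∘ (arr_cod ∘ s').
  by rewrite -square_comm.
rewrite (mulc_eq h1 h2 (square_comm s) erefl).
have h3 : icd1 A ∘ (arr_tgt ∘ s) = icd0 A ∘ (arr_cod ∘ s').
  by rewrite hs src_cod.
have h4 : icd1 A ∘ (arr_dom ∘ s) = icd0 A ∘ mulc h3.
  by rewrite d0mulc dom_tgt.
rewrite -(icmA h4 h2).
have h5 : icd1 A ∘ (arr_dom ∘ s) = icd0 A ∘ mulc (dom_tgt s').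
  by rewrite d0mulc sqm_dom.
rewrite (mulc_eq h4 h5 erefl); first exact: icmA.
by rewrite -square_comm; apply: mulc_eq.
Qed.

Definition square_mul : hom T arr1 := square sqm_comm.

End SquareComposition.

Lemma square_id_h (T : C) (u : hom T (ic1 A)) :
  icd1 A ∘ (ici A ∘ (icd0 A ∘ u)) = icd0 A ∘ u.
Proof. exact: d1i. Qed.
Lemma square_id_k (T : C) (u : hom T (ic1 A)) :
  icd1 A ∘ u = icd0 A ∘ (ici A ∘ (icd1 A ∘ u)).
Proof. by rewrite d0i. Qed.
Lemma square_id_comm (T : C) (u : hom T (ic1 A)) :
  mulc (square_id_k u) = mulc (square_id_h u).
Proof. by rewrite icm1l icm1r. Qed.

Definition arrow_data : icat_data :=
  @ICatData (ic1 A) arr1 arr_src arr_tgt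
    (square (square_id_comm (idm (ic1 A))))
    (square_mul (pb_sq arr_tgt arr_src)).

Lemma arrow_mulc (T : C) (s s' : hom T arr1) (hs : arr_tgt ∘ s = arr_src ∘ s') :
  @mulc arrow_data T s s' hs = square_mul hs.
Proof.
rewrite /mulc /=; apply: square_ext; rewrite !compA.
- by rewrite !src_square -(compA arr_src) pb1_pair.
- rewrite !cod_square.
  have k : icd1 A ∘ (arr_cod ∘ pb1 arr_tgt arr_src ∘ pbpair hs)
         = icd0 A ∘ (arr_cod ∘ pb2 arr_tgt arr_src ∘ pbpair hs).
    by rewrite -!(compA arr_cod) pb1_pair pb2_pair (sqm_cod hs).
  by rewrite (mulc_pre _ k); apply: mulc_eq; rewrite -(compA arr_cod) ?pb1_pair ?pb2_pair.
- rewrite !dom_square.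
  have k : icd1 A ∘ (arr_dom ∘ pb1 arr_tgt arr_src ∘ pbpair hs)
         = icd0 A ∘ (arr_dom ∘ pb2 arr_tgt arr_src ∘ pbpair hs).
    by rewrite -!(compA arr_dom) pb1_pair pb2_pair (sqm_dom hs).
  by rewrite (mulc_pre _ k); apply: mulc_eq; rewrite -(compA arr_dom) ?pb1_pair ?pb2_pair.
- by rewrite !tgt_square -(compA arr_tgt) pb2_pair.
Qed.

Program Definition arrow : icat := @ICat arrow_data _ _ _ _ _ _ _.
Next Obligation. by rewrite /= src_square. Qed.
Next Obligation. by rewrite /= tgt_square. Qed.
Next Obligation. by rewrite /= src_square. Qed.
Next Obligation. by rewrite /= tgt_square. Qed.
Next Obligation.
move=> T s h; rewrite arrow_mulc; apply: square_ext; rewrite /=.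
- by rewrite src_square !compA src_square comp1m.
- rewrite cod_square; apply: mulc_idl.
  by rewrite compA cod_square compm1 -(compA (ici A)) src_cod.
- rewrite dom_square; apply: mulc_idl.
  by rewrite compA dom_square compm1 -(compA (ici A)) d0src.
- by rewrite tgt_square.
Qed.
Next Obligation.
move=> T s h; rewrite arrow_mulc; apply: square_ext; rewrite /=.
- by rewrite src_square.
- rewrite cod_square; apply: mulc_idr.
  by rewrite compA cod_square compm1 -(compA (ici A)) d1cod.
- rewrite dom_square; apply: mulc_idr.
  by rewrite compA dom_square compm1 -(compA (ici A)) dom_tgt.
- by rewrite tgt_square !compA tgt_square comp1m.
Qed.
Next Obligation.
move=> T f g k hfg hgk h1 h2; rewrite (arrow_mulc h1) (arrow_mulc h2); apply: square_ext.
- by rewrite !src_square arrow_mulc src_square.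
- rewrite !cod_square.
  have e1 : icd1 A ∘ (arr_cod ∘ f) = icd0 A ∘ mulc (sqm_cod hgk).
    by rewrite d0mulc (sqm_cod hfg).
  have e2 : icd1 A ∘ mulc (sqm_cod hfg) = icd0 A ∘ (arr_cod ∘ k).
    by rewrite d1mulc (sqm_cod hgk).
  transitivity (mulc e1); first by apply: mulc_eq; rewrite ?arrow_mulc ?cod_square.
  by rewrite (icmA e1 e2); apply: mulc_eq; rewrite ?arrow_mulc ?cod_square.
- rewrite !dom_square.
  have e1 : icd1 A ∘ (arr_dom ∘ f) = icd0 A ∘ mulc (sqm_dom hgk).
    by rewrite d0mulc (sqm_dom hfg).
  have e2 : icd1 A ∘ mulc (sqm_dom hfg) = icd0 A ∘ (arr_dom ∘ k).
    by rewrite d1mulc (sqm_dom hgk).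
  transitivity (mulc e1); first by apply: mulc_eq; rewrite ?arrow_mulc ?dom_square.
  by rewrite (icmA e1 e2); apply: mulc_eq; rewrite ?arrow_mulc ?dom_square.
- by rewrite !tgt_square arrow_mulc tgt_square.
Qed.

Program Definition arrow_domain : ifunctor arrow A :=
  @IFunctor arrow A (icd0 A) arr_dom _ _ _ _.
Next Obligation. by have := d0src (idm arr1); rewrite !compm1. Qed.
Next Obligation. by have := dom_tgt (idm arr1); rewrite !compm1. Qed.
Next Obligation. by rewrite /= dom_square compm1. Qed.
Next Obligation.
by move=> T f g h h'; rewrite arrow_mulc dom_square; apply: mulc_eq.
Qed.

Program Definition arrow_codomain : ifunctor arrow A :=
  @IFunctor arrow A (icd1 A) arr_cod _ _ _ _.
Next Obligation. by have := src_cod (idm arr1); rewrite !compm1. Qed.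
Next Obligation. by have := d1cod (idm arr1); rewrite !compm1. Qed.
Next Obligation. by rewrite /= cod_square compm1. Qed.
Next Obligation.
by move=> T f g h h'; rewrite arrow_mulc cod_square; apply: mulc_eq.
Qed.

End ArrowCategory.

(** ** The core *)

Lemma cpair1 (T A B : C) (u : hom T A) (v : hom T B) :
  pb1 (bang A) (bang B) ∘ cpair u v = u.
Proof. exact: pb1_pair. Qed.
Lemma cpair2 (T A B : C) (u : hom T A) (v : hom T B) :
  pb2 (bang A) (bang B) ∘ cpair u v = v.
Proof. exact: pb2_pair. Qed.
Lemma cpair_pre (S T A B : C) (u : hom T A) (v : hom T B) (t : hom S T) :
  cpair u v ∘ t = cpair (u ∘ t) (v ∘ t).
Proof. by apply: pb_ext; rewrite compA ?cpair1 ?cpair2. Qed.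

Section Core.
Variable A : icat.

(** Generalized elements of [cyc]: pairs of opposite morphisms [(f, g)]. *)
Definition cyc : C :=
  pb (cpair (icd0 A) (icd1 A)) (cpair (icd1 A) (icd0 A)).

Lemma cyc_gf : icd1 A ∘ (pb2 _ _ : hom cyc _) = icd0 A ∘ pb1 _ _.
Proof.
have := congr1 (comp (pb1 _ _)) (pb_sq (cpair (icd0 A) (icd1 A))
  (cpair (icd1 A) (icd0 A))).
by rewrite !compA !cpair1.
Qed.
Lemma cyc_fg : icd1 A ∘ (pb1 _ _ : hom cyc _) = icd0 A ∘ pb2 _ _.
Proof.
have := congr1 (comp (pb2 _ _)) (pb_sq (cpair (icd0 A) (icd1 A))
  (cpair (icd1 A) (icd0 A))).
by rewrite !compA !cpair2.
Qed.

(** Generalized elements of [isos]: pairs [(f, g)] such that [f; g] and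
    [g; f] are identities, i.e. isomorphisms with their inverses. *)
Definition isos : C :=
  pb (cpair (mulc cyc_fg) (mulc cyc_gf))
     (cpair (ici A ∘ pb1 (bang (ic0 A)) (bang (ic0 A)))
            (ici A ∘ pb2 (bang (ic0 A)) (bang (ic0 A)))).
Definition fwd : hom isos (ic1 A) := pb1 _ _ ∘ pb1 _ _.
Definition bwd : hom isos (ic1 A) := pb2 _ _ ∘ pb1 _ _.

Section IsoElements.
Variables (T : C) (s : hom T isos).

Lemma fwd_bwd : icd1 A ∘ (fwd ∘ s) = icd0 A ∘ (bwd ∘ s).
Proof. by rewrite /fwd /bwd !compA cyc_fg. Qed.
Lemma bwd_fwd : icd1 A ∘ (bwd ∘ s) = icd0 A ∘ (fwd ∘ s).
Proof. by rewrite /fwd /bwd !compA cyc_gf. Qed.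

Lemma isos_fst :
  mulc cyc_fg ∘ pb1 _ _ ∘ s
  = ici A ∘ (pb1 (bang (ic0 A)) (bang (ic0 A)) ∘ (pb2 _ _ ∘ s)).
Proof.
have := congr1 (fun t => pb1 _ _ ∘ t ∘ s) (pb_sq
  (cpair (mulc cyc_fg) (mulc cyc_gf))
  (cpair (ici A ∘ pb1 (bang (ic0 A)) (bang (ic0 A)))
         (ici A ∘ pb2 (bang (ic0 A)) (bang (ic0 A))))).
by rewrite /= !compA !cpair1 => ->.
Qed.
Lemma isos_snd :
  mulc cyc_gf ∘ pb1 _ _ ∘ s
  = ici A ∘ (pb2 (bang (ic0 A)) (bang (ic0 A)) ∘ (pb2 _ _ ∘ s)).
Proof.
have := congr1 (fun t => pb2 _ _ ∘ t ∘ s) (pb_sq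
  (cpair (mulc cyc_fg) (mulc cyc_gf))
  (cpair (ici A ∘ pb1 (bang (ic0 A)) (bang (ic0 A)))
         (ici A ∘ pb2 (bang (ic0 A)) (bang (ic0 A))))).
by rewrite /= !compA !cpair2 => ->.
Qed.

Lemma mul_fwd : mulc fwd_bwd = ici A ∘ (icd0 A ∘ (fwd ∘ s)).
Proof.
have e : mulc fwd_bwd = mulc cyc_fg ∘ (pb1 _ _ ∘ s).
  have k : icd1 A ∘ (pb1 _ _ ∘ (pb1 _ _ ∘ s : hom T cyc))
         = icd0 A ∘ (pb2 _ _ ∘ (pb1 _ _ ∘ s)).
    by have := fwd_bwd; rewrite /fwd /bwd -!compA.
  by rewrite (mulc_pre _ k); apply: mulc_eq; rewrite !compA.
by have := d0mulc fwd_bwd; rewrite e (compA (mulc cyc_fg)) isos_fst d0i => ->.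
Qed.
Lemma mul_bwd : mulc bwd_fwd = ici A ∘ (icd1 A ∘ (fwd ∘ s)).
Proof.
have e : mulc bwd_fwd = mulc cyc_gf ∘ (pb1 _ _ ∘ s).
  have k : icd1 A ∘ (pb2 _ _ ∘ (pb1 _ _ ∘ s : hom T cyc))
         = icd0 A ∘ (pb1 _ _ ∘ (pb1 _ _ ∘ s)).
    by have := bwd_fwd; rewrite /fwd /bwd -!compA.
  by rewrite (mulc_pre _ k); apply: mulc_eq; rewrite !compA.
by have := d1mulc bwd_fwd; rewrite e (compA (mulc cyc_gf)) isos_snd d1i => ->.
Qed.

End IsoElements.

Section IsoMk.
Variables (T : C) (f g : hom T (ic1 A)).
Hypotheses (hfg : icd1 A ∘ f = icd0 A ∘ g) (hgf : icd1 A ∘ g = icd0 A ∘ f).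
Hypotheses (efg : mulc hfg = ici A ∘ (icd0 A ∘ f))
           (egf : mulc hgf = ici A ∘ (icd0 A ∘ g)).

Lemma iso_mk_cyc :
  cpair (icd0 A) (icd1 A) ∘ f = cpair (icd1 A) (icd0 A) ∘ g.
Proof. by rewrite !cpair_pre hfg hgf. Qed.

Lemma iso_mk_isos :
  cpair (mulc cyc_fg) (mulc cyc_gf) ∘ pbpair iso_mk_cyc
  = cpair (ici A ∘ pb1 (bang (ic0 A)) (bang (ic0 A)))
          (ici A ∘ pb2 (bang (ic0 A)) (bang (ic0 A)))
    ∘ cpair (icd0 A ∘ f) (icd0 A ∘ g).
Proof.
rewrite !cpair_pre -!(compA (ici A)) cpair1 cpair2 -efg -egf.
have k1 : icd1 A ∘ (pb1 _ _ ∘ (pbpair iso_mk_cyc : hom T cyc))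
        = icd0 A ∘ (pb2 _ _ ∘ pbpair iso_mk_cyc).
  by rewrite pb1_pair pb2_pair.
have k2 : icd1 A ∘ (pb2 _ _ ∘ (pbpair iso_mk_cyc : hom T cyc))
        = icd0 A ∘ (pb1 _ _ ∘ pbpair iso_mk_cyc).
  by rewrite pb1_pair pb2_pair.
rewrite (mulc_pre _ k1) (mulc_pre _ k2).
by congr cpair; apply: mulc_eq; rewrite ?pb1_pair ?pb2_pair.
Qed.

Definition iso_mk : hom T isos := pbpair iso_mk_isos.

Lemma fwd_mk : fwd ∘ iso_mk = f.
Proof. by rewrite /fwd -compA !pb1_pair. Qed.
Lemma bwd_mk : bwd ∘ iso_mk = g.
Proof. by rewrite /bwd -compA pb1_pair pb2_pair. Qed.

End IsoMk.

Lemma isos_ext (T : C) (s s' : hom T isos) : fwd ∘ s = fwd ∘ s' -> s = s'.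
Proof.
move=> e.
have hb : icd1 A ∘ (bwd ∘ s) = icd0 A ∘ (fwd ∘ s') by rewrite bwd_fwd e.
have e' : bwd ∘ s = bwd ∘ s'.
  have h1 : icd1 A ∘ (bwd ∘ s) = icd0 A ∘ mulc (fwd_bwd s').
    by rewrite d0mulc.
  have h2 : icd1 A ∘ mulc hb = icd0 A ∘ (bwd ∘ s').
    by rewrite d1mulc fwd_bwd.
  have e1 : mulc h1 = bwd ∘ s.
    by apply: mulc_idr; rewrite mul_fwd hb.
  have e2 : mulc h2 = bwd ∘ s'.
    apply: mulc_idl; rewrite -fwd_bwd.
    by transitivity (mulc (bwd_fwd s)); [exact: mulc_eq | rewrite mul_bwd e].
  by rewrite -[LHS]e1 -[RHS]e2; apply: icmA.
have p1 : pb1 _ _ ∘ s = pb1 _ _ ∘ s'.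
  by move: e e'; rewrite /fwd /bwd -!compA; apply: pb_ext.
apply: pb_ext => //; apply: pb_ext.
- have := isos_fst s'; rewrite -compA -p1 compA isos_fst.
  by move/(congr1 (comp (icd0 A))); rewrite !d0i.
- have := isos_snd s'; rewrite -compA -p1 compA isos_snd.
  by move/(congr1 (comp (icd0 A))); rewrite !d0i.
Qed.

Section IsoMul.
Variables (T : C) (s s' : hom T isos).
Hypothesis hs : icd1 A ∘ fwd ∘ s = icd0 A ∘ fwd ∘ s'.

Lemma isos_mulf : icd1 A ∘ (fwd ∘ s) = icd0 A ∘ (fwd ∘ s').
Proof. by rewrite 2!(compA _ fwd). Qed.
Lemma isos_mulb : icd1 A ∘ (bwd ∘ s') = icd0 A ∘ (bwd ∘ s).
Proof. by rewrite bwd_fwd -isos_mulf fwd_bwd. Qed.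
Lemma isos_mul1 : icd1 A ∘ mulc isos_mulf = icd0 A ∘ mulc isos_mulb.
Proof. by rewrite d1mulc d0mulc fwd_bwd. Qed.
Lemma isos_mul2 : icd1 A ∘ mulc isos_mulb = icd0 A ∘ mulc isos_mulf.
Proof. by rewrite d1mulc d0mulc bwd_fwd. Qed.

Lemma isos_mul_fb : mulc isos_mul1 = ici A ∘ (icd0 A ∘ mulc isos_mulf).
Proof.
have h1 : icd1 A ∘ (fwd ∘ s') = icd0 A ∘ mulc isos_mulb.
  by rewrite d0mulc fwd_bwd.
have h2 : icd1 A ∘ (fwd ∘ s) = icd0 A ∘ mulc h1.
  by rewrite d0mulc isos_mulf.
rewrite -(icmA h2 isos_mul1) d0mulc -mul_fwd; apply: mulc_eq => //.
have h3 : icd1 A ∘ mulc (fwd_bwd s') = icd0 A ∘ (bwd ∘ s).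
  by rewrite d1mulc isos_mulb.
rewrite (icmA h1 h3); apply: mulc_idl.
by rewrite mul_fwd -isos_mulf fwd_bwd.
Qed.

Lemma isos_mul_bf : mulc isos_mul2 = ici A ∘ (icd0 A ∘ mulc isos_mulb).
Proof.
have h1 : icd1 A ∘ (bwd ∘ s) = icd0 A ∘ mulc isos_mulf.
  by rewrite d0mulc bwd_fwd.
have h2 : icd1 A ∘ (bwd ∘ s') = icd0 A ∘ mulc h1.
  by rewrite d0mulc isos_mulb.
rewrite -(icmA h2 isos_mul2) d0mulc -fwd_bwd -mul_bwd; apply: mulc_eq => //.
have h3 : icd1 A ∘ mulc (bwd_fwd s) = icd0 A ∘ (fwd ∘ s').
  by rewrite d1mulc isos_mulf.
rewrite (icmA h1 h3); apply: mulc_idl.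
by rewrite mul_bwd isos_mulf.
Qed.

Definition isos_mul : hom T isos := iso_mk isos_mul_fb isos_mul_bf.

End IsoMul.

Section IsoId.
Variables (T : C) (x : hom T (ic0 A)).
Lemma isos_id_h : icd1 A ∘ (ici A ∘ x) = icd0 A ∘ (ici A ∘ x).
Proof. by rewrite d0i d1i. Qed.
Lemma isos_id_e : mulc isos_id_h = ici A ∘ (icd0 A ∘ (ici A ∘ x)).
Proof. by rewrite d0i; apply: mulc_idl; rewrite d0i. Qed.
Definition isos_id : hom T isos := iso_mk isos_id_e isos_id_e.
End IsoId.

Definition core_data : icat_data :=
  @ICatData (ic0 A) isos (icd0 A ∘ fwd) (icd1 A ∘ fwd)
    (isos_id (idm (ic0 A))) (isos_mul (pb_sq _ _)).

Lemma core_mulc (T : C) (s s' : hom T isos)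
    (hs : icd1 A ∘ fwd ∘ s = icd0 A ∘ fwd ∘ s') :
  fwd ∘ @mulc core_data T s s' hs = mulc (isos_mulf hs).
Proof.
rewrite /mulc /= compA fwd_mk.
have k : icd1 A ∘ (fwd ∘ pb1 _ _ ∘ pbpair hs)
       = icd0 A ∘ (fwd ∘ pb2 _ _ ∘ pbpair hs).
  by rewrite -!(compA fwd) pb1_pair pb2_pair (isos_mulf hs).
rewrite (mulc_pre _ k).
by apply: mulc_eq; rewrite -(compA fwd) ?pb1_pair ?pb2_pair.
Qed.

Program Definition core_cat : icat := @ICat core_data _ _ _ _ _ _ _.
Next Obligation. by rewrite /= -compA fwd_mk d0i. Qed.
Next Obligation. by rewrite /= -compA fwd_mk d1i. Qed.
Next Obligation. by rewrite /= -(compA _ fwd) fwd_mk d0mulc (compA _ fwd). Qed.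
Next Obligation. by rewrite /= -(compA _ fwd) fwd_mk d1mulc (compA _ fwd). Qed.
Next Obligation.
move=> T s h; apply: isos_ext; rewrite (core_mulc h); apply: mulc_idl.
by rewrite /= (compA fwd) fwd_mk compm1 -(compA _ fwd).
Qed.
Next Obligation.
move=> T s h; apply: isos_ext; rewrite (core_mulc h); apply: mulc_idr.
by rewrite /= (compA fwd) fwd_mk compm1 -(compA _ fwd).
Qed.
Next Obligation.
move=> T f g k hfg hgk h1 h2; apply: isos_ext.
rewrite (core_mulc h1) (core_mulc h2).
have e1 : icd1 A ∘ (fwd ∘ f) = icd0 A ∘ mulc (isos_mulf hgk).
  by rewrite d0mulc (isos_mulf hfg).
have e2 : icd1 A ∘ mulc (isos_mulf hfg) = icd0 A ∘ (fwd ∘ k).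
  by rewrite d1mulc (isos_mulf hgk).
transitivity (mulc e1); first by apply: mulc_eq; rewrite ?core_mulc.
by rewrite (icmA e1 e2); apply: mulc_eq; rewrite ?core_mulc.
Qed.

Lemma core_inv_bf :
  mulc (bwd_fwd (idm isos)) = ici A ∘ (icd0 A ∘ (bwd ∘ idm isos)).
Proof. by rewrite mul_bwd fwd_bwd. Qed.

Definition core_inv : hom isos isos := iso_mk core_inv_bf (mul_fwd (idm isos)).

Lemma fwd_core_inv : fwd ∘ core_inv = bwd.
Proof. by rewrite fwd_mk compm1. Qed.

Program Definition core : igroupoid := @IGroupoid core_cat core_inv _ _ _ _.
Next Obligation.
rewrite /= -compA fwd_core_inv.
by have := fwd_bwd (idm isos); rewrite !compm1.
Qed.
Next Obligation.
rewrite /= -compA fwd_core_inv.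
by have := bwd_fwd (idm isos); rewrite !compm1.
Qed.
Next Obligation.
move=> T f h; apply: isos_ext; rewrite (core_mulc h).
transitivity (ici A ∘ (icd0 A ∘ (fwd ∘ f))).
  by rewrite -mul_fwd; apply: mulc_eq; rewrite ?(compA fwd) ?fwd_core_inv.
by rewrite /= (compA fwd) fwd_mk compm1 -(compA _ fwd).
Qed.
Next Obligation.
move=> T f h; apply: isos_ext; rewrite (core_mulc h).
transitivity (ici A ∘ (icd1 A ∘ (fwd ∘ f))).
  by rewrite -mul_bwd; apply: mulc_eq; rewrite ?(compA fwd) ?fwd_core_inv.
by rewrite /= (compA fwd) fwd_mk compm1 -(compA _ fwd).
Qed.

Program Definition core_incl : ifunctor core A :=
  @IFunctor core A (idm _) fwd _ _ _ _.
Next Obligation. by rewrite /= comp1m. Qed.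
Next Obligation. by rewrite /= comp1m. Qed.
Next Obligation. by rewrite /= fwd_mk. Qed.
Next Obligation. by move=> T f g h h'; rewrite core_mulc; apply: mulc_eq. Qed.

End Core.

Section CoreMap.
Variables (A B : icat) (F : ifunctor A B).

Lemma core_map_fb :
  icd1 B ∘ (if1 F ∘ fwd A) = icd0 B ∘ (if1 F ∘ bwd A).
Proof.
rewrite !compA if_d0 if_d1 -!compA.
by have := fwd_bwd (idm (isos A)); rewrite !compm1 => ->.
Qed.
Lemma core_map_bf :
  icd1 B ∘ (if1 F ∘ bwd A) = icd0 B ∘ (if1 F ∘ fwd A).
Proof.
rewrite !compA if_d0 if_d1 -!compA.
by have := bwd_fwd (idm (isos A)); rewrite !compm1 => ->.
Qed.
Lemma core_map_e1 :
  mulc core_map_fb = ici B ∘ (icd0 B ∘ (if1 F ∘ fwd A)).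
Proof.
have h : icd1 B ∘ (if1 F ∘ (fwd A ∘ idm _)) = icd0 B ∘ (if1 F ∘ (bwd A ∘ idm _)).
  by rewrite !compm1 core_map_fb.
transitivity (mulc h); first by apply: mulc_eq; rewrite compm1.
rewrite -(if_m (fwd_bwd (idm (isos A))) h) mul_fwd compm1.
by rewrite compA if_i -compA; congr comp; rewrite !compA if_d0.
Qed.
Lemma core_map_e2 :
  mulc core_map_bf = ici B ∘ (icd0 B ∘ (if1 F ∘ bwd A)).
Proof.
have h : icd1 B ∘ (if1 F ∘ (bwd A ∘ idm _)) = icd0 B ∘ (if1 F ∘ (fwd A ∘ idm _)).
  by rewrite !compm1 core_map_bf.
transitivity (mulc h); first by apply: mulc_eq; rewrite compm1.
rewrite -(if_m (bwd_fwd (idm (isos A))) h) mul_bwd fwd_bwd compm1.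
by rewrite compA if_i -compA; congr comp; rewrite !compA if_d0.
Qed.

Program Definition core_map : ifunctor (core A) (core B) :=
  @IFunctor (core A) (core B) (if0 F) (iso_mk core_map_e1 core_map_e2) _ _ _ _.
Next Obligation. by rewrite /= -compA fwd_mk !compA if_d0. Qed.
Next Obligation. by rewrite /= -compA fwd_mk !compA if_d1. Qed.
Next Obligation.
apply: isos_ext; rewrite /= !compA !fwd_mk -compA fwd_mk !compm1.
by rewrite if_i.
Qed.
Next Obligation.
move=> T f g h h'; apply: isos_ext.
rewrite (core_mulc (A := B) h') compA fwd_mk -compA (core_mulc (A := A) h).
have k : icd1 B ∘ (if1 F ∘ (fwd A ∘ f)) = icd0 B ∘ (if1 F ∘ (fwd A ∘ g)).
  rewrite compA if_d1 [in RHS]compA if_d0 -!(compA (if0 F)).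
  by rewrite (isos_mulf (A := A) h).
rewrite (if_m _ k); apply: mulc_eq; by rewrite [in RHS]compA fwd_mk compA.
Qed.

End CoreMap.

(** ** The groupoid of a kernel pair *)

Section KernelPair.
Variables (Y X : C) (p : hom Y X).

Lemma kp_mul_subproof :
  p ∘ (pb1 p p ∘ pb1 (pb2 p p) (pb1 p p))
  = p ∘ (pb2 p p ∘ pb2 (pb2 p p) (pb1 p p)).
Proof. by rewrite compA pb_sq -compA pb_sq compA pb_sq -compA. Qed.

Definition kp_data : icat_data :=
  @ICatData Y (pb p p) (pb1 p p) (pb2 p p)
    (pbpair (erefl (p ∘ idm Y))) (pbpair kp_mul_subproof).

Lemma kp_mulc1 (T : C) (f g : hom T (pb p p)) (h : pb2 p p ∘ f = pb1 p p ∘ g) :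
  pb1 p p ∘ @mulc kp_data T f g h = pb1 p p ∘ f.
Proof. by rewrite /mulc /= compA pb1_pair -compA pb1_pair. Qed.
Lemma kp_mulc2 (T : C) (f g : hom T (pb p p)) (h : pb2 p p ∘ f = pb1 p p ∘ g) :
  pb2 p p ∘ @mulc kp_data T f g h = pb2 p p ∘ g.
Proof. by rewrite /mulc /= compA pb2_pair -compA pb2_pair. Qed.

Program Definition kp_cat : icat := @ICat kp_data _ _ _ _ _ _ _.
Next Obligation. exact: pb1_pair. Qed.
Next Obligation. exact: pb2_pair. Qed.
Next Obligation. exact: pb1_pair. Qed.
Next Obligation. exact: pb2_pair. Qed.
Next Obligation.
move=> T f h; apply: pb_ext; rewrite ?kp_mulc1 ?kp_mulc2 //.
by rewrite /= compA pb1_pair comp1m.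
Qed.
Next Obligation.
move=> T f h; apply: pb_ext; rewrite ?kp_mulc1 ?kp_mulc2 //.
by rewrite /= compA pb2_pair comp1m.
Qed.
Next Obligation.
by move=> *; apply: pb_ext; rewrite ?kp_mulc1 ?kp_mulc2.
Qed.

Program Definition kernel_pair : igroupoid :=
  @IGroupoid kp_cat (pbpair (esym (pb_sq p p))) _ _ _ _.
Next Obligation. exact: pb1_pair. Qed.
Next Obligation. exact: pb2_pair. Qed.
Next Obligation.
move=> T f h; apply: pb_ext; rewrite ?kp_mulc1 ?kp_mulc2 /= !compA.
  by rewrite pb1_pair comp1m.
by rewrite !pb2_pair comp1m.
Qed.
Next Obligation.
move=> T f h; apply: pb_ext; rewrite ?kp_mulc1 ?kp_mulc2 /= !compA.
  by rewrite !pb1_pair comp1m.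
by rewrite pb2_pair comp1m.
Qed.

End KernelPair.

Section KernelPairMap.
Variables (Y Z X : C) (p : hom Y X) (q : hom Z X) (s : hom Y Z).
Hypothesis hs : q ∘ s = p.

Lemma kp_map_subproof : q ∘ (s ∘ pb1 p p) = q ∘ (s ∘ pb2 p p).
Proof. by rewrite !compA hs pb_sq. Qed.

Program Definition kp_map : ifunctor (kernel_pair p) (kernel_pair q) :=
  @IFunctor (kernel_pair p) (kernel_pair q) s (pbpair kp_map_subproof) _ _ _ _.
Next Obligation. exact: pb1_pair. Qed.
Next Obligation. exact: pb2_pair. Qed.
Next Obligation.
apply: pb_ext; rewrite /= !compA ?pb1_pair ?pb2_pair -compA ?pb1_pair ?pb2_pair;
by rewrite compm1 comp1m.
Qed.
Next Obligation.
move=> T f g h h'; apply: pb_ext; rewrite ?(kp_mulc1 h') ?(kp_mulc2 h') !compA.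
  by rewrite !pb1_pair -!compA (kp_mulc1 h).
by rewrite !pb2_pair -!compA (kp_mulc2 h).
Qed.

End KernelPairMap.

End InternalCategories.

Arguments arrow {C} A.
Arguments core {C} A.
Arguments kernel_pair {C Y X} p.
Arguments arrow_domain {C} A.
Arguments arrow_codomain {C} A.
Arguments core_incl {C} A.

(** * Principal bundles *)

Section PrincipalBundles.
Variable C : cartesian.

Record bundle (G : igroupoid C) (X : C) := Bundle {
  bdl : C;
  bdl_x : hom bdl (ic0 G);
  bdl_p : hom bdl X;
  bdl_descent : effective_descent bdl_p;
  bdl_act : hom (pb (icd0 G) bdl_x) bdl;
  bdl_x_act : bdl_x ∘ bdl_act = icd1 G ∘ pb1 _ _;
  bdl_act1 : forall (T : C) (y : hom T bdl)
    (h : icd0 G ∘ (ici G ∘ (bdl_x ∘ y)) = bdl_x ∘ y),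
    bdl_act ∘ pbpair h = y;
  bdl_actM : forall (T : C) (g k : hom T (ic1 G)) (y : hom T bdl)
    (hgk : icd1 G ∘ g = icd0 G ∘ k)
    (hg : icd0 G ∘ g = bdl_x ∘ y)
    (h1 : icd0 G ∘ mulc hgk = bdl_x ∘ y)
    (h2 : icd0 G ∘ k = bdl_x ∘ (bdl_act ∘ pbpair hg)),
    bdl_act ∘ pbpair h1 = bdl_act ∘ pbpair h2;
  bdl_p_act : bdl_p ∘ bdl_act = bdl_p ∘ pb2 _ _;
  bdl_principal :
    is_iso (pbpair bdl_p_act : hom (pb (icd0 G) bdl_x) (pb bdl_p bdl_p)) }.

Record bundle_hom (G : igroupoid C) (X : C) (P Q : bundle G X) := BundleHom {
  bmap :> hom (bdl P) (bdl Q);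
  bmap_p : bdl_p Q ∘ bmap = bdl_p P;
  bmap_x : bdl_x Q ∘ bmap = bdl_x P;
  bmap_act : forall (T : C) (g : hom T (ic1 G)) (y : hom T (bdl P))
    (h : icd0 G ∘ g = bdl_x P ∘ y)
    (h' : icd0 G ∘ g = bdl_x Q ∘ (bmap ∘ y)),
    bmap ∘ (bdl_act P ∘ pbpair h) = bdl_act Q ∘ pbpair h' }.

(** ** The cocycle of a principal bundle *)

Section Cocycle.
Variables (G : igroupoid C) (X : C) (P : bundle G X).

Lemma act_inj (T : C) (g g' : hom T (ic1 G)) (y : hom T (bdl P))
    (h : icd0 G ∘ g = bdl_x P ∘ y) (h' : icd0 G ∘ g' = bdl_x P ∘ y) :
  bdl_act P ∘ pbpair h = bdl_act P ∘ pbpair h' -> g = g'.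
Proof.
move=> e; have [i [il _]] := bdl_principal P.
have e' : pbpair (bdl_p_act P) ∘ pbpair h = pbpair (bdl_p_act P) ∘ pbpair h'.
  by apply: pb_ext; rewrite !compA ?pb1_pair ?pb2_pair ?e // !pb2_pair.
have e2 : pbpair h = pbpair h'.
  by rewrite -[LHS]comp1m -[RHS]comp1m -il -!compA e'.
by have := congr1 (comp (pb1 _ _)) e2; rewrite !pb1_pair.
Qed.

(** [(p, p') |-> (g, p) |-> g], where [(g, p)] is the inverse image of
    [(p', p)] under [(a, pi_2)]. *)
Definition division : hom (pb (bdl_p P) (bdl_p P)) (ic1 G) :=
  pb1 _ _ ∘ sval (cid (bdl_principal P)) ∘ pbpair (esym (pb_sq _ _)).

Lemma division_d0 : icd0 G ∘ division = bdl_x P ∘ pb1 _ _.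
Proof.
rewrite /division; case: cid => i [il ir] /=.
have e : pb2 (icd0 G) (bdl_x P) ∘ i = pb2 _ _.
  by rewrite -[RHS]compm1 -ir compA pb2_pair.
by rewrite !compA pb_sq -(compA (bdl_x P)) e -compA pb2_pair.
Qed.

Lemma division_d0E (T : C) (s : hom T (pb (bdl_p P) (bdl_p P))) :
  icd0 G ∘ (division ∘ s) = bdl_x P ∘ (pb1 _ _ ∘ s).
Proof. by rewrite compA division_d0 -compA. Qed.

Lemma division_act (h : icd0 G ∘ division = bdl_x P ∘ pb1 _ _) :
  bdl_act P ∘ pbpair h = pb2 _ _.
Proof.
move: h; rewrite /division; case: cid => i [il ir] /= h.
have -> : pbpair h = i ∘ pbpair (esym (pb_sq _ _)).
  apply: pb_ext; rewrite ?pb1_pair ?pb2_pair compA //.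
  have -> : pb2 (icd0 G) (bdl_x P) ∘ i = pb2 _ _.
    by rewrite -[RHS]compm1 -ir compA pb2_pair.
  by rewrite pb2_pair.
have -> : bdl_act P = pb1 _ _ ∘ pbpair (bdl_p_act P) by rewrite pb1_pair.
by rewrite -compA (compA _ i) ir comp1m pb1_pair.
Qed.

Lemma division_actE (T : C) (s : hom T (pb (bdl_p P) (bdl_p P)))
    (h : icd0 G ∘ (division ∘ s) = bdl_x P ∘ (pb1 _ _ ∘ s)) :
  bdl_act P ∘ pbpair h = pb2 _ _ ∘ s.
Proof.
have e : pbpair division_d0 ∘ s = pbpair h by apply: pbpair_pre.
by rewrite -e compA division_act.
Qed.

Lemma divisionP (T : C) (s : hom T (pb (bdl_p P) (bdl_p P)))
    (g : hom T (ic1 G)) (h : icd0 G ∘ g = bdl_x P ∘ (pb1 _ _ ∘ s)) :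
  bdl_act P ∘ pbpair h = pb2 _ _ ∘ s -> division ∘ s = g.
Proof.
have k : icd0 G ∘ (division ∘ s) = bdl_x P ∘ (pb1 _ _ ∘ s).
  exact: division_d0E.
by move=> e; apply: (@act_inj _ _ _ _ k h); rewrite e division_actE.
Qed.

Program Definition cocycle : ifunctor (kernel_pair (bdl_p P)) G :=
  @IFunctor C (kernel_pair (bdl_p P)) G (bdl_x P) division _ _ _ _.
Next Obligation. exact: division_d0. Qed.
Next Obligation.
rewrite /= -(division_act division_d0) compA bdl_x_act -compA.
by rewrite pb1_pair.
Qed.
Next Obligation.
have h : icd0 G ∘ (ici G ∘ bdl_x P)
    = bdl_x P ∘ (pb1 _ _ ∘ ici (kernel_pair (bdl_p P))).
  by rewrite d0i /= pb1_pair compm1.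
apply: (divisionP (h := h)).
have h' : icd0 G ∘ (ici G ∘ (bdl_x P ∘ idm _)) = bdl_x P ∘ idm _ by rewrite d0i.
rewrite [RHS]/= [RHS]pb2_pair -[RHS](bdl_act1 h'); congr comp; apply: pbpair_eq.
  by rewrite compm1.
by rewrite /= pb1_pair.
Qed.
Next Obligation.
move=> T f g h h'.
have k : icd0 G ∘ mulc h' = bdl_x P ∘ (pb1 _ _ ∘ @mulc C (kp_data _) T f g h).
  by rewrite d0mulc kp_mulc1 division_d0E.
apply: (divisionP (h := k)); rewrite kp_mulc2.
have hf : icd0 G ∘ (division ∘ f)
    = bdl_x P ∘ (pb1 _ _ ∘ @mulc C (kp_data _) T f g h).
  by rewrite kp_mulc1 division_d0E.
have hf' : icd0 G ∘ (division ∘ f) = bdl_x P ∘ (pb1 _ _ ∘ f).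
  by rewrite division_d0E.
have e : bdl_act P ∘ pbpair hf = pb1 _ _ ∘ g.
  transitivity (bdl_act P ∘ pbpair hf'); last by rewrite division_actE -h.
  by congr comp; apply: pbpair_eq => //; rewrite kp_mulc1.
have hg : icd0 G ∘ (division ∘ g) = bdl_x P ∘ (bdl_act P ∘ pbpair hf).
  by rewrite e division_d0E.
rewrite (bdl_actM k hg).
have hg' : icd0 G ∘ (division ∘ g) = bdl_x P ∘ (pb1 _ _ ∘ g).
  by rewrite division_d0E.
rewrite -[RHS](division_actE hg'); congr comp; exact: pbpair_eq.
Qed.

End Cocycle.

(** ** Morphisms of principal bundles are isomorphisms *)

Section BundleHom.
Variables (G : igroupoid C) (X : C).

Program Definition bundle_id (P : bundle G X) : bundle_hom P P :=
  @BundleHom G X P P (idm _) _ _ _.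
Next Obligation. by move=> P; rewrite compm1. Qed.
Next Obligation. by move=> P; rewrite compm1. Qed.
Next Obligation.
by move=> P T g y h h'; rewrite comp1m; congr comp; apply: pbpair_eq; rewrite ?comp1m.
Qed.

Program Definition bundle_comp (P Q R : bundle G X)
    (k : bundle_hom Q R) (h : bundle_hom P Q) : bundle_hom P R :=
  @BundleHom G X P R (k ∘ h) _ _ _.
Next Obligation. by move=> *; rewrite compA !bmap_p. Qed.
Next Obligation. by move=> *; rewrite compA !bmap_x. Qed.
Next Obligation.
move=> P Q R k h T g y e e'.
have e1 : icd0 G ∘ g = bdl_x Q ∘ (h ∘ y) by rewrite compA bmap_x.
have e2 : icd0 G ∘ g = bdl_x R ∘ (k ∘ (h ∘ y)) by rewrite compA bmap_x.
rewrite -compA (bmap_act _ e1) (bmap_act _ e2); congr comp.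
by apply: pbpair_eq; rewrite ?compA.
Qed.

Variables (P Q : bundle G X) (h : bundle_hom P Q).

Lemma bundle_hom_iso : is_iso h.
Proof.
pose sh : @hom (slice X) (SliceOb (bdl_p P)) (SliceOb (bdl_p Q)) :=
  exist _ (bmap h) (bmap_p h).
suff: is_iso sh.
  move=> [[k hk] [kh hk']]; exists k.
  by split; [apply: (congr1 sval kh) | apply: (congr1 sval hk')].
apply: (monadic_conservative (bdl_descent P)).
(* The inverse of [P x_X P -> P x_X Q] sends [(y, z)] to
   [(y, a(psi(h y, z), y))]. *)
have k : bdl_p Q ∘ (h ∘ pb1 (bdl_p P) (bdl_p Q))
       = bdl_p Q ∘ pb2 (bdl_p P) (bdl_p Q).
  by rewrite compA bmap_p pb_sq.
pose g := division Q ∘ pbpair k.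
have hg : icd0 G ∘ g = bdl_x P ∘ pb1 (bdl_p P) (bdl_p Q).
  by rewrite /g division_d0E pb1_pair compA bmap_x.
have hg' : icd0 G ∘ g = bdl_x Q ∘ (h ∘ pb1 (bdl_p P) (bdl_p Q)).
  by rewrite compA bmap_x.
have z : h ∘ (bdl_act P ∘ pbpair hg) = pb2 (bdl_p P) (bdl_p Q).
  rewrite (bmap_act _ hg').
  have hg2 : icd0 G ∘ (division Q ∘ pbpair k)
           = bdl_x Q ∘ (pb1 _ _ ∘ pbpair k) by rewrite division_d0E.
  rewrite -[RHS](pb2_pair k) -(division_actE hg2); congr comp.
  by apply: pbpair_eq; rewrite ?pb1_pair.
have hw : bdl_p P ∘ pb1 (bdl_p P) (bdl_p Q)
        = bdl_p P ∘ (bdl_act P ∘ pbpair hg).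
  by rewrite [RHS]compA bdl_p_act -compA pb2_pair.
have w1 : pb1 _ _ ∘ pbpair hw = pb1 (bdl_p P) (bdl_p Q) by rewrite pb1_pair.
exists (exist _ (pbpair hw) w1).
have hk : pbpair (pullback_map_subproof (bdl_p P) sh) ∘ pbpair hw
        = idm (pb (bdl_p P) (bdl_p Q)).
  apply: pb_ext; rewrite compA ?pb1_pair ?pb2_pair ?compm1 ?pb1_pair //.
  by rewrite -compA pb2_pair /=.
split; apply: eq_exist => //=.
apply: pb_ext; rewrite compm1 compA ?pb1_pair ?pb2_pair //=.
set w := pbpair (pullback_map_subproof _ sh) in hk *.
have p1w : pb1 _ _ ∘ w = pb1 (bdl_p P) (bdl_p P) by rewrite pb1_pair.
have p2w : pb2 _ _ ∘ w = h ∘ pb2 (bdl_p P) (bdl_p P) by rewrite pb2_pair.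
have q : bdl_p P ∘ pb1 (bdl_p P) (bdl_p P) = bdl_p P ∘ pb2 _ _ by rewrite pb_sq.
have gw1 : icd0 G ∘ (g ∘ w) = bdl_x Q ∘ (h ∘ pb1 (bdl_p P) (bdl_p P)).
  by rewrite compA hg -compA p1w compA bmap_x.
have d1 : icd0 G ∘ division P = bdl_x Q ∘ (h ∘ pb1 (bdl_p P) (bdl_p P)).
  by rewrite division_d0 compA bmap_x.
have gw : g ∘ w = division P.
  apply: (act_inj (h := gw1) (h' := d1)).
  have -> : bdl_act Q ∘ pbpair d1 = pb2 _ _ ∘ w.
    by rewrite -(bmap_act (division_d0 P) d1) division_act p2w.
  rewrite -[in RHS]z -(compA h) -(compA (bdl_act P)).
  have e : icd0 G ∘ (g ∘ w) = bdl_x P ∘ (pb1 (bdl_p P) (bdl_p Q) ∘ w).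
    by rewrite !(compA _ _ w) hg.
  have e' : icd0 G ∘ (g ∘ w)
      = bdl_x Q ∘ (h ∘ (pb1 (bdl_p P) (bdl_p Q) ∘ w)) by rewrite p1w.
  rewrite (pbpair_pre _ e) (bmap_act _ e'); congr comp.
  by apply: pbpair_eq; rewrite ?p1w.
rewrite -[RHS](division_act (division_d0 P)) -compA; congr comp.
have e : icd0 G ∘ (g ∘ w) = bdl_x P ∘ (pb1 (bdl_p P) (bdl_p Q) ∘ w).
  by rewrite !(compA _ _ w) hg.
by rewrite (pbpair_pre _ e); apply: pbpair_eq.
Qed.

Definition bundle_hom_inv_map : hom (bdl Q) (bdl P) := sval (cid bundle_hom_iso).

Lemma bundle_hom_inv_mapK : bundle_hom_inv_map ∘ h = idm _.
Proof. by rewrite /bundle_hom_inv_map; case: cid => k []. Qed.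
Lemma bundle_hom_inv_mapKr : h ∘ bundle_hom_inv_map = idm _.
Proof. by rewrite /bundle_hom_inv_map; case: cid => k []. Qed.

Program Definition bundle_inv : bundle_hom Q P :=
  @BundleHom G X Q P bundle_hom_inv_map _ _ _.
Next Obligation.
by rewrite -(bmap_p h) -compA bundle_hom_inv_mapKr compm1.
Qed.
Next Obligation.
by rewrite -(bmap_x h) -compA bundle_hom_inv_mapKr compm1.
Qed.
Next Obligation.
move=> T g y e e'.
have k : icd0 G ∘ g = bdl_x Q ∘ (h ∘ (bundle_hom_inv_map ∘ y)).
  by rewrite (compA h) bundle_hom_inv_mapKr comp1m.
rewrite -[RHS]comp1m -bundle_hom_inv_mapK -compA (bmap_act e' k).
congr comp; congr comp; apply: pbpair_eq => //.
by rewrite compA bundle_hom_inv_mapKr comp1m.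
Qed.

End BundleHom.

(** ** Bundles corresponding to cocycles, and [Sigma] *)

(** The principal bundle corresponding to a cocycle [psi] on a cover [y],
    presented by the comparison [bof_map] that determines it up to isomorphism. *)
Record bundle_of (G : igroupoid C) (Y X : C) (y : hom Y X)
    (psi : ifunctor (kernel_pair y) G) := BundleOf {
  bof :> bundle G X;
  bof_map : hom Y (bdl bof);
  bof_map_p : bdl_p bof ∘ bof_map = y;
  bof_map_x : bdl_x bof ∘ bof_map = if0 psi;
  bof_map_psi : if1 (cocycle bof) ∘ if1 (kp_map bof_map_p) = if1 psi }.

Definition Sigma (H G : igroupoid C) (F : ifunctor H G) (X : C)
  (P : bundle H X) := bundle_of (ifunctor_comp F (cocycle P)).

(** [h] is [Sigma_F(phi)]: the bundle morphism, unique by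
    [Sigma_map_unique], that commutes with the comparison maps. *)
Definition is_Sigma_map (H G : igroupoid C) (F : ifunctor H G) (X : C)
    (P P' : bundle H X) (S : Sigma F P) (S' : Sigma F P')
    (phi : bundle_hom P P') (h : bundle_hom S S') : Prop :=
  h ∘ bof_map S = bof_map S' ∘ phi.

Lemma Sigma_map_unique (H G : igroupoid C) (F : ifunctor H G) (X : C)
    (P P' : bundle H X) (S : Sigma F P) (S' : Sigma F P')
    (phi : bundle_hom P P') (h h' : bundle_hom S S') :
  is_Sigma_map phi h -> is_Sigma_map phi h' -> bmap h = bmap h'.
Proof.
rewrite /is_Sigma_map => e e'.
have := @monadic_faithful _ _ _ (bdl_descent P)
  (SliceOb (bdl_p S)) (SliceOb (bdl_p S'))
  (exist _ (bmap h) (bmap_p h)) (exist _ (bmap h') (bmap_p h')).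
move=> faith; apply: (congr1 sval (faith _)); apply: eq_exist.
apply: pbpair_eq => //=.
(* On [P x_X S], [z = a(psi(s y, z), s y)]. *)
have k : bdl_p S ∘ (bof_map S ∘ pb1 (bdl_p P) (bdl_p S))
       = bdl_p S ∘ pb2 (bdl_p P) (bdl_p S).
  by rewrite compA bof_map_p pb_sq.
pose g := division S ∘ pbpair k.
have hg : icd0 G ∘ (division S ∘ pbpair k) = bdl_x S ∘ (pb1 _ _ ∘ pbpair k).
  by rewrite division_d0E.
have z : bdl_act S ∘ pbpair hg = pb2 (bdl_p P) (bdl_p S).
  by rewrite division_actE pb2_pair.
have k1 : icd0 G ∘ g = bdl_x S' ∘ (h ∘ (pb1 _ _ ∘ pbpair k)).
  by rewrite compA bmap_x -hg.
have k2 : icd0 G ∘ g = bdl_x S' ∘ (h' ∘ (pb1 _ _ ∘ pbpair k)).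
  by rewrite compA bmap_x -hg.
rewrite -[in LHS]z -[in RHS]z (bmap_act hg k1) (bmap_act hg k2); congr comp; apply: pbpair_eq => //.
by rewrite pb1_pair !compA e e'.
Qed.

(** * Morphisms of principal bundles for an internal category *)

Section Prin.
Variables (A : icat C) (X : C).

Definition cat_cocycle (P : bundle (core A) X) :
  ifunctor (kernel_pair (bdl_p P)) A :=
  ifunctor_comp (core_incl A) (cocycle P).

Section Hom.
Variables P0 P1 : bundle (core A) X.

Definition over_prod : hom (pb (bdl_p P0) (bdl_p P1)) X :=
  bdl_p P0 ∘ pb1 (bdl_p P0) (bdl_p P1).

Definition kp_proj1 :
    ifunctor (kernel_pair over_prod) (kernel_pair (bdl_p P0)) :=
  kp_map (erefl over_prod).
Definition kp_proj2 :
    ifunctor (kernel_pair over_prod) (kernel_pair (bdl_p P1)) :=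
  kp_map (esym (pb_sq (bdl_p P0) (bdl_p P1))).

Definition prin_hom : Type :=
  inattrans (ifunctor_comp (cat_cocycle P0) kp_proj1)
            (ifunctor_comp (cat_cocycle P1) kp_proj2).

Definition D0 : ifunctor (core (arrow A)) (core A) :=
  core_map (arrow_domain A).
Definition D1 : ifunctor (core (arrow A)) (core A) :=
  core_map (arrow_codomain A).

(** As [Sigma] is only determined up to (unique compatible) isomorphism, a
    triple comes with its representatives [tr_S0] and [tr_S1] of
    [Sigma_{D0} P] and [Sigma_{D1} P]; isomorphisms of triples compare
    different representatives along the induced maps. *)
Record triple := Triple {
  tr_P : bundle (core (arrow A)) X;
  tr_S0 : Sigma D0 tr_P;
  tr_S1 : Sigma D1 tr_P;
  tr_beta0 : bundle_hom P0 tr_S0;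
  tr_beta1 : bundle_hom tr_S1 P1 }.

Definition triple_iso (t t' : triple) : Prop :=
  exists (phi : bundle_hom (tr_P t) (tr_P t'))
    (phi0 : bundle_hom (tr_S0 t) (tr_S0 t'))
    (phi1 : bundle_hom (tr_S1 t) (tr_S1 t')),
  [/\ is_Sigma_map phi phi0, is_Sigma_map phi phi1,
      phi0 ∘ tr_beta0 t = tr_beta0 t' & tr_beta1 t' ∘ phi1 = tr_beta1 t].

Lemma triple_iso_refl (t : triple) : triple_iso t t.
Proof.
exists (bundle_id _), (bundle_id _), (bundle_id _).
by split; rewrite /is_Sigma_map /= ?comp1m ?compm1.
Qed.

Lemma triple_iso_trans (t u v : triple) :
  triple_iso t u -> triple_iso u v -> triple_iso t v.
Proof.
move=> [f [f0 [f1 [ef0 ef1 eb0 eb1]]]] [g [g0 [g1 [eg0 eg1 ec0 ec1]]]].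
exists (bundle_comp g f), (bundle_comp g0 f0), (bundle_comp g1 f1).
rewrite /is_Sigma_map /= in ef0 ef1 eg0 eg1 *; split.
- by rewrite -compA ef0 compA eg0 -compA.
- by rewrite -compA ef1 compA eg1 -compA.
- by rewrite -compA eb0.
- by rewrite compA ec1.
Qed.

Lemma triple_iso_sym (t u : triple) : triple_iso t u -> triple_iso u t.
Proof.
move=> [f [f0 [f1 [ef0 ef1 eb0 eb1]]]].
exists (bundle_inv f), (bundle_inv f0), (bundle_inv f1).
rewrite /is_Sigma_map /= in ef0 ef1 *; split.
- rewrite -[bof_map (tr_S0 u)]compm1 -(bundle_hom_inv_mapKr f).
  by rewrite (compA _ f) -ef0 -compA !compA bundle_hom_inv_mapK comp1m.
- rewrite -[bof_map (tr_S1 u)]compm1 -(bundle_hom_inv_mapKr f).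
  by rewrite (compA _ f) -ef1 -compA !compA bundle_hom_inv_mapK comp1m.
- by rewrite -eb0 compA bundle_hom_inv_mapK comp1m.
- by rewrite -eb1 -compA bundle_hom_inv_mapKr compm1.
Qed.

Definition triple_class : Type :=
  {K : triple -> Prop | exists t, K = triple_iso t}.

End Hom.
End Prin.

End PrincipalBundles.

(* Main.v *)
(** A triple [(β0, P, β1)] amounts to a principal [cC^↑]-bundle [P] with maps
    [t0 : P -> P0] and [t1 : P -> P1] over [X] lying over the two functors [D0] and
    [D1].  The object [x_P(w)] of [C^↑] is then a morphism from [x_{P0}(t0 w)] to
    [x_{P1}(t1 w)], and there is exactly one natural [η] on [P0 x_X P1] with
    [η(t0 w, t1 w) = x_P(w)]: it is found locally on [X], where [P] has sections.
    Conversely, [η] and the naturality squares form a cocycle on the cover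
    [P0 x_X P1 -> X] with values in [cC^↑], whose bundle [P] carries such [t0] and
    [t1].  An isomorphism of two bundles with the same [η] sends [w] to the only
    element with the same images under [x], [t0] and [t1].

    All of this rests on descent along effective descent morphisms: maps and
    objects given locally glue, [P0 x_X P1 -> X] is again of effective descent,
    and [q] is of effective descent as soon as some composite [q s] is. *)

From mathcomp Require Import ssreflect ssrfun ssrbool.
From mathcomp Require Import boolp.
Require Import Defs.

Set Implicit Arguments.
Unset Strict Implicit.
Unset Printing Implicit Defensive.
#[local] Obligation Tactic := idtac.
Local Open Scope cat_scope.

(** The obstacle is that [effective_descent] means monadicity for some unspecified left adjoint,
    whereas the argument has to choose elements locally. [monadic_comparison] replaces that adjoint
    by composition with [p], whose algebras are objects over [Y] with an action, and [descent]
    spells out the equivalence as gluing of maps, of equalities and of objects. [descent_rel]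
    repackages the first two: a relation that is stable, functional and locally inhabited is the
    graph of a morphism. Most maps below arise from such a relation, so local choices never have to
    be made coherently. The two closure properties of covers are forced by the definition of a
    bundle: the cocycle of [η] lives on [P0 x_X P1], and the projection of the bundle built from a
    cocycle must itself be of effective descent. Since a triple carries its own representatives of
    [Sigma], [P0] and [P1] themselves may serve as the two [Sigma]s once [P] has legs to them. *)

Lemma sig_eq (T : Type) (P : T -> Prop) (u v : {x | P x}) :
  sval u = sval v -> u = v.
Proof. by case: u v => [x hx] [y hy]; apply: eq_exist. Qed.

(** * Monadicity does not depend on the left adjoint *)

Section AdjunctionComparison.
Variables (D E : category) (U : functor D E).

Lemma adj_transpose_inj (F : functor E D) (adj : adjunction F U)
    (A : E) (B : D) (f g : hom (F A) B) :
  fmap U f ∘ adj_unit adj A = fmap U g ∘ adj_unit adj A -> f = g.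
Proof.
have rec (k : hom (F A) B) :
    k = adj_counit adj B ∘ fmap F (fmap U k ∘ adj_unit adj A).
  rewrite fmapM compA -(ntnat (adj_counit adj) k) /= -compA.
  by rewrite (adj_triL adj A) compm1.
by move=> e; rewrite (rec f) (rec g) e.
Qed.

Section Comparison.
Variables (F F' : functor E D) (adj : adjunction F U) (adj' : adjunction F' U).

(** The canonical isomorphism between two left adjoints of [U]. It is locked because only its
    compatibility with units, counits and naturality is used. *)
Definition adj_compare (A : E) : hom (F A) (F' A) :=
  locked (adj_counit adj (F' A) ∘ fmap F (adj_unit adj' A)).

Lemma adj_compare_unit (A : E) :
  fmap U (adj_compare A) ∘ adj_unit adj A = adj_unit adj' A.
Proof.
rewrite /adj_compare -lock fmapM -compA.
have -> : fmap U (fmap F (adj_unit adj' A)) ∘ adj_unit adj A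
    = adj_unit adj (U (F' A)) ∘ adj_unit adj' A.
  exact: (ntnat (adj_unit adj)).
by rewrite compA (adj_triR adj (F' A)) comp1m.
Qed.

Lemma adj_compare_nat (A B : E) (f : hom A B) :
  adj_compare B ∘ fmap F f = fmap F' f ∘ adj_compare A.
Proof.
apply: (@adj_transpose_inj F adj); rewrite (fmapM U (adj_compare B)).
rewrite (fmapM U _ (adj_compare A)) -!compA adj_compare_unit.
have -> : fmap U (fmap F f) ∘ adj_unit adj A = adj_unit adj B ∘ f.
  exact: (ntnat (adj_unit adj)).
rewrite compA adj_compare_unit; exact: esym (ntnat (adj_unit adj') f).
Qed.

Lemma adj_compare_counit (B : D) :
  adj_counit adj' B ∘ adj_compare (U B) = adj_counit adj B.
Proof.
apply: (@adj_transpose_inj F adj); rewrite fmapM -compA adj_compare_unit.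
by rewrite (adj_triR adj' B) (adj_triR adj B).
Qed.

End Comparison.

Lemma adj_compareK (F F' : functor E D) (adj : adjunction F U)
    (adj' : adjunction F' U) (A : E) :
  adj_compare adj' adj A ∘ adj_compare adj adj' A = idm (F A).
Proof.
apply: (@adj_transpose_inj F adj); rewrite fmapM -compA !adj_compare_unit.
by rewrite fmap1 comp1m.
Qed.

Section Transfer.
Variables (F F' : functor E D) (adj : adjunction F U) (adj' : adjunction F' U).

(** Restriction of the structure map along the canonical isomorphism of monads [U F -> U F']. *)
Program Definition algebra_transfer (A : algebra (adj_monad adj')) :
    algebra (adj_monad adj) :=
  @Algebra _ (adj_monad adj) A (alg_str A ∘ fmap U (adj_compare adj adj' A)) _ _.
Next Obligation.
move=> A /=; rewrite -compA adj_compare_unit; exact: (alg_unit A).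
Qed.
Next Obligation.
move=> A /=; rewrite -compA -fmapM.
have /= -> := ntnat (adj_counit adj) (adj_compare adj adj' A).
have /= m := alg_mul A.
rewrite -(adj_compare_counit adj adj' (F' A)) !fmapM !compA m.
rewrite -!compA; congr comp; rewrite -!fmapM; congr fmap;
  by rewrite fmapM !compA adj_compare_nat.
Qed.

Lemma algebra_transfer_hom (A B : algebra (adj_monad adj')) (f : hom A B) :
  f ∘ alg_str (algebra_transfer A)
    = alg_str (algebra_transfer B) ∘ fmap (adj_monad adj) f
  <-> f ∘ alg_str A = alg_str B ∘ fmap (adj_monad adj') f.
Proof.
rewrite /= -compA -fmapM adj_compare_nat fmapM !compA; split; last by move=> ->.
move=> /(congr1 (fun k => k ∘ fmap U (adj_compare adj' adj A))).
by rewrite -!compA -!fmapM adj_compareK fmap1 !compm1.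
Qed.

End Transfer.

(** The two categories of algebras are isomorphic over [E] by [algebra_transfer], and by [str] this
    isomorphism carries one comparison functor to the other; fullness, faithfulness and essential
    surjectivity are transported along it. *)
Lemma monadic_comparison (F' : functor E D) (adj' : adjunction F' U) :
  monadic U -> is_equivalence (comparison adj').
Proof.
move=> [F [adj [ff es]]].
have str (B : D) : alg_str (algebra_transfer adj (comparison adj' B))
    = alg_str (comparison adj B).
  by rewrite /= -fmapM adj_compare_counit.
split=> [A B|B].
  have [r fK rK] := ff A B.
  have tr (k : hom (comparison adj' A) (comparison adj' B)) :
      sval k ∘ alg_str (comparison adj A)
      = alg_str (comparison adj B) ∘ fmap (adj_monad adj) (sval k).
    rewrite -!str.
    apply/(@algebra_transfer_hom _ _ adj adj' (comparison adj' A) (comparison adj' B)).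
    by case: k.
  exists (fun k => r (exist _ (sval k) (tr k))) => [f|k].
    by rewrite -[RHS]fK; congr r; apply: eq_exist.
  by apply: sig_eq; have := congr1 sval (rK (exist _ _ (tr k))).
have [A [f [g [gf fg]]]] := es (algebra_transfer adj B).
have hf : sval f ∘ alg_str (comparison adj' A)
    = alg_str B ∘ fmap (adj_monad adj') (sval f).
  apply/(@algebra_transfer_hom _ _ adj adj' (comparison adj' A) B).
  by rewrite str; case: f {gf fg}.
have hg : sval g ∘ alg_str B
    = alg_str (comparison adj' A) ∘ fmap (adj_monad adj') (sval g).
  apply/(@algebra_transfer_hom _ _ adj adj' B (comparison adj' A)).
  by rewrite str; case: g {gf fg}.
pose f' : algebra_hom (comparison adj' A) B := exist _ (sval f) hf.
pose g' : algebra_hom B (comparison adj' A) := exist _ (sval g) hg.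
exists A, f', g'.
by split; apply: sig_eq; [have := congr1 sval gf | have := congr1 sval fg].
Qed.

End AdjunctionComparison.

Lemma inj_surj_bij (S T : Type) (f : S -> T) :
  injective f -> (forall y, exists x, f x = y) -> bijective f.
Proof.
move=> fI fS; pose g y := sval (cid (fS y)).
have gK : cancel g f by move=> y; rewrite /g; case: cid.
by exists g => // x; apply: fI; rewrite gK.
Qed.

Section PullbackElements.
Variables (C : cartesian) (A B E T : C) (f : hom A E) (g : hom B E).

Lemma pb_elt (w : hom T (pb f g)) : f ∘ (pb1 f g ∘ w) = g ∘ (pb2 f g ∘ w).
Proof. by rewrite !compA pb_sq. Qed.

Lemma pbpair_eta (w : hom T (pb f g)) : pbpair (pb_elt w) = w.
Proof. by apply: pb_ext; rewrite ?pb1_pair ?pb2_pair. Qed.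

Variables (S : C) (u : hom T A) (v : hom T B) (h : f ∘ u = g ∘ v) (t : hom S T).

Lemma pb1_pairA : pb1 f g ∘ (pbpair h ∘ t) = u ∘ t.
Proof. by rewrite compA pb1_pair. Qed.

Lemma pb2_pairA : pb2 f g ∘ (pbpair h ∘ t) = v ∘ t.
Proof. by rewrite compA pb2_pair. Qed.

Lemma pair_sqM : f ∘ (u ∘ t) = g ∘ (v ∘ t).
Proof. by rewrite !compA h. Qed.

Lemma pbpairM : pbpair h ∘ t = pbpair pair_sqM.
Proof. exact: pbpair_pre. Qed.

End PullbackElements.

(** * Effective descent in terms of generalized elements *)

Section ElementaryDescent.
Variables (C : cartesian) (X Y : C) (p : hom Y X).

(** The explicit left adjoint of pullback along [p]; the resulting monad sends [π] to
    [pb1 p (p ∘ π)]. *)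
Program Definition sigma_functor : functor (slice Y) (slice X) :=
  @Functor (slice Y) (slice X) (fun A => SliceOb (p ∘ sl_map A))
    (fun A B f => exist _ (sval f) _) _ _.
Next Obligation. by move=> A B [f hf] /=; rewrite -compA hf. Qed.
Next Obligation. by move=> A; apply: sig_eq. Qed.
Next Obligation. by move=> A B D f g; apply: sig_eq. Qed.

Lemma sigma_unit_subproof (A : slice Y) :
  p ∘ sl_map A = p ∘ sl_map A ∘ idm (sl_dom A).
Proof. by rewrite compm1. Qed.

Program Definition sigma_unit :
    nattrans (functor_id (slice Y))
      (functor_comp (pullback_functor p) sigma_functor) :=
  @NatTrans (slice Y) (slice Y) _ _
    (fun A => exist _ (pbpair (sigma_unit_subproof A)) _) _.
Next Obligation. by move=> A /=; rewrite pb1_pair. Qed.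
Next Obligation.
move=> A B [f hf]; apply: sig_eq; apply: pb_ext => /=; rewrite !compA.
  by rewrite !pb1_pair.
by rewrite !pb2_pair -compA pb2_pair comp1m compm1.
Qed.

Program Definition sigma_counit :
    nattrans (functor_comp sigma_functor (pullback_functor p))
      (functor_id (slice X)) :=
  @NatTrans (slice X) (slice X) _ _ (fun B => exist _ (pb2 p (sl_map B)) _) _.
Next Obligation. by move=> B /=; rewrite pb_sq. Qed.
Next Obligation. by move=> A B f; apply: sig_eq; rewrite /= pb2_pair. Qed.

Program Definition sigma_adj : adjunction sigma_functor (pullback_functor p) :=
  @Adjunction _ _ _ _ sigma_unit sigma_counit _ _.
Next Obligation. by move=> A; apply: sig_eq; rewrite /= pb2_pair. Qed.
Next Obligation.
move=> B; apply: sig_eq; apply: pb_ext; rewrite /= compA.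
  by rewrite !pb1_pair compm1.
by rewrite pb2_pair -compA pb2_pair.
Qed.

(** The algebras for the monad of [sigma_adj]: [α(v, a)] lies over [v]. *)
Record descent_action (A : C) (π : hom A Y) (α : hom (pb p (p ∘ π)) A) : Prop :=
  DescentAction {
  da_over : π ∘ α = pb1 p (p ∘ π);
  da_unit : forall (T : C) (a : hom T A) (h : p ∘ (π ∘ a) = p ∘ π ∘ a),
    α ∘ pbpair h = a;
  da_assoc : forall (T : C) (v v' : hom T Y) (a : hom T A)
    (h : p ∘ v = p ∘ π ∘ a) (h' : p ∘ v' = p ∘ π ∘ (α ∘ pbpair h))
    (h'' : p ∘ v' = p ∘ π ∘ a),
    α ∘ pbpair h' = α ∘ pbpair h'' }.

Arguments descent_action {A} π α.

(** The fields correspond to fullness, faithfulness and essential surjectivity of the comparison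
    functor of [sigma_adj]. The target [W] is an arbitrary object instead of one over [X], which is
    the form that gluing of maps requires. *)
Record descent : Prop := Descent {
  descent_map : forall (Z W : C) (c : hom Z X) (f : hom (pb p c) W),
    (forall (T : C) (v v' : hom T Y) (z : hom T Z)
       (h : p ∘ v = c ∘ z) (h' : p ∘ v' = c ∘ z),
       f ∘ pbpair h = f ∘ pbpair h') ->
    exists g : hom Z W, g ∘ pb2 p c = f;
  descent_epi : forall (Z W : C) (c : hom Z X) (g g' : hom Z W),
    g ∘ pb2 p c = g' ∘ pb2 p c -> g = g';
  descent_ob : forall (A : C) (π : hom A Y) (α : hom (pb p (p ∘ π)) A),
    descent_action π α ->
    exists (B : C) (b : hom B X) (r : hom A B) (e : p ∘ π = b ∘ r),
      is_iso (pbpair e : hom A (pb p b)) /\ r ∘ α = r ∘ pb2 p (p ∘ π) }.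

Lemma effective_descent_descent : effective_descent p -> descent.
Proof.
move=> edp; have [ff es] := monadic_comparison sigma_adj edp; split.
- move=> Z W c f fP.
  (* Maps from [Z] to [W] become maps over [X] into the product of [X] and [W]. *)
  pose B := SliceOb c; pose B' := SliceOb (pb1 (bang X) (bang W)).
  have hk : p ∘ pb1 p c
      = pb1 (bang X) (bang W) ∘ cpair (c ∘ pb2 p c) f.
    by rewrite cpair1 pb_sq.
  have hk1 : pb1 _ _ ∘ pbpair hk = pb1 p c by rewrite pb1_pair.
  pose k : @hom (slice Y) (pullback_functor p B) (pullback_functor p B') :=
    exist _ (pbpair hk) hk1.
  have kalg : k ∘ alg_str (comparison sigma_adj B)
      = alg_str (comparison sigma_adj B') ∘ fmap (adj_monad sigma_adj) k.
    apply: sig_eq; apply: pb_ext; rewrite /= !compA ?pb1_pair //.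
    rewrite !pb2_pair -compA pb2_pair compA pb2_pair !cpair_pre.
    rewrite -!compA pb2_pair; congr cpair => //=.
    have h1 : p ∘ pb1 p (p ∘ pb1 p c) = c ∘ (pb2 p c ∘ pb2 p (p ∘ pb1 p c)).
      by rewrite -pb_elt compA -pb_sq.
    rewrite -[in RHS](pbpair_eta (pb2 p (p ∘ pb1 p c))).
    by rewrite (fP _ _ _ _ (pb_elt _) h1); congr comp; apply: pbpair_eq.
  have [/= g gk] : exists g : @hom (slice X) B B', fmap (pullback_functor p) g = k.
    have [r _ rK] := ff B B'; exists (r (exist _ k kalg)).
    by have := congr1 sval (rK (exist _ k kalg)).
  exists (pb2 _ _ ∘ sval g).
  have /(congr1 (fun h => pb2 (bang X) (bang W) ∘ (pb2 _ _ ∘ h))) := congr1 sval gk.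
  by rewrite /= !pb2_pair compA.
- move=> Z W c g g' e.
  pose B := SliceOb c; pose B' := SliceOb (pb1 (bang X) (bang W)).
  pose k : @hom (slice X) B B' := exist _ (cpair c g) (cpair1 c g).
  pose k' : @hom (slice X) B B' := exist _ (cpair c g') (cpair1 c g').
  have kk' : k = k'.
    apply: (bij_inj (ff B B')); apply: sig_eq; apply: sig_eq; apply: pbpair_eq => //=.
    by rewrite !cpair_pre e.
  by have := congr1 (fun h => pb2 _ _ ∘ sval h) kk'; rewrite /= !cpair2.
- move=> A π α [ov un as_].
  pose T := adj_monad sigma_adj.
  pose str : @hom (slice Y) (T (SliceOb π)) (SliceOb π) := exist _ α ov.
  have au : str ∘ mnd_unit T (SliceOb π) = idm _.
    apply: sig_eq; have h : p ∘ (π ∘ idm A) = p ∘ π ∘ idm A by rewrite !compm1.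
    by rewrite /= -[RHS](un _ _ h); congr comp; apply: pbpair_eq; rewrite ?compm1.
  have am : str ∘ mnd_mul T (SliceOb π) = str ∘ fmap T str.
    apply: sig_eq => /=.
    set w := pb2 p (p ∘ pb1 p (p ∘ π)); set v := pb1 p (p ∘ pb1 p (p ∘ π)).
    have ew : p ∘ v = p ∘ π ∘ (pb2 p (p ∘ π) ∘ w).
      by rewrite -pb_elt compA; exact: pb_sq.
    have ev : p ∘ v = p ∘ π ∘ (α ∘ pbpair (pb_elt w)).
      by rewrite pbpair_eta compA -(compA p π) ov; exact: pb_sq.
    transitivity (α ∘ pbpair ew); first by congr comp; apply: pbpair_eq.
    rewrite -(as_ _ _ _ _ _ ev); congr comp; apply: pbpair_eq => //.
    by rewrite pbpair_eta.
  have [B [[f hf] [[g hg] [gf fg]]]] := es (@Algebra _ T _ str au am).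
  exists (sl_dom B), (sl_map B), (pb2 _ _ ∘ sval g).
  have e : p ∘ π = sl_map B ∘ (pb2 p (sl_map B) ∘ sval g).
    by rewrite -pb_elt; congr comp; case: g {hg gf fg}.
  exists e; have eg : pbpair e = sval g.
    apply: pb_ext; rewrite ?pb1_pair ?pb2_pair //.
    by apply: esym; case: g {hg gf fg e}.
  rewrite eg; split.
    exists (sval f).
    by split; [have := congr1 (fun k => sval (sval k)) fg
              |have := congr1 (fun k => sval (sval k)) gf].
  have /= hg' := congr1 sval hg.
  by rewrite -(compA _ _ α) hg' pb2_pairA /= -compA pb2_pair compA.
Qed.

Lemma descent_effective_descent : descent -> effective_descent p.
Proof.
move=> [dm de dob]; exists sigma_functor, sigma_adj; split.
  move=> A B; apply: inj_surj_bij.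
    move=> f g fg; apply: sig_eq; apply: (de _ _ (sl_map A)).
    have /(congr1 (fun h => pb2 _ _ ∘ h)) := congr1 (fun h => sval (sval h)) fg.
    by rewrite /= !pb2_pair.
  move=> [k hk].
  have /= kalg := congr1 sval hk; have /= kov := proj2_sig k.
  have [|g gk] := dm _ _ (sl_map A) (pb2 p (sl_map B) ∘ sval k).
    have inv (T : C) (v v' : hom T Y) z
        (h : p ∘ v = sl_map A ∘ z) (h' : p ∘ v' = sl_map A ∘ z) :
        pb2 p (sl_map B) ∘ sval k ∘ pbpair h' = pb2 p (sl_map B) ∘ sval k ∘ pbpair h.
      have e : p ∘ v' = p ∘ pb1 p (sl_map A) ∘ pbpair h.
        by rewrite -(compA p) pb1_pair h' h.
      (* The structure map of a pulled back object replaces the [Y] component and keeps the other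
         one. The algebra equation for [k] at [(v', (v, z))] therefore compares the values at
         [(v', z)] and [(v, z)]. *)
      have := congr1 (fun f => pb2 _ _ ∘ (f ∘ (pbpair e : hom T _))) kalg.
      rewrite -!compA pb2_pairA /= -compA pb2_pairA -compA pb2_pair => <-.
      do 2 congr comp; apply: pb_ext;
        rewrite ?pb1_pairA ?pb2_pairA ?pb1_pair ?pb2_pair //=.
      by rewrite -compA !pb2_pair.
    by move=> T v v' z h h'; apply: inv.
  have gov : sl_map B ∘ g = sl_map A.
    apply: (de _ _ (sl_map A)); rewrite -compA gk -pb_elt.
    by rewrite kov pb_sq.
  exists (exist _ g gov); do 2 apply: sig_eq; apply: pb_ext => /=.
    by rewrite pb1_pair kov.
  by rewrite pb2_pair.
move=> [[A π] [α ov] un as_].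
have /= ov' := ov; have /= un' := congr1 sval un; have /= as' := congr1 sval as_.
have act : descent_action π α.
  split=> // [T a h|T v v' a h h' h''].
    rewrite -[RHS]comp1m -un' -compA pbpairM; congr comp; apply: pbpair_eq => //.
    by rewrite comp1m.
  have ew : p ∘ v' = p ∘ pb1 p (p ∘ π) ∘ pbpair h.
    by rewrite h' -ov' !compA.
  have /= := congr1 (fun f => f ∘ (pbpair ew : hom T _)) as'.
  rewrite -!compA => e; etransitivity; last (etransitivity; first exact: (esym e)).
    congr comp; apply: pb_ext; rewrite ?pb1_pairA ?pb2_pairA ?pb1_pair ?pb2_pair //=.
    by rewrite -compA pb2_pair.
  congr comp; apply: pb_ext; rewrite ?pb1_pairA ?pb2_pairA ?pb1_pair ?pb2_pair //=.
  by rewrite -compA !pb2_pair.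
have [B [b [r [e [[i [ir ri]] rα]]]]] := dob _ _ _ act.
have iov : π ∘ i = pb1 p b.
  by rewrite -[π](pb1_pair e) -compA ri compm1.
pose A' : algebra (adj_monad sigma_adj) :=
  @Algebra _ (adj_monad sigma_adj) (SliceOb π) (exist _ α ov) un as_.
pose B' := comparison sigma_adj (SliceOb b).
pose f : @hom (slice Y) B' A' := exist _ i iov.
pose g : @hom (slice Y) A' B' := exist _ (pbpair e) (pb1_pair e).
have hg : g ∘ alg_str A' = alg_str B' ∘ fmap (adj_monad sigma_adj) g.
  apply: sig_eq; apply: pb_ext; rewrite /= compA ?pb1_pair ?pb2_pair.
    by rewrite compA !pb1_pair.
  by rewrite pb2_pairA /= -compA !pb2_pair compA pb2_pair.
have gf : g ∘ f = idm _ by apply: sig_eq.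
have fg : f ∘ g = idm _ by apply: sig_eq.
have hf : f ∘ alg_str B' = alg_str A' ∘ fmap (adj_monad sigma_adj) f.
  rewrite -[RHS]comp1m -fg -compA; congr comp.
  rewrite compA hg -compA -fmapM gf fmap1 compm1 //.
pose f' : algebra_hom B' A' := exist _ f hf.
pose g' : algebra_hom A' B' := exist _ g hg.
by exists (SliceOb b), f', g'; split; apply: sig_eq.
Qed.

End ElementaryDescent.
Arguments descent_action {C X Y p A} π α.

(** * Reasoning locally on a cover *)

Section DescentElements.
Variables (C : cartesian) (X Y : C) (p : hom Y X).

(** [dact α v a] is [α(v, a)], extended by the junk value [a] to pairs that do
    not lie over the same element of [X]. *)
Definition dact (A : C) (π : hom A Y) (α : hom (pb p (p ∘ π)) A)
    (T : C) (v : hom T Y) (a : hom T A) : hom T A :=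
  match pselect (p ∘ v = p ∘ π ∘ a) with
  | left h => α ∘ pbpair h
  | right _ => a
  end.

Section Action.
Variables (A : C) (π : hom A Y) (α : hom (pb p (p ∘ π)) A).

Lemma dactE (T : C) (v : hom T Y) (a : hom T A) (h : p ∘ v = p ∘ π ∘ a) :
  α ∘ pbpair h = dact α v a.
Proof. by rewrite /dact; case: pselect => // h'; congr comp; apply: pbpair_eq. Qed.

Lemma dactM (S T : C) (v : hom T Y) (a : hom T A) (t : hom S T) :
  p ∘ v = p ∘ (π ∘ a) -> dact α v a ∘ t = dact α (v ∘ t) (a ∘ t).
Proof.
rewrite [in p ∘ (π ∘ a)]compA => h.
by rewrite -(dactE h) -compA pbpairM dactE.
Qed.

Lemma descent_actionI :
  (forall (T : C) (v : hom T Y) (a : hom T A),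
     p ∘ v = p ∘ (π ∘ a) -> π ∘ dact α v a = v) ->
  (forall (T : C) (a : hom T A), dact α (π ∘ a) a = a) ->
  (forall (T : C) (v v' : hom T Y) (a : hom T A),
     p ∘ v = p ∘ (π ∘ a) -> p ∘ v' = p ∘ v ->
     dact α v' (dact α v a) = dact α v' a) ->
  descent_action π α.
Proof.
move=> ov un as_; split.
- have := ov _ (pb1 p (p ∘ π) ∘ idm _) (pb2 p (p ∘ π) ∘ idm _).
  by rewrite -(dactE (pb_elt (idm _))) pbpair_eta !compm1; apply; rewrite pb_sq compA.
- by move=> T a h; rewrite dactE.
- move=> T v v' a h h' h''; rewrite !dactE as_ //.
    by rewrite h compA.
  by rewrite h'' h.
Qed.

Hypothesis act : descent_action π α.

Lemma dact_over (T : C) (v : hom T Y) (a : hom T A) :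
  p ∘ v = p ∘ (π ∘ a) -> π ∘ dact α v a = v.
Proof.
rewrite [in p ∘ (π ∘ a)]compA => h.
by rewrite -(dactE h) compA (da_over act) pb1_pair.
Qed.

Lemma dact_unit (T : C) (a : hom T A) : dact α (π ∘ a) a = a.
Proof. by rewrite -(dactE (compA p π a)) (da_unit act). Qed.

Lemma dact_assoc (T : C) (v v' : hom T Y) (a : hom T A) :
  p ∘ v = p ∘ (π ∘ a) -> p ∘ v' = p ∘ v ->
  dact α v' (dact α v a) = dact α v' a.
Proof.
move=> h e; have ov := dact_over h; rewrite compA in h.
have h'' : p ∘ v' = p ∘ π ∘ a by rewrite e.
have h' : p ∘ v' = p ∘ π ∘ (α ∘ pbpair h) by rewrite dactE -compA ov.
by have := da_assoc act h' h''; rewrite !dactE.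
Qed.

End Action.

(** [r] exhibits [A] as the pullback of [b] along [p], equivariantly. *)
Record descended (A : C) (π : hom A Y) (α : hom (pb p (p ∘ π)) A)
    (B : C) (b : hom B X) (r : hom A B) : Prop := Descended {
  desc_over : b ∘ r = p ∘ π;
  desc_act : forall (T : C) (v : hom T Y) (a : hom T A),
    p ∘ v = p ∘ (π ∘ a) -> r ∘ dact α v a = r ∘ a;
  desc_surj : forall (T : C) (v : hom T Y) (z : hom T B),
    p ∘ v = b ∘ z -> exists a : hom T A, π ∘ a = v /\ r ∘ a = z;
  desc_inj : forall (T : C) (a a' : hom T A),
    π ∘ a = π ∘ a' -> r ∘ a = r ∘ a' -> a = a' }.

Lemma descendedP (A : C) (π : hom A Y) (α : hom (pb p (p ∘ π)) A)
    (B : C) (b : hom B X) (r : hom A B) :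
  descended α b r <->
  exists e : p ∘ π = b ∘ r,
    is_iso (pbpair e : hom A (pb p b)) /\ r ∘ α = r ∘ pb2 p (p ∘ π).
Proof.
split=> [[ov ac su inj]|[e [[i [ir ri]] rα]]].
  exists (esym ov); split.
    have [i [πi ri]] := su _ (pb1 p b) (pb2 p b) (pb_sq p b).
    exists i; split.
      by apply: inj; rewrite compA ?πi ?ri ?pb1_pair ?pb2_pair compm1.
    by apply: pb_ext; rewrite compA ?pb1_pair ?pb2_pair compm1.
  have := ac _ (pb1 p (p ∘ π) ∘ idm _) (pb2 p (p ∘ π) ∘ idm _).
  by rewrite -(dactE α (pb_elt (idm _))) pbpair_eta !compm1; apply; rewrite pb_sq compA.
have πi : π ∘ i = pb1 p b by rewrite -[π](pb1_pair e) -compA ri compm1.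
have ri' : r ∘ i = pb2 p b by rewrite -[r](pb2_pair e) -compA ri compm1.
split=> //.
- move=> T v a h; rewrite compA in h.
  by rewrite -(dactE α h) compA rα -compA pb2_pair.
- by move=> T v z h; exists (i ∘ pbpair h); rewrite !compA πi ri' pb1_pair pb2_pair.
- move=> T a a' eπ er; rewrite -[a]comp1m -[a']comp1m -ir -!compA; congr comp.
  by apply: pb_ext; rewrite !compA ?pb1_pair ?pb2_pair.
Qed.

Section Descent.
Hypothesis dp : descent p.

(** It suffices to use the hypothesis at the universal place where [c] lifts to the cover, namely
    [pb p c]. *)
Lemma descent_local (T W : C) (c : hom T X) (f f' : hom T W) :
  (forall (S : C) (t : hom S T) (v : hom S Y), p ∘ v = c ∘ t -> f ∘ t = f' ∘ t) ->
  f = f'.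
Proof. by move=> e; apply: (descent_epi dp (c := c)); apply: e (pb_sq _ _). Qed.

(** A functional relation that is inhabited locally for the cover [p] is the
    graph of a morphism. *)
Lemma descent_rel (Z W : C) (c : hom Z X)
    (R : forall T : C, hom T Z -> hom T W -> Prop) :
  (forall (S T : C) (t : hom S T) (z : hom T Z) (w : hom T W),
     R T z w -> R S (z ∘ t) (w ∘ t)) ->
  (forall (T : C) (z : hom T Z) (w w' : hom T W), R T z w -> R T z w' -> w = w') ->
  (forall (T : C) (z : hom T Z) (v : hom T Y), p ∘ v = c ∘ z ->
     exists w, R T z w) ->
  exists g : hom Z W, forall (T : C) (z : hom T Z) (w : hom T W),
    R T z w -> g ∘ z = w.
Proof.
move=> RM Rfun Rex.
(* A value over the universal local element is a map on [pb p c]; functionality of [R] makes it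
   independent of the [Y] component, so that it descends to [Z]. *)
have [f fP] := Rex _ (pb2 p c) (pb1 p c) (pb_sq p c).
have fE (T : C) (v : hom T Y) (z : hom T Z) (h : p ∘ v = c ∘ z) :
    R T z (f ∘ pbpair h).
  by have := RM _ _ (pbpair h) _ _ fP; rewrite pb2_pair.
have [|g gf] := descent_map dp (c := c) (f := f).
  by move=> T v v' z h h'; apply: Rfun (fE _ _ _ h) (fE _ _ _ h').
exists g => T z w zw; apply: (descent_local (c := c ∘ z)) => S t v.
rewrite -compA => h; apply: Rfun (RM _ _ t _ _ zw).
by have := fE _ _ _ h; rewrite -gf -compA pb2_pair compA.
Qed.

Lemma descent_descended (A : C) (π : hom A Y) (α : hom (pb p (p ∘ π)) A) :
  descent_action π α ->
  exists (B : C) (b : hom B X) (r : hom A B), descended α b r.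
Proof.
move=> /(descent_ob dp) [B [b [r H]]].
by exists B, b, r; apply/descendedP.
Qed.

End Descent.

Lemma descentI :
  (forall (Z W : C) (c : hom Z X) (f : hom (pb p c) W),
    (forall (T : C) (v v' : hom T Y) (z : hom T Z)
       (h : p ∘ v = c ∘ z) (h' : p ∘ v' = c ∘ z),
       f ∘ pbpair h = f ∘ pbpair h') ->
    exists g : hom Z W, g ∘ pb2 p c = f) ->
  (forall (T W : C) (c : hom T X) (f f' : hom T W),
    (forall (S : C) (t : hom S T) (v : hom S Y),
       p ∘ v = c ∘ t -> f ∘ t = f' ∘ t) -> f = f') ->
  (forall (A : C) (π : hom A Y) (α : hom (pb p (p ∘ π)) A),
    descent_action π α ->
    exists (B : C) (b : hom B X) (r : hom A B), descended α b r) ->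
  descent p.
Proof.
move=> dm dl dob; split=> //.
  move=> Z W c g g' e; apply: (dl _ _ c) => S t v h.
  by rewrite -(pb2_pair h) !compA e.
by move=> A π α /dob [B [b [r H]]]; exists B, b, r; apply/descendedP.
Qed.

End DescentElements.

Arguments dact {C X Y p A π} α {T} v a.

Arguments descended {C X Y p A π} α {B} b r.

(** An element [v] of [Y] yields the element [s v] of [Z], so whatever holds locally for [q] holds
    locally for [y = q s]; this settles maps and equalities. For objects, an action [α] on [A] over
    [Z] is pulled back to [s^* A] over [Y] by [α'(v, (v', a)) = (v, α(s v, a))]. This descends along
    [y] to an object [B], and it remains to recognize [A] as the pullback of [B] along [q]. *)
Lemma descent_cancel (C : cartesian) (X Y Z : C) (s : hom Y Z) (q : hom Z X) :
  descent (q ∘ s) -> descent q.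
Proof.
set y := q ∘ s => dy; apply: descentI.
- move=> V W c f fP.
  have [||T z v h|g gP] := @descent_rel _ _ _ _ dy V W c
    (fun T z w => exists (v : hom T Z) (h : q ∘ v = c ∘ z), w = f ∘ pbpair h).
  + move=> S T t z w [v [h ->]]; exists (v ∘ t), (pair_sqM h t).
    by rewrite -compA pbpairM.
  + by move=> T z w w' [v [h ->]] [v' [h' ->]]; apply: fP.
  + have h' : q ∘ (s ∘ v) = c ∘ z by rewrite compA.
    by exists (f ∘ pbpair h'), (s ∘ v), h'.
  exists g; apply: gP; exists (pb1 q c), (pb_sq q c).
  rewrite -[f in LHS]compm1; congr comp.
  by apply: pb_ext; rewrite ?pb1_pair ?pb2_pair compm1.
- move=> T W c f f' e; apply: (descent_local dy (c := c)) => S t v h.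
  by apply: (e _ t (s ∘ v)); rewrite compA.
move=> A π α act.
pose y' := y ∘ pb1 s π.
have hy : q ∘ (s ∘ pb1 y y') = q ∘ (π ∘ (pb2 s π ∘ pb2 y y')).
  by rewrite compA -/y pb_sq /y' /y -!compA; congr comp; rewrite !compA pb_sq.
have hα : s ∘ pb1 y y' = π ∘ dact α (s ∘ pb1 y y') (pb2 s π ∘ pb2 y y').
  by rewrite dact_over.
pose α' : hom (pb y y') (pb s π) := pbpair hα.
have α'E (T : C) (v : hom T Y) (a : hom T (pb s π)) :
    y ∘ v = y ∘ (pb1 s π ∘ a) ->
    pb1 s π ∘ dact α' v a = v /\
    pb2 s π ∘ dact α' v a = dact α (s ∘ v) (pb2 s π ∘ a).
  rewrite compA => h; rewrite -(dactE α' h) !compA pb1_pair pb2_pair pb1_pair.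
  by split=> //; rewrite (dactM α _ hy) -!compA pb1_pair pb2_pair.
have act' : descent_action (pb1 s π) α'.
  apply: descent_actionI.
  - by move=> T v a /α'E [].
  - move=> T a; have [//|e1 e2] := α'E _ (pb1 s π ∘ a) a.
    by apply: pb_ext; rewrite ?e1 // e2 pb_elt dact_unit.
  - move=> T v v' a h h'.
    have [e1 e2] := α'E _ v a h.
    have [|e3 e4] := α'E _ v' (dact α' v a); first by rewrite e1.
    have [|e5 e6] := α'E _ v' a; first by rewrite h'.
    apply: pb_ext; rewrite ?e3 ?e5 // e4 e6 e2 dact_assoc //.
      by rewrite -pb_elt !(compA q).
    by rewrite !compA.
have [B [b [r [ov ac su inj]]]] := descent_descended dy act'.
(* The quotient [r] of [s^* A] also serves for [A]: send [a] to [r(v, α(s v, a))],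
   which does not depend on [v]. *)
pose rel (T : C) (a : hom T A) (z : hom T B) :=
  exists (v : hom T Y) (w : hom T (pb s π)),
  [/\ q ∘ (s ∘ v) = q ∘ (π ∘ a), pb1 s π ∘ w = v,
      pb2 s π ∘ w = dact α (s ∘ v) a & z = r ∘ w].
have rel_ex (T : C) (v : hom T Y) (a : hom T A) :
    q ∘ (s ∘ v) = q ∘ (π ∘ a) -> exists z, rel T a z.
  move=> h; have k : s ∘ v = π ∘ dact α (s ∘ v) a by rewrite dact_over.
  exists (r ∘ pbpair k), v, (pbpair k); split=> //; first exact: pb1_pair.
  exact: pb2_pair.
have relP (T : C) (w : hom T (pb s π)) :
    rel T (pb2 s π ∘ w) (r ∘ w).
  exists (pb1 s π ∘ w), w.
  by split=> //; rewrite ?pb_elt // dact_unit.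
have [||T a v|k kP] := @descent_rel _ _ _ _ dy _ _ (q ∘ π) rel.
- move=> S T t a z [v [w [h1 h2 h3 ->]]]; exists (v ∘ t), (w ∘ t).
  have e : q ∘ (s ∘ (v ∘ t)) = q ∘ (π ∘ (a ∘ t)).
    by have := congr1 (fun f => f ∘ t) h1; rewrite /= -!compA.
  split=> //; last exact: esym (compA _ _ _).
    by rewrite compA h2.
  by rewrite compA h3 (dactM α _ h1) -compA.
- move=> T a z z' [v [w [h1 h2 h3 ->]]] [v' [w' [h1' h2' h3' ->]]].
  have h : y ∘ v = y ∘ (pb1 s π ∘ w') by rewrite h2' -!compA h1.
  have [e1 e2] := α'E _ v w' h.
  rewrite -(ac _ _ _ h); congr comp; apply: pb_ext; rewrite ?e1 // e2 h3'.
  by rewrite dact_assoc // h1.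
- by rewrite -!compA; apply: rel_ex.
exists B, b, k.
have kov : b ∘ k = q ∘ π.
  apply: (descent_local dy (c := q ∘ π)) => S t v; rewrite -!compA => h.
  have [z [v' [w [h1 h2 h3 hz]]]] := rel_ex _ _ _ h.
  rewrite (kP _ _ z); last by exists v', w.
  by rewrite hz compA ov -compA h2 -h1 compA.
have kE (T : C) (w : hom T (pb s π)) : k ∘ (pb2 s π ∘ w) = r ∘ w.
  exact: kP (relP _ _).
have kA (T : C) (z : hom T Z) (a : hom T A) :
    q ∘ z = q ∘ (π ∘ a) -> k ∘ dact α z a = k ∘ a.
  have kdact (S : C) (v : hom S Y) (a' : hom S A) :
      q ∘ (s ∘ v) = q ∘ (π ∘ a') -> k ∘ dact α (s ∘ v) a' = k ∘ a'.
    move=> h; have k1 : s ∘ v = π ∘ dact α (s ∘ v) a' by rewrite dact_over.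
    have := kE _ (pbpair k1); rewrite pb2_pair => ->; apply: esym; apply: kP.
    by exists v, (pbpair k1); split; rewrite ?pb1_pair ?pb2_pair.
  move=> h; apply: (descent_local dy (c := q ∘ z)) => S t v.
  rewrite -!compA => hy'; have hv : q ∘ (s ∘ v) = q ∘ (z ∘ t).
    by move: hy'; rewrite /y -?compA.
  have h' : q ∘ (z ∘ t) = q ∘ (π ∘ (a ∘ t)).
    by have := congr1 (fun f => f ∘ t) h; rewrite /= -!compA.
  rewrite (dactM α _ h) -(kdact _ v) ?dact_over //.
  by rewrite dact_assoc // -(kdact _ v (a ∘ t)) // hv h'.
have ovE (T : C) (w : hom T (pb s π)) : y ∘ (pb1 s π ∘ w) = b ∘ (r ∘ w).
  by rewrite [RHS]compA ov compA.
(* Two elements of [s^* A] with the same image in [B] differ only by the action. *)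
have rI (T : C) (w w' : hom T (pb s π)) : r ∘ w = r ∘ w' ->
    dact α (s ∘ (pb1 s π ∘ w')) (pb2 s π ∘ w) = pb2 s π ∘ w'.
  move=> e; have h : y ∘ (pb1 s π ∘ w') = y ∘ (pb1 s π ∘ w).
    by rewrite !ovE e.
  have [e1 <-] := α'E _ _ _ h; congr comp; apply: inj; first by rewrite e1.
  by rewrite ac.
split=> //.
- move=> T z c h.
  have yw (S : C) (t : hom S T) (w : hom S (pb s π)) : r ∘ w = c ∘ t ->
      q ∘ (z ∘ t) = q ∘ (π ∘ (pb2 s π ∘ w)).
    move=> e; transitivity (y ∘ (pb1 s π ∘ w)); last by rewrite /y -compA pb_elt.
    by rewrite ovE e !compA h.
  (* The element of [A] over [z] with image [c] is found by lifting [c] locally to [s^* A] and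
     moving its [A] component over [z]. *)
  pose R (S : C) (t : hom S T) (a : hom S A) := exists w : hom S (pb s π),
    r ∘ w = c ∘ t /\ a = dact α (z ∘ t) (pb2 s π ∘ w).
  have R_ex (S : C) (t : hom S T) (v : hom S Y) :
      y ∘ v = q ∘ z ∘ t -> exists a, R S t a.
    rewrite h -compA => /su [w [_ e]].
    by exists (dact α (z ∘ t) (pb2 s π ∘ w)), w.
  have [||//|a aP] := @descent_rel _ _ _ _ dy _ _ (q ∘ z) R.
  + move=> S S' u t a [w [e ->]]; exists (w ∘ u); rewrite !compA e.
    by rewrite (dactM α _ (yw _ _ _ e)).
  + move=> S t a a' [w [e ->]] [w' [e' ->]].
    have <- := rI _ w w'; last by rewrite e e'.
    by rewrite dact_assoc ?pb_elt -?(yw _ _ _ e) -?(yw _ _ _ e').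
  exists a; split;
    apply: (descent_local dy (c := q ∘ z)) => S t v /R_ex [a' [w [e ea]]];
    rewrite -compA (aP _ t a') ?ea; try by exists w.
    by rewrite dact_over // (yw _ _ _ e).
  by rewrite kA ?(yw _ _ _ e) // kE.
- move=> T a a' eπ ek; apply: (descent_local dy (c := q ∘ π ∘ a)) => S t v ht.
  have h : q ∘ (s ∘ v) = q ∘ (π ∘ (a ∘ t)) by rewrite !compA.
  have h' : q ∘ (s ∘ v) = q ∘ (π ∘ (a' ∘ t)) by rewrite h (compA π) eπ -compA.
  have k1 : s ∘ v = π ∘ dact α (s ∘ v) (a ∘ t) by rewrite dact_over.
  have k2 : s ∘ v = π ∘ dact α (s ∘ v) (a' ∘ t) by rewrite dact_over.
  have e : pbpair k1 = pbpair k2.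
    apply: inj; rewrite ?pb1_pair // -!kE !pb2_pair !kA //.
    by rewrite !compA ek.
  have eπ' : π ∘ (a ∘ t) = π ∘ (a' ∘ t) by rewrite !compA eπ.
  (* Both elements were moved over [s v], where [inj] identifies them; acting with [π a] moves them
     back. *)
  have := congr1 (fun w => dact α (π ∘ (a ∘ t)) (pb2 s π ∘ w)) e.
  rewrite /= !pb2_pair (dact_assoc act h) // [in RHS]eπ'.
  by rewrite (dact_assoc act h') // !dact_unit.
Qed.

(** * The fibre product of two covers is a cover *)

Section ProductCover.
Variables (C : cartesian) (X P0 P1 : C) (p0 : hom P0 X) (p1 : hom P1 X).
Hypotheses (d0 : descent p0) (d1 : descent p1).

Let o : hom (pb p0 p1) X := p0 ∘ pb1 p0 p1.

Lemma prod_cover0 (T : C) (z : hom T (pb p0 p1)) : o ∘ z = p0 ∘ (pb1 p0 p1 ∘ z).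
Proof. by rewrite compA. Qed.

Lemma prod_cover1 (T : C) (z : hom T (pb p0 p1)) : o ∘ z = p1 ∘ (pb2 p0 p1 ∘ z).
Proof. by rewrite /o pb_sq compA. Qed.

Lemma prod_cover_pair (T : C) (v0 : hom T P0) (v1 : hom T P1) :
  p0 ∘ v0 = p1 ∘ v1 ->
  exists z : hom T (pb p0 p1), pb1 p0 p1 ∘ z = v0 /\ pb2 p0 p1 ∘ z = v1.
Proof. by move=> h; exists (pbpair h); rewrite pb1_pair pb2_pair. Qed.

Lemma prod_cover_local (T W : C) (c : hom T X) (f f' : hom T W) :
  (forall (S : C) (t : hom S T) (z : hom S (pb p0 p1)),
     o ∘ z = c ∘ t -> f ∘ t = f' ∘ t) -> f = f'.
Proof.
move=> e; apply: (descent_local d0 (c := c)) => S t v0 h0.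
apply: (descent_local d1 (c := c ∘ t)) => S' t' v1 h1.
have [|z [z0 z1]] := @prod_cover_pair _ (v0 ∘ t') v1; first by rewrite compA h0.
by rewrite -!compA; apply: (e _ _ z); rewrite prod_cover0 z0 !compA h0.
Qed.

(** Where [P0] has an element, every element of [P1] over the same point extends to one of the fibre
    product. Hence [f] descends along [p0] to a map [g1] on [pb p1 c], and [g1] descends along [p1]
    to [Z]. *)
Lemma prod_cover_map (Z W : C) (c : hom Z X) (f : hom (pb o c) W) :
  (forall (T : C) (v v' : hom T (pb p0 p1)) (z : hom T Z)
     (h : o ∘ v = c ∘ z) (h' : o ∘ v' = c ∘ z), f ∘ pbpair h = f ∘ pbpair h') ->
  exists g : hom Z W, g ∘ pb2 o c = f.
Proof.
move=> fP.
pose R (T : C) (y : hom T (pb p1 c)) (w : hom T W) :=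
  exists (v : hom T (pb p0 p1)) (h : o ∘ v = c ∘ (pb2 p1 c ∘ y)),
    w = f ∘ pbpair h.
have [||T y v h|g1 g1P] := @descent_rel _ _ _ _ d0 _ _ (p1 ∘ pb1 p1 c) R.
- move=> S T t y w [v [h ->]].
  have h' : o ∘ (v ∘ t) = c ∘ (pb2 p1 c ∘ (y ∘ t)).
    by have := congr1 (fun k => k ∘ t) h; rewrite /= -!compA.
  exists (v ∘ t), h'; rewrite -compA pbpairM; congr comp.
  by apply: pbpair_eq; rewrite ?compA.
- by move=> T y w w' [v [h ->]] [v' [h' ->]]; apply: fP.
- rewrite -compA in h; have [z [z0 z1]] := prod_cover_pair h.
  have h' : o ∘ z = c ∘ (pb2 p1 c ∘ y) by rewrite prod_cover1 z1 pb_elt.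
  by exists (f ∘ pbpair h'), z, h'.
have g1E (T : C) (v : hom T (pb p0 p1)) (z : hom T Z) (h : o ∘ v = c ∘ z)
    (v1 : hom T P1) (h1 : p1 ∘ v1 = c ∘ z) : g1 ∘ pbpair h1 = f ∘ pbpair h.
  apply: g1P; exists v; have h' : o ∘ v = c ∘ (pb2 p1 c ∘ pbpair h1).
    by rewrite pb2_pair.
  by exists h'; congr comp; apply: pbpair_eq; rewrite ?pb2_pair.
have [|g gE] := descent_map d1 (c := c) (f := g1).
  move=> T v v' z h h'; apply: (descent_local d0 (c := p1 ∘ v)) => S t v0 h0.
  have [|w [w0 w1]] := @prod_cover_pair _ v0 (v ∘ t); first by rewrite h0 compA.
  have hw : o ∘ w = c ∘ (z ∘ t) by rewrite prod_cover0 w0 h0 h compA.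
  by rewrite -!compA !pbpairM !(g1E _ _ _ hw).
exists g.
have h := pb_sq o c; have h1 : p1 ∘ (pb2 p0 p1 ∘ pb1 o c) = c ∘ pb2 o c.
  by rewrite -prod_cover1.
rewrite -[X in g ∘ X](pb2_pair h1) compA gE (g1E _ _ _ h).
by rewrite -[RHS]compm1; congr comp; apply: pb_ext; rewrite ?pb1_pair ?pb2_pair compm1.
Qed.

Section Action.
Variables (A : C) (π : hom A (pb p0 p1)) (α : hom (pb o (o ∘ π)) A).
Hypothesis act : descent_action π α.

Let π0 := pb1 p0 p1 ∘ π.
Let π1 := pb2 p0 p1 ∘ π.

Lemma prod_π0 (T : C) (a : hom T A) : pb1 p0 p1 ∘ (π ∘ a) = π0 ∘ a.
Proof. exact: compA. Qed.

Lemma prod_π1 (T : C) (a : hom T A) : pb2 p0 p1 ∘ (π ∘ a) = π1 ∘ a.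
Proof. exact: compA. Qed.

Lemma prod_cover_sq (T : C) (a : hom T A) : p0 ∘ (π0 ∘ a) = p1 ∘ (π1 ∘ a).
Proof. by rewrite -prod_π0 -prod_π1 pb_elt. Qed.

Lemma prod_cover_sq0 (T : C) (a : hom T A) : o ∘ (π ∘ a) = p0 ∘ (π0 ∘ a).
Proof. by rewrite prod_cover0 prod_π0. Qed.

Lemma prod_action0 :
  exists α0 : hom (pb p0 (p0 ∘ π0)) A,
    forall (T : C) (v0 : hom T P0) (a : hom T A) (z : hom T (pb p0 p1)),
      p0 ∘ v0 = p0 ∘ (π0 ∘ a) -> pb1 p0 p1 ∘ z = v0 ->
      pb2 p0 p1 ∘ z = π1 ∘ a -> dact α0 v0 a = dact α z a.
Proof.
have k : p0 ∘ pb1 p0 (p0 ∘ π0) = p1 ∘ (π1 ∘ pb2 p0 (p0 ∘ π0)).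
  by rewrite pb_sq -compA prod_cover_sq.
exists (dact α (pbpair k) (pb2 p0 (p0 ∘ π0))) => T v0 a z h z0 z1.
rewrite compA in h; rewrite -(dactE _ h) dactM ?pb2_pair.
  congr dact; apply: pb_ext; rewrite ?pb1_pairA ?pb2_pairA ?pb1_pair //.
  by rewrite -compA pb2_pair.
by rewrite prod_cover1 pb2_pair prod_cover_sq0 prod_cover_sq.
Qed.

(** Were the result [B] known, [A] would be [P0 x_X P1 x_X B]. So [P0] is removed to leave [A1],
    expected to be [P1 x_X B], and then [P1]. The map [ρ : A1 -> P1] and the action [α1] are only
    accessible through lifts to [A], so their laws are checked locally on [P0]. *)
Lemma prod_cover_descended :
  exists (B : C) (b : hom B X) (r : hom A B), descended α b r.
Proof.
have [α0 α0E] := prod_action0.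
have α0ex (T : C) (v0 : hom T P0) (a : hom T A) : p0 ∘ v0 = p0 ∘ (π0 ∘ a) ->
    exists z, [/\ pb1 p0 p1 ∘ z = v0, pb2 p0 p1 ∘ z = π1 ∘ a,
      o ∘ z = o ∘ (π ∘ a) & dact α0 v0 a = dact α z a].
  move=> h; have [|z [z0 z1]] := @prod_cover_pair _ v0 (π1 ∘ a).
    by rewrite h prod_cover_sq.
  exists z; split=> //; last exact: α0E.
  by rewrite prod_cover1 z1 prod_cover_sq0 prod_cover_sq.
have π1act (T : C) (v0 : hom T P0) (a : hom T A) :
    p0 ∘ v0 = p0 ∘ (π0 ∘ a) -> π1 ∘ dact α0 v0 a = π1 ∘ a.
  by move=> /α0ex [z [z0 z1 h ->]]; rewrite -prod_π1 dact_over.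
have act0 : descent_action π0 α0.
  apply: descent_actionI.
  - by move=> T v a /α0ex [z [z0 z1 h ->]]; rewrite -prod_π0 dact_over.
  - by move=> T a; rewrite (α0E _ _ _ (π ∘ a)) ?dact_unit // compA.
  - move=> T v v' a h h'; have [z [z0 z1 hz ->]] := α0ex _ _ _ h.
    have [|z' [z0' z1' hz' ->]] := α0ex _ v' a; first by rewrite h' h.
    rewrite (α0E _ _ _ z') -?prod_π0 -?prod_π1 ?dact_over ?z0 ?z1 //.
    by rewrite dact_assoc // hz.
(* [A1] is [A] descended along [p0]; the action of [P1] descends with it. *)
have [A1 [b1 [r0 [ov0 ac0 su0 in0]]]] := descent_descended d0 act0.
have ov0E (T : C) (a : hom T A) : b1 ∘ (r0 ∘ a) = p0 ∘ (π0 ∘ a).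
  by rewrite compA ov0 compA.
have r0I (T : C) (a a' : hom T A) : r0 ∘ a = r0 ∘ a' ->
    p0 ∘ (π0 ∘ a') = p0 ∘ (π0 ∘ a) /\ dact α0 (π0 ∘ a') a = a'.
  move=> e; have h : p0 ∘ (π0 ∘ a') = p0 ∘ (π0 ∘ a) by rewrite -!ov0E e.
  by split=> //; apply: in0; rewrite ?(dact_over act0) // ac0.
(* [π1] is invariant under [α0] and therefore factors through [r0]. *)
have [||T x v /su0 [a [_ ax]]|ρ ρP] := @descent_rel _ _ _ _ d0 _ _ b1
    (fun T x w => exists a : hom T A, r0 ∘ a = x /\ w = π1 ∘ a).
- by move=> S T t x w [a [ax ->]]; exists (a ∘ t); rewrite !compA ax.
- move=> T x w w' [a [<- ->]] [a' [/esym /r0I [h <-] ->]].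
  by rewrite π1act.
- by exists (π1 ∘ a), a.
have {ρP} ρE (T : C) (a : hom T A) : ρ ∘ (r0 ∘ a) = π1 ∘ a.
  by apply: ρP; exists a.
have ρ1 : p1 ∘ ρ = b1.
  apply: (descent_local d0 (c := b1)) => S t v /su0 [a [_ <-]].
  by rewrite -compA ρE ov0E prod_cover_sq.
have ρ1E (T : C) (x : hom T A1) : p1 ∘ (ρ ∘ x) = b1 ∘ x by rewrite compA ρ1.
(* Elements of the fibre product that agree in [P1] move [a] to elements that differ by [α0], and
   [r0] identifies these. *)
have r0z (T : C) (a : hom T A) (z z' : hom T (pb p0 p1)) :
    o ∘ z = o ∘ (π ∘ a) -> pb2 p0 p1 ∘ z = pb2 p0 p1 ∘ z' ->
    r0 ∘ dact α z a = r0 ∘ dact α z' a.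
  move=> h e; have h' : o ∘ z' = o ∘ z by rewrite !prod_cover1 e.
  have k : p0 ∘ (pb1 p0 p1 ∘ z') = p0 ∘ (π0 ∘ dact α z a).
    by rewrite -prod_π0 dact_over // -!prod_cover0.
  rewrite -(dact_assoc act h h') -(α0E _ _ _ _ k erefl) ?(ac0 _ _ _ k) //.
  by rewrite -prod_π1 dact_over.
(* The action is [α1(v, r0 a) = r0(α(z, a))] for any [z] with [P1] component [v]. *)
have [||T y v|α1 α1P] := @descent_rel _ _ _ _ d0 (pb p1 (p1 ∘ ρ)) A1 (p1 ∘ pb1 _ _)
    (fun T y w => exists (a : hom T A) (z : hom T (pb p0 p1)),
      [/\ r0 ∘ a = pb2 _ _ ∘ y, o ∘ z = o ∘ (π ∘ a),
          pb2 p0 p1 ∘ z = pb1 _ _ ∘ y & w = r0 ∘ dact α z a]).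
- move=> S T t y w [a [z [ay h zy ->]]]; exists (a ∘ t), (z ∘ t).
  split; first by rewrite !compA ay.
  - by have := congr1 (fun k => k ∘ t) h; rewrite /= -!compA.
  - by rewrite !compA zy.
  - by rewrite -compA dactM.
- move=> T y w w' [a [z [ay h zy ->]]] [a' [z' [ay' h' zy' ->]]].
  have [k <-] := r0I _ a a' (etrans ay (esym ay')).
  have [u [u0 u1 hu ->]] := α0ex _ _ _ k.
  have hz : o ∘ z' = o ∘ u by rewrite h' hu !prod_cover_sq0.
  by rewrite (dact_assoc act hu hz); apply: r0z; rewrite // zy zy'.
- rewrite -compA => h.
  have h' : p0 ∘ v = b1 ∘ (pb2 _ _ ∘ y) by rewrite h pb_elt -compA ρ1E.
  have [a [a0 ay]] := su0 _ _ _ h'.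
  have [z [z0 z1]] := prod_cover_pair h.
  exists (r0 ∘ dact α z a), a, z; split=> //.
  by rewrite prod_cover_sq0 a0 prod_cover0 z0.
have {α1P} α1E (T : C) (a : hom T A) (z : hom T (pb p0 p1)) (v : hom T P1)
    (x : hom T A1) :
    o ∘ z = o ∘ (π ∘ a) -> pb2 p0 p1 ∘ z = v -> r0 ∘ a = x ->
    dact α1 v x = r0 ∘ dact α z a.
  move=> h zv ax; have k : p1 ∘ v = p1 ∘ ρ ∘ x.
    by rewrite -zv -ax -compA ρE -prod_cover_sq -prod_cover_sq0 -h prod_cover1.
  rewrite -(dactE _ k); apply: α1P; exists a, z.
  by rewrite pb1_pair pb2_pair.
have ex1 (T : C) (v : hom T P1) (x : hom T A1) (v0 : hom T P0) :
    p1 ∘ v = p1 ∘ (ρ ∘ x) -> p0 ∘ v0 = p1 ∘ v ->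
    exists (a : hom T A) (z : hom T (pb p0 p1)),
      [/\ r0 ∘ a = x, o ∘ z = o ∘ (π ∘ a), pb2 p0 p1 ∘ z = v
        & dact α1 v x = r0 ∘ dact α z a].
  move=> h h0; have [|a [a0 ax]] := su0 _ v0 x; first by rewrite h0 h compA ρ1.
  have [z [z0 z1]] := prod_cover_pair h0.
  have hz : o ∘ z = o ∘ (π ∘ a) by rewrite prod_cover_sq0 a0 prod_cover0 z0.
  by exists a, z; split=> //; apply: α1E.
have α1M (S T : C) (t : hom S T) (v : hom T P1) (x : hom T A1) :
    p1 ∘ v = p1 ∘ (ρ ∘ x) -> dact α1 v x ∘ t = dact α1 (v ∘ t) (x ∘ t).
  exact: dactM.
have sqM (S T : C) (t : hom S T) (v : hom T P1) (x : hom T A1) :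
    p1 ∘ v = p1 ∘ (ρ ∘ x) -> p1 ∘ (v ∘ t) = p1 ∘ (ρ ∘ (x ∘ t)).
  by move=> /(congr1 (fun k => k ∘ t)) /=; rewrite -!compA.
have over1 (T : C) (v : hom T P1) (x : hom T A1) :
    p1 ∘ v = p1 ∘ (ρ ∘ x) -> ρ ∘ dact α1 v x = v.
  move=> h; apply: (descent_local d0 (c := p1 ∘ v)) => S t v0 h0.
  rewrite -compA α1M //; have h' := sqM _ _ t _ _ h.
  have [|a [z [ax hz zv ->]]] := ex1 _ _ _ v0 h'; first by rewrite h0 compA.
  by rewrite ρE -prod_π1 dact_over.
have act1 : descent_action ρ α1.
  apply: descent_actionI => //.
  - move=> T x; apply: (descent_local d0 (c := b1 ∘ x)) => S t v0 h0.
    have [|a [a0 ax]] := su0 _ v0 (x ∘ t); first by rewrite h0 compA.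
    rewrite α1M // -compA -ax ρE.
    by rewrite (α1E _ a (π ∘ a)) ?dact_unit ?prod_π1.
  - move=> T v v' x h e; apply: (descent_local d0 (c := p1 ∘ v)) => S t v0 h0.
    have h' := sqM _ _ t _ _ h.
    have e' : p1 ∘ (v' ∘ t) = p1 ∘ (v ∘ t) by rewrite !compA e.
    have [|a [z [ax hz zv E]]] := ex1 _ _ _ v0 h'; first by rewrite h0 compA.
    have [|z' [z0' z1']] := @prod_cover_pair _ (pb1 p0 p1 ∘ z) (v' ∘ t).
      by rewrite -prod_cover0 prod_cover1 zv.
    have hz' : o ∘ z' = o ∘ z by rewrite !prod_cover0 z0'.
    rewrite α1M ?over1 // α1M // α1M ?e // E.
    rewrite (α1E _ (dact α z a) z') ?dact_over // dact_assoc //.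
    by rewrite (α1E _ a z') // hz'.
have [B [b [r1 [ov1 ac1 su1 in1]]]] := descent_descended d1 act1.
exists B, b, (r1 ∘ r0); split.
- have e := ρE _ (idm A); rewrite !compm1 in e.
  by rewrite compA ov1 -compA e /π1 /o pb_sq compA.
- move=> T z a h.
  rewrite -!compA -(α1E _ a z _ _ h erefl erefl) ac1 //.
  by rewrite ρE -prod_cover1 h prod_cover_sq0 prod_cover_sq.
- move=> T z x h; have [|y [yz yx]] := su1 _ (pb2 p0 p1 ∘ z) x.
    by rewrite -prod_cover1.
  have [|a [az ay]] := su0 _ (pb1 p0 p1 ∘ z) y.
    by rewrite -ρ1 -compA yz -prod_cover0 prod_cover1.
  exists a; split; last by rewrite -compA ay.
  by apply: pb_ext; rewrite ?prod_π0 ?prod_π1 // -ρE ay.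
- move=> T a a' e e'.
  apply: in0; first by rewrite -!prod_π0 e.
  apply: in1; first by rewrite !ρE -!prod_π1 e.
  by rewrite !compA.
Qed.

End Action.

Lemma descent_prod : descent o.
Proof.
split; [exact: prod_cover_map| |].
  move=> Z W c g g' e; apply: (prod_cover_local (c := c)) => S t v h.
  by rewrite -(pb2_pair h) !compA e.
by move=> A π α /prod_cover_descended [B [b [r H]]]; exists B, b, r; apply/descendedP.
Qed.

End ProductCover.

(** * Total operations on generalized elements *)

(** The operations of internal categories and bundles are given a junk value on
    non-composable arguments, so that equations can be rewritten without
    transporting composability proofs. *)
Section Multiplication.
Variable C : cartesian.

Definition mul (A : icat_data C) (T : C) (f g : hom T (ic1 A)) : hom T (ic1 A) :=
  match pselect (icd1 A ∘ f = icd0 A ∘ g) with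
  | left h => mulc h
  | right _ => f
  end.

Lemma mulE (A : icat_data C) (T : C) (f g : hom T (ic1 A))
    (h : icd1 A ∘ f = icd0 A ∘ g) : mulc h = mul f g.
Proof. by rewrite /mul; case: pselect => // h'; apply: mulc_eq. Qed.

Lemma mulM (A : icat_data C) (S T : C) (f g : hom T (ic1 A)) (t : hom S T) :
  icd1 A ∘ f = icd0 A ∘ g -> mul f g ∘ t = mul (f ∘ t) (g ∘ t).
Proof. by move=> h; rewrite -(mulE h) (mulc_pre h (pair_sqM h t)) mulE. Qed.

Section Category.
Variables (A : icat C) (T : C).
Implicit Types f g k : hom T (ic1 A).

Lemma d0mul f g : icd1 A ∘ f = icd0 A ∘ g -> icd0 A ∘ mul f g = icd0 A ∘ f.
Proof. by move=> h; rewrite -(mulE h) d0mulc. Qed.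

Lemma d1mul f g : icd1 A ∘ f = icd0 A ∘ g -> icd1 A ∘ mul f g = icd1 A ∘ g.
Proof. by move=> h; rewrite -(mulE h) d1mulc. Qed.

Lemma mul1l f (x : hom T (ic0 A)) : icd0 A ∘ f = x -> mul (ici A ∘ x) f = f.
Proof.
move=> <-; have h : icd1 A ∘ (ici A ∘ (icd0 A ∘ f)) = icd0 A ∘ f by rewrite d1i.
by rewrite -(mulE h) icm1l.
Qed.

Lemma mul1r f (x : hom T (ic0 A)) : icd1 A ∘ f = x -> mul f (ici A ∘ x) = f.
Proof.
move=> <-; have h : icd1 A ∘ f = icd0 A ∘ (ici A ∘ (icd1 A ∘ f)) by rewrite d0i.
by rewrite -(mulE h) icm1r.
Qed.

Lemma mulA f g k : icd1 A ∘ f = icd0 A ∘ g -> icd1 A ∘ g = icd0 A ∘ k ->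
  mul f (mul g k) = mul (mul f g) k.
Proof.
move=> hfg hgk.
have h1 : icd1 A ∘ f = icd0 A ∘ mulc hgk by rewrite d0mulc.
have h2 : icd1 A ∘ mulc hfg = icd0 A ∘ k by rewrite d1mulc.
by rewrite -(mulE hfg) -(mulE hgk) -(mulE h1) -(mulE h2) (icmA h1 h2).
Qed.

End Category.

Lemma if1_mul (A B : icat C) (F : ifunctor A B) (T : C) (f g : hom T (ic1 A)) :
  icd1 A ∘ f = icd0 A ∘ g -> if1 F ∘ mul f g = mul (if1 F ∘ f) (if1 F ∘ g).
Proof.
move=> h; have h' : icd1 B ∘ (if1 F ∘ f) = icd0 B ∘ (if1 F ∘ g).
  by rewrite !compA if_d0 if_d1 -!compA h.
by rewrite -(mulE h) -(mulE h') (if_m h h').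
Qed.

Lemma if_d0E (A B : icat C) (F : ifunctor A B) (T : C) (f : hom T (ic1 A)) :
  icd0 B ∘ (if1 F ∘ f) = if0 F ∘ (icd0 A ∘ f).
Proof. by rewrite !compA if_d0. Qed.

Lemma if_d1E (A B : icat C) (F : ifunctor A B) (T : C) (f : hom T (ic1 A)) :
  icd1 B ∘ (if1 F ∘ f) = if0 F ∘ (icd1 A ∘ f).
Proof. by rewrite !compA if_d1. Qed.

Section Groupoid.
Variables (G : igroupoid C) (T : C).
Implicit Types f g k : hom T (ic1 G).

Lemma d0inv f : icd0 G ∘ (igr_inv G ∘ f) = icd1 G ∘ f.
Proof. by rewrite compA igr_d0inv. Qed.

Lemma d1inv f : icd1 G ∘ (igr_inv G ∘ f) = icd0 G ∘ f.
Proof. by rewrite compA igr_d1inv. Qed.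

Lemma mulV f : mul f (igr_inv G ∘ f) = ici G ∘ (icd0 G ∘ f).
Proof.
have h : icd1 G ∘ f = icd0 G ∘ (igr_inv G ∘ f) by rewrite d0inv.
by rewrite -(mulE h) igr_mulV.
Qed.

Lemma mulVl f : mul (igr_inv G ∘ f) f = ici G ∘ (icd1 G ∘ f).
Proof.
have h : icd1 G ∘ (igr_inv G ∘ f) = icd0 G ∘ f by rewrite d1inv.
by rewrite -(mulE h) igr_mulVl.
Qed.

Lemma mulKV f g : icd0 G ∘ f = icd0 G ∘ g -> mul f (mul (igr_inv G ∘ f) g) = g.
Proof. by move=> h; rewrite mulA ?d0inv ?d1inv // mulV mul1l. Qed.

Lemma mul_injl f g g' : icd1 G ∘ f = icd0 G ∘ g -> icd1 G ∘ f = icd0 G ∘ g' ->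
  mul f g = mul f g' -> g = g'.
Proof.
move=> h h' /(congr1 (mul (igr_inv G ∘ f))).
by rewrite !mulA ?d1inv // mulVl !mul1l.
Qed.

End Groupoid.

(** [cc ψ v v'] is [ψ(v, v')], and the identity of [v] if [v] and [v'] do not lie
    over the same element of [X]. *)
Section Cocycles.
Variables (Y X : C) (y : hom Y X) (G : icat C).
Variable ψ : ifunctor (kernel_pair y) G.

Definition cc (T : C) (v v' : hom T Y) : hom T (ic1 G) :=
  match pselect (y ∘ v = y ∘ v') with
  | left h => if1 ψ ∘ (pbpair h : hom T (ic1 (kernel_pair y)))
  | right _ => ici G ∘ (if0 ψ ∘ v)
  end.

Section Elements.
Variable T : C.
Implicit Types v w : hom T Y.

Lemma ccE v w (h : y ∘ v = y ∘ w) :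
  if1 ψ ∘ (pbpair h : hom T (ic1 (kernel_pair y))) = cc v w.
Proof. by rewrite /cc; case: pselect => // h'; congr comp; apply: pbpair_eq. Qed.

Lemma cc_d0 v w : icd0 G ∘ cc v w = if0 ψ ∘ v.
Proof.
rewrite /cc; case: pselect => h; last by rewrite d0i.
by rewrite if_d0E /= pb1_pair.
Qed.

Lemma cc_d1 v w : y ∘ v = y ∘ w -> icd1 G ∘ cc v w = if0 ψ ∘ w.
Proof. by move=> h; rewrite -(ccE h) if_d1E /= pb2_pair. Qed.

Lemma cc_id v : cc v v = ici G ∘ (if0 ψ ∘ v).
Proof.
rewrite -(ccE (erefl (y ∘ v))) compA -if_i -compA; congr comp.
by apply: pb_ext; rewrite ?pb1_pair ?pb2_pair compA /= ?pb1_pair ?pb2_pair comp1m.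
Qed.

Lemma cc_mul u v w : y ∘ u = y ∘ v -> y ∘ v = y ∘ w ->
  mul (cc u v) (cc v w) = cc u w.
Proof.
move=> h k; have hk : y ∘ u = y ∘ w by rewrite h.
have e : icd1 (kernel_pair y) ∘ pbpair h = icd0 (kernel_pair y) ∘ pbpair k.
  by rewrite /= pb1_pair pb2_pair.
rewrite -(ccE h) -(ccE k) -(ccE hk) -(if1_mul ψ e) -(mulE e); congr comp.
by apply: pb_ext; rewrite ?(kp_mulc1 e) ?(kp_mulc2 e) ?pb1_pair ?pb2_pair.
Qed.

End Elements.

Lemma ccM (S T : C) (v w : hom T Y) (t : hom S T) : y ∘ v = y ∘ w ->
  cc v w ∘ t = cc (v ∘ t) (w ∘ t).
Proof.
move=> h; rewrite -(ccE h) -(ccE (pair_sqM h t)) -compA; congr comp.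
exact: pbpair_pre.
Qed.

End Cocycles.

Arguments cc {Y X y G} ψ {T} v v'.

Section BundleElements.
Variables (G : igroupoid C) (X : C) (P : bundle G X).

Definition act (T : C) (g : hom T (ic1 G)) (z : hom T (bdl P)) : hom T (bdl P) :=
  match pselect (icd0 G ∘ g = bdl_x P ∘ z) with
  | left h => bdl_act P ∘ pbpair h
  | right _ => z
  end.

Section Elements.
Variable T : C.
Implicit Types (g k : hom T (ic1 G)) (z : hom T (bdl P)).

Lemma actE g z (h : icd0 G ∘ g = bdl_x P ∘ z) : bdl_act P ∘ pbpair h = act g z.
Proof. by rewrite /act; case: pselect => // h'; congr comp; apply: pbpair_eq. Qed.

Lemma x_act g z : icd0 G ∘ g = bdl_x P ∘ z -> bdl_x P ∘ act g z = icd1 G ∘ g.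
Proof. by move=> h; rewrite -(actE h) compA bdl_x_act -compA pb1_pair. Qed.

Lemma p_act g z : icd0 G ∘ g = bdl_x P ∘ z -> bdl_p P ∘ act g z = bdl_p P ∘ z.
Proof. by move=> h; rewrite -(actE h) compA bdl_p_act -compA pb2_pair. Qed.

Lemma act_mul g k z : icd0 G ∘ g = bdl_x P ∘ z -> icd1 G ∘ g = icd0 G ∘ k ->
  act (mul g k) z = act k (act g z).
Proof.
move=> hg hgk.
have h1 : icd0 G ∘ mulc hgk = bdl_x P ∘ z by rewrite d0mulc.
have h2 : icd0 G ∘ k = bdl_x P ∘ (bdl_act P ∘ pbpair hg) by rewrite actE x_act.
by rewrite -(mulE hgk) -(actE h1) (bdl_actM h1 h2) !actE.
Qed.

Lemma act_id z : act (ici G ∘ (bdl_x P ∘ z)) z = z.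
Proof.
have h : icd0 G ∘ (ici G ∘ (bdl_x P ∘ z)) = bdl_x P ∘ z by rewrite d0i.
by rewrite -(actE h) bdl_act1.
Qed.

Local Notation dv := (cc (cocycle P)).

Lemma act_dv z z' : bdl_p P ∘ z = bdl_p P ∘ z' -> act (dv z z') z = z'.
Proof.
move=> h; rewrite -(ccE (cocycle P) h) /=.
have k := division_d0E (pbpair h); have k' := k; rewrite pb1_pair in k'.
rewrite -(actE k'); apply: etrans (pb2_pair h); rewrite -(division_actE k).
by congr comp; apply: pbpair_eq; rewrite ?pb1_pair.
Qed.

Lemma dv_uniq g z z' : icd0 G ∘ g = bdl_x P ∘ z -> act g z = z' -> dv z z' = g.
Proof.
move=> h <-; have hp : bdl_p P ∘ z = bdl_p P ∘ act g z by rewrite p_act.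
rewrite -(ccE _ hp) /=.
have k : icd0 G ∘ g = bdl_x P ∘ (pb1 _ _ ∘ pbpair hp) by rewrite pb1_pair.
apply: (divisionP (h := k)); rewrite pb2_pair -[RHS](actE h).
by congr comp; apply: pbpair_eq; rewrite ?pb1_pair.
Qed.

End Elements.

Lemma actM (S T : C) (g : hom T (ic1 G)) (z : hom T (bdl P)) (t : hom S T) :
  icd0 G ∘ g = bdl_x P ∘ z -> act g z ∘ t = act (g ∘ t) (z ∘ t).
Proof. by move=> h; rewrite -(actE h) -compA pbpairM actE. Qed.

End BundleElements.

Lemma bof_map_cc (G : igroupoid C) (Y X : C) (y : hom Y X)
    (ψ : ifunctor (kernel_pair y) G) (Q : bundle_of ψ) (T : C) (v v' : hom T Y) :
  y ∘ v = y ∘ v' -> cc (cocycle Q) (bof_map Q ∘ v) (bof_map Q ∘ v') = cc ψ v v'.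
Proof.
move=> h; have hq : bdl_p Q ∘ (bof_map Q ∘ v) = bdl_p Q ∘ (bof_map Q ∘ v').
  by rewrite !compA bof_map_p.
rewrite -(ccE _ h) -(ccE _ hq) -(bof_map_psi Q) -compA; congr comp.
by apply: pb_ext; rewrite /= ?pb1_pairA ?pb2_pairA -?compA ?pb1_pair ?pb2_pair.
Qed.

Lemma cocycle_kp_map (G : igroupoid C) (Y X : C) (y : hom Y X)
    (ψ : ifunctor (kernel_pair y) G) (R : bundle G X) (s : hom Y (bdl R))
    (e : bdl_p R ∘ s = y) :
  (forall (T : C) (v v' : hom T Y), y ∘ v = y ∘ v' ->
     cc (cocycle R) (s ∘ v) (s ∘ v') = cc ψ v v') ->
  if1 (cocycle R) ∘ if1 (kp_map e) = if1 ψ.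
Proof.
move=> /(_ _ _ _ (pb_sq y y)).
rewrite -(ccE _ (pb_sq y y)) -(ccE _ (kp_map_subproof e)) => ->.
rewrite -[RHS]compm1; congr comp.
by apply: pb_ext; rewrite ?pb1_pair ?pb2_pair compm1.
Qed.

Lemma cc_comp (Y X : C) (y : hom Y X) (G H : icat C)
    (ψ : ifunctor (kernel_pair y) G) (F : ifunctor G H) (T : C) (v v' : hom T Y) :
  y ∘ v = y ∘ v' -> cc (ifunctor_comp F ψ) v v' = if1 F ∘ cc ψ v v'.
Proof. by move=> h; rewrite -(ccE _ h) -(ccE _ h) /= compA. Qed.

Lemma cc_kp_map (Y Z X : C) (p : hom Y X) (q : hom Z X) (s : hom Y Z)
    (e : q ∘ s = p) (G : icat C) (ψ : ifunctor (kernel_pair q) G)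
    (T : C) (v v' : hom T Y) :
  p ∘ v = p ∘ v' -> cc (ifunctor_comp ψ (kp_map e)) v v' = cc ψ (s ∘ v) (s ∘ v').
Proof.
move=> h; have h' : q ∘ (s ∘ v) = q ∘ (s ∘ v') by rewrite !compA e.
rewrite -(ccE _ h) -(ccE _ h') /= -compA; congr comp; apply: pb_ext.
  by rewrite pb1_pairA -compA !pb1_pair.
by rewrite pb2_pairA -compA !pb2_pair.
Qed.

Lemma cc_pb (Y X : C) (y : hom Y X) (G : icat C) (ψ : ifunctor (kernel_pair y) G)
    (T : C) (w : hom T (pb y y)) :
  if1 ψ ∘ w = cc ψ (pb1 y y ∘ w) (pb2 y y ∘ w).
Proof. by rewrite -(ccE ψ (pb_elt w)) pbpair_eta. Qed.

(** Compatibility with identities is automatic since [φ(v, v)] is idempotent. *)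
Lemma cocycle_make (Y X : C) (y : hom Y X) (G : igroupoid C) (x : hom Y (ic0 G))
    (φ : hom (pb y y) (ic1 G)) :
  icd0 G ∘ φ = x ∘ pb1 y y -> icd1 G ∘ φ = x ∘ pb2 y y ->
  (forall (T : C) (u v w : hom T (pb y y)),
     pb2 y y ∘ u = pb1 y y ∘ v -> pb1 y y ∘ u = pb1 y y ∘ w ->
     pb2 y y ∘ v = pb2 y y ∘ w -> mul (φ ∘ u) (φ ∘ v) = φ ∘ w) ->
  exists ψ : ifunctor (kernel_pair y) G, if0 ψ = x /\ if1 ψ = φ.
Proof.
move=> h0 h1 hm.
have hi : φ ∘ ici (kernel_pair y) = ici G ∘ x.
  set d := ici (kernel_pair y).
  have d1 : pb1 y y ∘ d = idm Y by rewrite pb1_pair.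
  have d2 : pb2 y y ∘ d = idm Y by rewrite pb2_pair.
  have e0 : icd0 G ∘ (φ ∘ d) = x by rewrite compA h0 -compA d1 compm1.
  have e1 : icd1 G ∘ (φ ∘ d) = x by rewrite compA h1 -compA d2 compm1.
  have k := etrans e1 (esym e0).
  apply: (mul_injl k); first by rewrite d0i.
  by rewrite (hm _ _ _ d) ?d1 ?d2 // mul1r.
have hmul (T : C) (f g : hom T (pb y y)) (h : pb2 y y ∘ f = pb1 y y ∘ g)
    (h' : icd1 G ∘ (φ ∘ f) = icd0 G ∘ (φ ∘ g)) :
    φ ∘ @mulc C (kp_data y) T f g h = mulc h'.
  by rewrite (mulE h'); apply: esym; apply: hm => //; rewrite ?kp_mulc1 ?kp_mulc2.
by exists (@IFunctor C (kernel_pair y) G x φ h0 h1 hi hmul).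
Qed.

End Multiplication.

Arguments cc {C Y X y G} ψ {T} v v'.
Arguments act {C G X} P {T} g z.

(** * The principal bundle of a cocycle *)

Section BundleOfCocycle.
Variables (C : cartesian) (X Y : C) (y : hom Y X) (G : igroupoid C).
Variable ψ : ifunctor (kernel_pair y) G.
Hypothesis dy : descent y.

(** [(v, g)] stands for the element [g · s(v)] of the bundle, where [s] is the
    comparison map. *)
Let E : C := pb (if0 ψ) (icd0 G).
Let ev : hom E Y := pb1 _ _.
Let eg : hom E (ic1 G) := pb2 _ _.

Lemma ev_eg (T : C) (w : hom T E) : if0 ψ ∘ (ev ∘ w) = icd0 G ∘ (eg ∘ w).
Proof. exact: pb_elt. Qed.

Lemma E_pair (T : C) (v : hom T Y) (g : hom T (ic1 G)) :
  if0 ψ ∘ v = icd0 G ∘ g -> exists w : hom T E, ev ∘ w = v /\ eg ∘ w = g.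
Proof. by move=> h; exists (pbpair h); rewrite pb1_pair pb2_pair. Qed.

Lemma cc_eg (T : C) (v : hom T Y) (w : hom T E) : y ∘ v = y ∘ (ev ∘ w) ->
  icd1 G ∘ cc ψ v (ev ∘ w) = icd0 G ∘ (eg ∘ w).
Proof. by move=> h; rewrite cc_d1 // ev_eg. Qed.

(** Since [s(v') = ψ(v, v') · s(v)], the pairs [(v', g)] and [(v, ψ(v, v'); g)] have to name the
    same element of the bundle. The action passes from one name to the other, so descending along it
    amounts to dividing by this identification. *)
Lemma translation_action :
  exists α : hom (pb y (y ∘ ev)) E, descent_action ev α /\
    forall (T : C) (v : hom T Y) (w : hom T E), y ∘ v = y ∘ (ev ∘ w) ->
      eg ∘ dact α v w = mul (cc ψ v (ev ∘ w)) (eg ∘ w).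
Proof.
set v := pb1 y (y ∘ ev); set w := pb2 y (y ∘ ev).
have hy : y ∘ v = y ∘ (ev ∘ w) by rewrite pb_sq compA.
have [|α [αv αg]] := @E_pair _ v (mul (cc ψ v (ev ∘ w)) (eg ∘ w)).
  by rewrite d0mul ?cc_d0 // cc_eg.
have αE (T : C) (v' : hom T Y) (w' : hom T E) : y ∘ v' = y ∘ (ev ∘ w') ->
    ev ∘ dact α v' w' = v' /\ eg ∘ dact α v' w' = mul (cc ψ v' (ev ∘ w')) (eg ∘ w').
  rewrite [in y ∘ (ev ∘ w')]compA => h; rewrite -(dactE α h) !compA αv αg pb1_pair.
  by rewrite mulM ?cc_eg // ccM // -!compA pb1_pair pb2_pair.
exists α; split; last by move=> T v' w' /αE [].
apply: descent_actionI => [T v' w' /αE []|T w'|T v1 v2 w' h1 h2] //.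
  have [//|e1 e2] := αE _ (ev ∘ w') w'.
  by apply: pb_ext; rewrite ?[pb1 _ _ ∘ _]e1 // [pb2 _ _ ∘ _]e2 cc_id mul1l // ev_eg.
have [e1 e2] := αE _ _ _ h1.
have [|e3 e4] := αE _ v2 (dact α v1 w'); first by rewrite e1.
have [|e5 e6] := αE _ v2 w'; first by rewrite h2.
apply: pb_ext; rewrite ?[pb1 _ _ ∘ _]e3 ?[pb1 _ _ ∘ _]e5 //.
rewrite [LHS]e4 [RHS]e6 e1 e2 mulA ?cc_mul ?cc_d1 ?cc_d0 // -ev_eg //.
Qed.

(** The bundle [Q] descends from [E]. Its operations are prescribed on representatives [(v, g)] and
    come from [descent_rel]; its laws reduce to those of [G] after lifting to [E]. The projection
    [q] is of effective descent by [descent_cancel], because [q s = y]. *)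
Lemma bundle_of_exists : inhabited (bundle_of ψ).
Proof.
have [α [αact αg]] := translation_action.
have [Q [q [r [qr rα rsurj rinj]]]] := descent_descended dy αact.
have qrE (T : C) (w : hom T E) : q ∘ (r ∘ w) = y ∘ (ev ∘ w).
  by rewrite compA qr compA.
have rI (T : C) (w w' : hom T E) : r ∘ w = r ∘ w' ->
    y ∘ (ev ∘ w') = y ∘ (ev ∘ w) /\ dact α (ev ∘ w') w = w'.
  move=> e; have h : y ∘ (ev ∘ w') = y ∘ (ev ∘ w) by rewrite -!qrE e.
  by split=> //; apply: rinj; rewrite ?(dact_over αact) // rα.
have rI2 (T : C) (w w' : hom T E) : r ∘ w = r ∘ w' ->
    eg ∘ w' = mul (cc ψ (ev ∘ w') (ev ∘ w)) (eg ∘ w).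
  by move=> /rI [h e]; rewrite -[in LHS]e αg.
have [|||x xP] := @descent_rel _ _ _ _ dy Q (ic0 G) q
    (fun T z u => exists w : hom T E, r ∘ w = z /\ u = icd1 G ∘ (eg ∘ w)).
- by move=> S T t z u [w [e ->]]; exists (w ∘ t); rewrite !compA e.
- move=> T z u u' [w [e ->]] [w' [e' ->]].
  have e2 : r ∘ w = r ∘ w' by rewrite e.
  by have [h _] := rI _ _ _ e2; rewrite (rI2 _ _ _ e2) d1mul // cc_eg.
- by move=> T z v /rsurj [w [_ e]]; exists (icd1 G ∘ (eg ∘ w)), w.
have {xP} xE (T : C) (w : hom T E) : x ∘ (r ∘ w) = icd1 G ∘ (eg ∘ w).
  by apply: xP; exists w.
pose Z := pb (icd0 G) x.
(* Acting with [k] on the element named by [(v, g)] gives the one named by [(v, g; k)]. *)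
have [|||a aP] := @descent_rel _ _ _ _ dy Z Q (q ∘ pb2 _ _)
    (fun T k z => exists w w' : hom T E, [/\ r ∘ w = pb2 _ _ ∘ k, ev ∘ w' = ev ∘ w,
      eg ∘ w' = mul (eg ∘ w) (pb1 _ _ ∘ k) & z = r ∘ w']).
- move=> S T t k z [w [w' [e1 e2 e3 ->]]]; exists (w ∘ t), (w' ∘ t).
  have h : icd1 G ∘ (eg ∘ w) = icd0 G ∘ (pb1 _ _ ∘ k) by rewrite -xE e1 pb_elt.
  by split; rewrite !compA ?e1 ?e2 ?e3 // (mulM t h).
- move=> T k z z' [w1 [w1' [e1 e2 e3 ->]]] [w2 [w2' [f1 f2 f3 ->]]].
  have e : r ∘ w1 = r ∘ w2 by rewrite e1.
  have [h _] := rI _ _ _ e.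
  have h' : y ∘ (ev ∘ w2) = y ∘ (ev ∘ w1') by rewrite h e2.
  have <- : dact α (ev ∘ w2) w1' = w2'.
    apply: pb_ext; first by rewrite [LHS](dact_over αact h') -f2.
    rewrite [LHS](αg _ _ _ h') [RHS]f3 (rI2 _ _ _ e) e2 e3 mulA ?cc_eg //.
    by rewrite -xE e1 pb_elt.
  by rewrite rα.
- move=> T k v; rewrite -compA => /rsurj [w [_ e]].
  have [|w' [e1 e2]] := @E_pair _ (ev ∘ w) (mul (eg ∘ w) (pb1 _ _ ∘ k)).
    by rewrite d0mul ?ev_eg // -xE e pb_elt.
  by exists (r ∘ w'), w, w'.
have {aP} aE (T : C) (g : hom T (ic1 G)) (w w' : hom T E) (z : hom T Q)
    (h : icd0 G ∘ g = x ∘ z) : r ∘ w = z -> ev ∘ w' = ev ∘ w ->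
    eg ∘ w' = mul (eg ∘ w) g -> a ∘ pbpair h = r ∘ w'.
  by move=> e1 e2 e3; apply: aP; exists w, w'; rewrite pb1_pair pb2_pair.
(* The comparison map sends [v] to the class of [(v, id)]. *)
have [|u [uv ug]] := @E_pair _ (idm Y) (ici G ∘ if0 ψ).
  by rewrite d0i compm1.
pose s := r ∘ u.
have qs : q ∘ s = y by rewrite qrE uv compm1.
have eq : effective_descent q.
  by apply/descent_effective_descent/(@descent_cancel _ _ _ _ s); rewrite qs.
pose ta (T : C) (g : hom T (ic1 G)) (z : hom T Q) : hom T Q :=
  match pselect (icd0 G ∘ g = x ∘ z) with
  | left h => a ∘ pbpair h
  | right _ => z
  end.
have taE (T : C) (g : hom T (ic1 G)) (z : hom T Q) (h : icd0 G ∘ g = x ∘ z) :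
    a ∘ pbpair h = ta T g z.
  by rewrite /ta; case: pselect => // h'; congr comp; apply: pbpair_eq.
have taM (S T : C) (t : hom S T) (g : hom T (ic1 G)) (z : hom T Q) :
    icd0 G ∘ g = x ∘ z -> ta T g z ∘ t = ta S (g ∘ t) (z ∘ t).
  by move=> h; rewrite -(taE _ _ _ h) -compA pbpairM taE.
have ta_r (T : C) (g : hom T (ic1 G)) (w : hom T E) : icd0 G ∘ g = icd1 G ∘ (eg ∘ w) ->
    exists w' : hom T E,
      [/\ ta T g (r ∘ w) = r ∘ w', ev ∘ w' = ev ∘ w & eg ∘ w' = mul (eg ∘ w) g].
  move=> k; have h : icd0 G ∘ g = x ∘ (r ∘ w) by rewrite xE.
  have [|w' [e1 e2]] := @E_pair _ (ev ∘ w) (mul (eg ∘ w) g).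
    by rewrite d0mul ?ev_eg.
  by exists w'; rewrite -(taE _ _ _ h); split=> //; apply: aE e1 e2.
(* Every element of [Q] has a representative in [E] locally on [Y]. *)
have local (T W : C) (z : hom T Q) (f f' : hom T W) :
    (forall (S : C) (t : hom S T) (w : hom S E), z ∘ t = r ∘ w -> f ∘ t = f' ∘ t) ->
    f = f'.
  move=> e; apply: (descent_local dy (c := q ∘ z)) => S t v.
  by rewrite -compA => /rsurj [w [_ wz]]; apply: e (esym wz).
have dM (S T : C) (t : hom S T) (g : hom T (ic1 G)) (z : hom T Q) (w : hom S E) :
    icd0 G ∘ g = x ∘ z -> z ∘ t = r ∘ w -> icd0 G ∘ (g ∘ t) = icd1 G ∘ (eg ∘ w).
  by move=> h e; rewrite -xE -e !compA h.
have x_ta (T : C) (g : hom T (ic1 G)) (z : hom T Q) :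
    icd0 G ∘ g = x ∘ z -> x ∘ ta T g z = icd1 G ∘ g.
  move=> h; apply: (local _ _ z) => S t w e; rewrite -!compA taM // e.
  have k := dM _ _ _ _ _ _ h e; have [w' [-> _ wg]] := ta_r _ _ _ k.
  by rewrite xE wg d1mul.
have q_ta (T : C) (g : hom T (ic1 G)) (z : hom T Q) :
    icd0 G ∘ g = x ∘ z -> q ∘ ta T g z = q ∘ z.
  move=> h; apply: (local _ _ z) => S t w e; rewrite -!compA taM // e.
  have k := dM _ _ _ _ _ _ h e; have [w' [-> wv _]] := ta_r _ _ _ k.
  by rewrite !qrE wv.
have ta1 (T : C) (z : hom T Q) : ta T (ici G ∘ (x ∘ z)) z = z.
  have h : icd0 G ∘ (ici G ∘ (x ∘ z)) = x ∘ z by rewrite d0i.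
  apply: (local _ _ z) => S t w e; rewrite taM // e.
  have k := dM _ _ _ _ _ _ h e; have [w' [-> wv wg]] := ta_r _ _ _ k.
  congr comp; apply: pb_ext => //; rewrite [LHS]wg -!compA e xE mul1r //.
have ta_mul (T : C) (g k : hom T (ic1 G)) (z : hom T Q) :
    icd0 G ∘ g = x ∘ z -> icd1 G ∘ g = icd0 G ∘ k ->
    ta T (mul g k) z = ta T k (ta T g z).
  move=> hg hgk; have hm : icd0 G ∘ mul g k = x ∘ z by rewrite d0mul.
  have hk : icd0 G ∘ k = x ∘ ta T g z by rewrite x_ta.
  apply: (local _ _ z) => S t w e; rewrite !taM // e.
  have [w1 [e1 v1 g1]] := ta_r _ _ _ (dM _ _ _ _ _ _ hm e).
  have [w2 [e2 v2 g2]] := ta_r _ _ _ (dM _ _ _ _ _ _ hg e).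
  have e2' : ta T g z ∘ t = r ∘ w2 by rewrite taM // e.
  have [w3 [e3 v3 g3]] := ta_r _ _ _ (dM _ _ _ _ _ _ hk e2').
  rewrite e1 e2 e3; congr comp; apply: pb_ext; first by rewrite [LHS]v1 -v2 -v3.
  rewrite [LHS]g1 [RHS]g3 g2 mulM // mulA // ?(dM _ _ _ _ _ _ hg e) //.
  by rewrite !compA hgk.
have x_a : x ∘ a = icd1 G ∘ pb1 _ _.
  have := x_ta _ _ _ (pb_elt (idm Z)).
  by rewrite -(taE _ _ _ (pb_elt (idm Z))) pbpair_eta !compm1.
have q_a : q ∘ a = q ∘ pb2 _ _.
  have := q_ta _ _ _ (pb_elt (idm Z)).
  by rewrite -(taE _ _ _ (pb_elt (idm Z))) pbpair_eta !compm1.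
(* Two elements over the same point of [X] can be represented with a common [v], say by [(v, g1)]
   and [(v, g2)]; the quotient taking the first to the second is then [g1^-1; g2]. The second
   component of [k] is taken to the first, as in the map [(a, π_2)]. *)
pose divides (T : C) (k : hom T (pb q q)) (g : hom T (ic1 G)) :=
  exists w w' : hom T E, [/\ r ∘ w = pb2 _ _ ∘ k, r ∘ w' = pb1 _ _ ∘ k,
    ev ∘ w' = ev ∘ w, icd1 G ∘ (eg ∘ w) = icd0 G ∘ g & eg ∘ w' = mul (eg ∘ w) g].
have divides_ex (T : C) (k : hom T (pb q q)) (v : hom T Y) :
    y ∘ v = q ∘ (pb1 _ _ ∘ k) -> exists g, divides T k g.
  move=> h; have [w' [wv' wz']] := rsurj _ _ _ h.
  rewrite pb_elt in h; have [w [wv wz]] := rsurj _ _ _ h.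
  exists (mul (igr_inv G ∘ (eg ∘ w)) (eg ∘ w')), w, w'.
  have k0 : icd0 G ∘ (eg ∘ w) = icd0 G ∘ (eg ∘ w') by rewrite -!ev_eg wv wv'.
  split; rewrite ?wv //; first by rewrite d0mul ?d0inv ?d1inv.
  by rewrite mulKV.
have [|||δ δP] := @descent_rel _ _ _ _ dy (pb q q) (ic1 G) (q ∘ pb1 _ _) divides.
- move=> S T t k g [w [w' [e1 e2 e3 e4 e5]]]; exists (w ∘ t), (w' ∘ t).
  split; rewrite !compA ?e1 ?e2 ?e3 ?e5 ?(mulM t e4) //.
  by have := congr1 (fun k => k ∘ t) e4; rewrite /= -!compA.
- move=> T k g g' [w1 [w1' [e1 e2 e3 e4 e5]]] [w2 [w2' [f1 f2 f3 f4 f5]]].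
  have e : r ∘ w1 = r ∘ w2 by rewrite e1.
  have e' : r ∘ w1' = r ∘ w2' by rewrite e2.
  have [h _] := rI _ _ _ e; have k1 := cc_eg h.
  have g1 := rI2 _ _ _ e; have g2 := rI2 _ _ _ e'.
  have f4' : icd1 G ∘ (eg ∘ w2) = icd0 G ∘ g by rewrite g1 d1mul.
  apply: (mul_injl f4' f4); rewrite -f5 g2 e3 f3 e5 mulA // -g1 //.
- by move=> T k v; rewrite -compA; apply: divides_ex.
have δ_d0 : icd0 G ∘ δ = x ∘ pb2 q q.
  apply: (descent_local dy (c := q ∘ pb1 q q)) => S t v; rewrite -!compA.
  move=> /divides_ex [g gt]; rewrite (δP _ _ _ gt).
  by have [w [w' [<- _ _ e _]]] := gt; rewrite xE.
have principal : is_iso (pbpair q_a).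
  exists (pbpair δ_d0); split; apply: pb_ext; rewrite compm1 compA ?pb1_pair ?pb2_pair.
  - apply: (local _ _ (pb2 _ _)) => S t w e; rewrite -compA.
    have k : icd0 G ∘ (pb1 (icd0 G) x ∘ t) = icd1 G ∘ (eg ∘ w).
      by rewrite pb_elt e xE.
    apply: δP; have [w' [e1 e2 e3]] := ta_r _ _ _ k.
    exists w, w'; split=> //; rewrite ?pb1_pairA ?pb2_pairA ?pb1_pair ?pb2_pair ?e //.
    by rewrite -e1 -e -(taE _ _ _ (pb_elt t)) pbpair_eta.
  - by rewrite ?pb2_pair.
  - apply: (descent_local dy (c := q ∘ pb1 q q)) => S t v; rewrite -!compA.
    move=> /divides_ex [g gt]; have gE := δP _ _ _ gt.
    have [w [w' [e1 e2 e3 e4 e5]]] := gt.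
    by rewrite pbpairM -e2; apply: aE e1 e3 _; rewrite gE.
  - by rewrite ?pb2_pair.
have a1 (T : C) (z : hom T Q) (h : icd0 G ∘ (ici G ∘ (x ∘ z)) = x ∘ z) :
    a ∘ pbpair h = z by rewrite taE ta1.
have aM (T : C) (g k : hom T (ic1 G)) (z : hom T Q)
    (hgk : icd1 G ∘ g = icd0 G ∘ k) (hg : icd0 G ∘ g = x ∘ z)
    (h1 : icd0 G ∘ mulc hgk = x ∘ z) (h2 : icd0 G ∘ k = x ∘ (a ∘ pbpair hg)) :
    a ∘ pbpair h1 = a ∘ pbpair h2 by rewrite !taE mulE ta_mul.
pose b := Bundle eq x_a a1 aM principal.
have b_act (T : C) (g : hom T (ic1 G)) (z : hom T Q) : act b g z = ta T g z.
  rewrite /ta; case: pselect => [h|h]; first by rewrite -(actE (P := b) h).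
  by rewrite /act; case: pselect.
have sE (T : C) (v : hom T Y) : r ∘ (u ∘ v) = s ∘ v by rewrite compA.
have x_s : x ∘ s = if0 ψ by rewrite xE ug d1i.
have dv_s (T : C) (v v' : hom T Y) : y ∘ v = y ∘ v' ->
    cc (cocycle b) (s ∘ v) (s ∘ v') = cc ψ v v'.
  move=> h; apply: dv_uniq; first by rewrite cc_d0 /= compA x_s.
  have uvE (v1 : hom T Y) : ev ∘ (u ∘ v1) = v1 by rewrite compA uv comp1m.
  have ugE (v1 : hom T Y) : eg ∘ (u ∘ v1) = ici G ∘ (if0 ψ ∘ v1).
    by rewrite compA ug -compA.
  rewrite b_act -!sE; have [|w [-> wv wg]] := ta_r _ (cc ψ v v') (u ∘ v).
    by rewrite cc_d0 ugE d1i.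
  have k : y ∘ v = y ∘ (ev ∘ (u ∘ v')) by rewrite uvE.
  rewrite -(rα _ _ _ k); congr comp; apply: pb_ext.
    by rewrite [LHS]wv uvE [RHS](dact_over αact k).
  by rewrite [LHS]wg [RHS](αg _ _ _ k) uvE !ugE mul1l ?cc_d0 // mul1r // cc_d1.
pose e : bdl_p b ∘ s = y := qs.
exact: inhabits (@BundleOf _ _ _ _ _ ψ b s e x_s (cocycle_kp_map e dv_s)).
Qed.

End BundleOfCocycle.

(** * Morphisms out of a bundle *)

Section BundleMorphisms.
Variables (C : cartesian) (X : C).

Lemma act_injl (G : igroupoid C) (R : bundle G X) (T : C) (z u u' : hom T (bdl R)) :
  bdl_p R ∘ z = bdl_p R ∘ u -> bdl_p R ∘ z = bdl_p R ∘ u' ->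
  cc (cocycle R) z u = cc (cocycle R) z u' -> u = u'.
Proof. by move=> h h' e; rewrite -(act_dv h) e act_dv. Qed.

Lemma bundle_hom_cc (G : igroupoid C) (P Q : bundle G X) (h : bundle_hom P Q)
    (T : C) (z z' : hom T (bdl P)) : bdl_p P ∘ z = bdl_p P ∘ z' ->
  cc (cocycle Q) (h ∘ z) (h ∘ z') = cc (cocycle P) z z'.
Proof.
move=> e; have k : icd0 G ∘ cc (cocycle P) z z' = bdl_x P ∘ z by rewrite cc_d0.
have k' : icd0 G ∘ cc (cocycle P) z z' = bdl_x Q ∘ (h ∘ z).
  by rewrite compA bmap_x.
apply: dv_uniq => //; rewrite -(actE k') -(bmap_act k k') actE act_dv //.
Qed.

Lemma bundle_hom_make (G : igroupoid C) (P Q : bundle G X) (f : hom (bdl P) (bdl Q)) :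
  bdl_p Q ∘ f = bdl_p P -> bdl_x Q ∘ f = bdl_x P ->
  (forall (T : C) (z z' : hom T (bdl P)), bdl_p P ∘ z = bdl_p P ∘ z' ->
     cc (cocycle Q) (f ∘ z) (f ∘ z') = cc (cocycle P) z z') ->
  exists h : bundle_hom P Q, bmap h = f.
Proof.
move=> fp fx fcc.
suff H (T : C) (g : hom T (ic1 G)) (z : hom T (bdl P))
    (h : icd0 G ∘ g = bdl_x P ∘ z) (h' : icd0 G ∘ g = bdl_x Q ∘ (f ∘ z)) :
    f ∘ (bdl_act P ∘ pbpair h) = bdl_act Q ∘ pbpair h'.
  by exists (BundleHom fp fx H).
rewrite !actE; have k : bdl_p P ∘ z = bdl_p P ∘ act P g z by rewrite p_act.
have kf : bdl_p Q ∘ (f ∘ z) = bdl_p Q ∘ (f ∘ act P g z) by rewrite !compA fp.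
by rewrite -(act_dv kf) fcc // (dv_uniq h erefl).
Qed.

(** With [s] the comparison map, an element [z] of [Q] is [ψ^Q(s v, z) · s(v)] for any local [v], so
    [t'] must send it to [F(ψ^Q(s v, z)) · t(v)]. The cocycle condition on [t] makes this
    independent of [v]. For [D0] and [D1] it turns the projections of [P0 x_X P1] into legs of the
    bundle. *)
Lemma bundle_of_extend (G H : igroupoid C) (F : ifunctor H G) (Y : C) (y : hom Y X)
    (ψ : ifunctor (kernel_pair y) H) (Q : bundle_of ψ) (R : bundle G X)
    (t : hom Y (bdl R)) :
  descent y -> bdl_p R ∘ t = y -> bdl_x R ∘ t = if0 F ∘ if0 ψ ->
  (forall (T : C) (v v' : hom T Y), y ∘ v = y ∘ v' ->
     cc (cocycle R) (t ∘ v) (t ∘ v') = if1 F ∘ cc ψ v v') ->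
  exists t' : hom (bdl Q) (bdl R),
    [/\ t' ∘ bof_map Q = t, bdl_p R ∘ t' = bdl_p Q,
        bdl_x R ∘ t' = if0 F ∘ bdl_x Q
      & forall (T : C) (z z' : hom T (bdl Q)), bdl_p Q ∘ z = bdl_p Q ∘ z' ->
          cc (cocycle R) (t' ∘ z) (t' ∘ z') = if1 F ∘ cc (cocycle Q) z z'].
Proof.
move=> dy tp tx tcc.
pose γ (T : C) (v : hom T Y) (z : hom T (bdl Q)) := cc (cocycle Q) (bof_map Q ∘ v) z.
have sp (T : C) (v : hom T Y) : bdl_p Q ∘ (bof_map Q ∘ v) = y ∘ v.
  by rewrite compA bof_map_p.
have γ0 (T : C) (v : hom T Y) (z : hom T (bdl Q)) :
    icd0 G ∘ (if1 F ∘ γ T v z) = bdl_x R ∘ (t ∘ v).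
  by rewrite if_d0E cc_d0 !compA tx -(compA _ (bdl_x Q)) bof_map_x.
have γ1 (T : C) (v : hom T Y) (z : hom T (bdl Q)) : y ∘ v = bdl_p Q ∘ z ->
    icd1 G ∘ (if1 F ∘ γ T v z) = if0 F ∘ (bdl_x Q ∘ z).
  by move=> h; rewrite if_d1E cc_d1 // sp.
have γM (S T : C) (u : hom S T) (v : hom T Y) (z : hom T (bdl Q)) :
    y ∘ v = bdl_p Q ∘ z -> γ T v z ∘ u = γ S (v ∘ u) (z ∘ u).
  by move=> h; rewrite /γ ccM ?sp // compA.
have γmul (T : C) (v v' : hom T Y) (z : hom T (bdl Q)) :
    y ∘ v = bdl_p Q ∘ z -> y ∘ v' = bdl_p Q ∘ z ->
    if1 F ∘ γ T v' z = mul (cc (cocycle R) (t ∘ v') (t ∘ v)) (if1 F ∘ γ T v z).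
  move=> h h'; have hy : y ∘ v' = y ∘ v by rewrite h h'.
  rewrite tcc // -(bof_map_cc Q hy) -if1_mul; last first.
    by rewrite cc_d1 ?cc_d0 // !sp.
  by rewrite cc_mul ?sp.
have [||T z v h|t' tP] := @descent_rel _ _ _ _ dy (bdl Q) (bdl R) (bdl_p Q)
    (fun T z w => exists v : hom T Y, y ∘ v = bdl_p Q ∘ z /\
       w = act R (if1 F ∘ γ T v z) (t ∘ v)).
- move=> S T u z w [v [h ->]]; exists (v ∘ u); split; first by rewrite !compA h.
  by rewrite actM // -!compA γM.
- move=> T z w w' [v [h ->]] [v' [h' ->]].
  rewrite (γmul _ _ _ _ h h') act_mul ?act_dv //.
  + by rewrite !(compA _ t) tp h.
  + by rewrite cc_d0.
  + by rewrite cc_d1 ?γ0 // !(compA _ t) tp h.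
- by exists (act R (if1 F ∘ γ T v z) (t ∘ v)), v.
have {tP} tE (T : C) (v : hom T Y) (z : hom T (bdl Q)) : y ∘ v = bdl_p Q ∘ z ->
    t' ∘ z = act R (if1 F ∘ γ T v z) (t ∘ v) by move=> h; apply: tP; exists v.
have t'p : bdl_p R ∘ t' = bdl_p Q.
  apply: (descent_local dy (c := bdl_p Q)) => S u v h; rewrite -compA (tE _ _ _ h).
  by rewrite p_act // compA tp.
have t'x : bdl_x R ∘ t' = if0 F ∘ bdl_x Q.
  apply: (descent_local dy (c := bdl_p Q)) => S u v h; rewrite -compA (tE _ _ _ h).
  by rewrite x_act // γ1 // compA.
exists t'; split=> //.
  rewrite (tE _ (idm Y)) ?bof_map_p ?compm1 //.
  by rewrite /γ !compm1 cc_id compA if_i -compA /= bof_map_x -tx act_id.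
move=> T z z' h; apply: (descent_local dy (c := bdl_p Q ∘ z)) => S u v.
rewrite -compA => hv; have hv' : y ∘ v = bdl_p Q ∘ (z' ∘ u).
  by rewrite hv !compA h.
have hR : bdl_p R ∘ (t' ∘ z) = bdl_p R ∘ (t' ∘ z') by rewrite !compA t'p.
have hu : bdl_p Q ∘ (z ∘ u) = bdl_p Q ∘ (z' ∘ u) by rewrite -hv.
rewrite (ccM _ _ hR) -!compA (ccM _ _ h).
have d0 : icd0 G ∘ (if1 F ∘ cc (cocycle Q) (z ∘ u) (z' ∘ u)) = bdl_x R ∘ (t' ∘ (z ∘ u)).
  by rewrite if_d0E cc_d0 [RHS]compA t'x compA.
apply: dv_uniq => //; rewrite (tE _ _ _ hv) (tE _ _ _ hv') -act_mul //; last first.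
  by rewrite γ1 // if_d0E cc_d0.
by rewrite -if1_mul ?cc_mul ?sp // cc_d1 ?cc_d0 ?sp.
Qed.

End BundleMorphisms.

(** * Isomorphisms of the arrow category *)

Section CoreElements.
Variables (C : cartesian) (A : icat C) (T : C).

Lemma fwdV (s : hom T (isos A)) :
  mul (fwd A ∘ s) (bwd A ∘ s) = ici A ∘ (icd0 A ∘ (fwd A ∘ s)).
Proof. by rewrite -mul_fwd mulE. Qed.

Lemma bwdV (s : hom T (isos A)) :
  mul (bwd A ∘ s) (fwd A ∘ s) = ici A ∘ (icd1 A ∘ (fwd A ∘ s)).
Proof. by rewrite -mul_bwd mulE. Qed.

Lemma core_make (f g : hom T (ic1 A)) :
  icd1 A ∘ f = icd0 A ∘ g -> icd1 A ∘ g = icd0 A ∘ f ->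
  mul f g = ici A ∘ (icd0 A ∘ f) -> mul g f = ici A ∘ (icd0 A ∘ g) ->
  exists s : hom T (isos A), fwd A ∘ s = f.
Proof.
move=> h k; rewrite -(mulE h) -(mulE k) => e e'.
by exists (iso_mk e e'); rewrite fwd_mk.
Qed.

Lemma fwd_injl (s : hom T (isos A)) (f g : hom T (ic1 A)) :
  icd1 A ∘ (fwd A ∘ s) = icd0 A ∘ f -> icd1 A ∘ (fwd A ∘ s) = icd0 A ∘ g ->
  mul (fwd A ∘ s) f = mul (fwd A ∘ s) g -> f = g.
Proof.
move=> h k /(congr1 (mul (bwd A ∘ s))).
by rewrite !mulA -?bwd_fwd // bwdV !mul1l.
Qed.

End CoreElements.

Section ArrowCore.
Variables (C : cartesian) (A : icat C) (T : C).

Local Notation dom s := (arr_dom A ∘ s).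
Local Notation cod s := (arr_cod A ∘ s).

Lemma arr_mul (f g : hom T (ic1 (arrow A))) :
  icd1 (arrow A) ∘ f = icd0 (arrow A) ∘ g ->
  dom (mul f g) = mul (dom f) (dom g) /\ cod (mul f g) = mul (cod f) (cod g).
Proof.
move=> h; split; first exact: (if1_mul (arrow_domain A)).
exact: (if1_mul (arrow_codomain A)).
Qed.

Lemma arr_id (x : hom T (ic1 A)) :
  dom (ici (arrow A) ∘ x) = ici A ∘ (icd0 A ∘ x) /\
  cod (ici (arrow A) ∘ x) = ici A ∘ (icd1 A ∘ x).
Proof.
split; rewrite !compA; congr comp; first exact: (if_i (arrow_domain A)).
exact: (if_i (arrow_codomain A)).
Qed.

Lemma fwd_D0 (s : hom T (isos (arrow A))) :
  fwd A ∘ (if1 (D0 A) ∘ s) = dom (fwd (arrow A) ∘ s).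
Proof. by rewrite compA fwd_mk -compA. Qed.

Lemma fwd_D1 (s : hom T (isos (arrow A))) :
  fwd A ∘ (if1 (D1 A) ∘ s) = cod (fwd (arrow A) ∘ s).
Proof. by rewrite compA fwd_mk -compA. Qed.

Lemma src_core (s : hom T (isos (arrow A))) :
  icd0 (core (arrow A)) ∘ s = arr_src A ∘ (fwd (arrow A) ∘ s).
Proof. exact: esym (compA _ _ _). Qed.

Lemma tgt_core (s : hom T (isos (arrow A))) :
  icd1 (core (arrow A)) ∘ s = arr_tgt A ∘ (fwd (arrow A) ∘ s).
Proof. exact: esym (compA _ _ _). Qed.

Lemma core_arrow_ext (s s' : hom T (isos (arrow A))) :
  icd0 (core (arrow A)) ∘ s = icd0 (core (arrow A)) ∘ s' ->
  icd1 (core (arrow A)) ∘ s = icd1 (core (arrow A)) ∘ s' ->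
  if1 (D0 A) ∘ s = if1 (D0 A) ∘ s' -> if1 (D1 A) ∘ s = if1 (D1 A) ∘ s' -> s = s'.
Proof.
move=> e0 e1 f0 f1; apply: isos_ext; apply: square_ext.
- by rewrite -!src_core.
- by rewrite -!fwd_D1 f1.
- by rewrite -!fwd_D0 f0.
- by rewrite -!tgt_core.
Qed.

Lemma core_arrow_comm (s : hom T (isos (arrow A))) :
  mul (icd0 (core (arrow A)) ∘ s) (fwd A ∘ (if1 (D1 A) ∘ s))
  = mul (fwd A ∘ (if1 (D0 A) ∘ s)) (icd1 (core (arrow A)) ∘ s).
Proof.
have := square_comm (fwd (arrow A) ∘ s).
by rewrite !mulE fwd_D0 fwd_D1 src_core tgt_core => ->.
Qed.

(** The inverse square has the inverses of [h] and [k] as its components; it commutes by [e'],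
    obtained by cancelling [h] on the left and [k] on the right. *)
Lemma iso_square (u v : hom T (ic1 A)) (h k : hom T (isos A)) :
  icd0 (core A) ∘ h = icd0 A ∘ u -> icd1 (core A) ∘ h = icd0 A ∘ v ->
  icd0 (core A) ∘ k = icd1 A ∘ u -> icd1 (core A) ∘ k = icd1 A ∘ v ->
  mul u (fwd A ∘ k) = mul (fwd A ∘ h) v ->
  exists s : hom T (isos (arrow A)),
    [/\ icd0 (core (arrow A)) ∘ s = u, icd1 (core (arrow A)) ∘ s = v,
        if1 (D0 A) ∘ s = h & if1 (D1 A) ∘ s = k].
Proof.
move=> /(etrans (compA _ _ _)) h0 /(etrans (compA _ _ _)) h1.
move=> /(etrans (compA _ _ _)) k0 /(etrans (compA _ _ _)) k1 e.
have hb0 : icd0 A ∘ (bwd A ∘ h) = icd0 A ∘ v by rewrite -fwd_bwd.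
have hb1 : icd1 A ∘ (bwd A ∘ h) = icd0 A ∘ u by rewrite bwd_fwd.
have kb0 : icd0 A ∘ (bwd A ∘ k) = icd1 A ∘ v by rewrite -fwd_bwd.
have kb1 : icd1 A ∘ (bwd A ∘ k) = icd1 A ∘ u by rewrite bwd_fwd.
have e' : mul v (bwd A ∘ k) = mul (bwd A ∘ h) u.
  have e1 := congr1 (mul (bwd A ∘ h)) e.
  rewrite (mulA (f := bwd A ∘ h) (g := fwd A ∘ h)) -?bwd_fwd // bwdV h1 mul1l // in e1.
  rewrite -e1 -!mulA ?d0mul ?d1mul -?fwd_bwd //.
  by rewrite fwdV mul1r // k0.
have [f [fs fc fd ft]] : exists f : hom T (arr1 A), [/\ arr_src A ∘ f = u,
    cod f = fwd A ∘ k, dom f = fwd A ∘ h & arr_tgt A ∘ f = v].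
  have l1 : icd1 A ∘ u = icd0 A ∘ (fwd A ∘ k) by [].
  have l2 : icd1 A ∘ (fwd A ∘ h) = icd0 A ∘ v by [].
  have l : mulc l1 = mulc l2 by rewrite !mulE.
  by exists (square l); rewrite src_square cod_square dom_square tgt_square.
have [g [gs gc gd gt]] : exists f : hom T (arr1 A), [/\ arr_src A ∘ f = v,
    cod f = bwd A ∘ k, dom f = bwd A ∘ h & arr_tgt A ∘ f = u].
  have l1 : icd1 A ∘ v = icd0 A ∘ (bwd A ∘ k) by [].
  have l2 : icd1 A ∘ (bwd A ∘ h) = icd0 A ∘ u by [].
  have l : mulc l1 = mulc l2 by rewrite !mulE.
  by exists (square l); rewrite src_square cod_square dom_square tgt_square.
have hfg : icd1 (arrow A) ∘ f = icd0 (arrow A) ∘ g by rewrite /= ft gs.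
have hgf : icd1 (arrow A) ∘ g = icd0 (arrow A) ∘ f by rewrite /= fs gt.
have [s sE] : exists s : hom T (isos (arrow A)), fwd (arrow A) ∘ s = f.
  have [fgd fgc] := arr_mul hfg; have [gfd gfc] := arr_mul hgf.
  apply: (@core_make _ (arrow A) _ f g) => //.
    have [id_d id_c] := arr_id u; rewrite [icd0 (arrow A) ∘ f]fs; apply: square_ext.
    - by rewrite [LHS](d0mul hfg) [RHS](d0i (A := arrow A)) [LHS]fs.
    - by rewrite id_c fgc fc gc fwdV k0.
    - by rewrite id_d fgd fd gd fwdV h0.
    - by rewrite [LHS](d1mul hfg) [RHS](d1i (A := arrow A)) [LHS]gt.
  have [id_d id_c] := arr_id v; rewrite [icd0 (arrow A) ∘ g]gs; apply: square_ext.
  - by rewrite [LHS](d0mul hgf) [RHS](d0i (A := arrow A)) [LHS]gs.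
  - by rewrite id_c gfc fc gc bwdV k1.
  - by rewrite id_d gfd fd gd bwdV h1.
  - by rewrite [LHS](d1mul hgf) [RHS](d1i (A := arrow A)) [LHS]ft.
exists s; split.
- by rewrite src_core sE.
- by rewrite tgt_core sE.
- by apply: isos_ext; rewrite fwd_D0 sE.
- by apply: isos_ext; rewrite fwd_D1 sE.
Qed.

End ArrowCore.

(** * Morphisms of principal bundles and triples *)

Section PrinHom.
Variables (C : cartesian) (A : icat C) (X : C) (P0 P1 : bundle (core A) X).

Local Notation p0 := (bdl_p P0).
Local Notation p1 := (bdl_p P1).
Local Notation o := (over_prod P0 P1).
Local Notation pr0 := (pb1 p0 p1).
Local Notation pr1 := (pb2 p0 p1).
Local Notation c0 := (cc (cat_cocycle P0)).
Local Notation c1 := (cc (cat_cocycle P1)).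

Lemma cat_cocycleE (P : bundle (core A) X) (T : C) (z z' : hom T (bdl P)) :
  bdl_p P ∘ z = bdl_p P ∘ z' ->
  cc (cat_cocycle P) z z' = fwd A ∘ cc (cocycle P) z z'.
Proof. exact: cc_comp. Qed.

Lemma cat_cocycle_injl (P : bundle (core A) X) (T : C) (z z' : hom T (bdl P))
    (f g : hom T (ic1 A)) : bdl_p P ∘ z = bdl_p P ∘ z' ->
  icd0 A ∘ f = bdl_x P ∘ z' -> icd0 A ∘ g = bdl_x P ∘ z' ->
  mul (cc (cat_cocycle P) z z') f = mul (cc (cat_cocycle P) z z') g -> f = g.
Proof.
move=> h hf hg; rewrite cat_cocycleE //.
have e : icd1 A ∘ (fwd A ∘ cc (cocycle P) z z') = bdl_x P ∘ z'.
  by rewrite -cat_cocycleE // cc_d1 //= comp1m.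
by apply: fwd_injl; rewrite e.
Qed.

Lemma over_prod0 (T : C) (z : hom T (pb p0 p1)) : o ∘ z = p0 ∘ (pr0 ∘ z).
Proof. exact: prod_cover0. Qed.

Lemma over_prod1 (T : C) (z : hom T (pb p0 p1)) : o ∘ z = p1 ∘ (pr1 ∘ z).
Proof. exact: prod_cover1. Qed.

Lemma over_prod_eq (T : C) (z z' : hom T (pb p0 p1)) : o ∘ z = o ∘ z' ->
  p0 ∘ (pr0 ∘ z) = p0 ∘ (pr0 ∘ z') /\ p1 ∘ (pr1 ∘ z) = p1 ∘ (pr1 ∘ z').
Proof. by rewrite -over_prod0 -over_prod1 -over_prod0 -over_prod1. Qed.

Definition natural (η : hom (pb p0 p1) (ic1 A)) : Prop :=
  forall (T : C) (z z' : hom T (pb p0 p1)), o ∘ z = o ∘ z' ->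
    mul (c0 (pr0 ∘ z) (pr0 ∘ z')) (η ∘ z') = mul (η ∘ z) (c1 (pr1 ∘ z) (pr1 ∘ z')).

Lemma prin_hom_d0 (η : prin_hom P0 P1) (T : C) (z : hom T (pb p0 p1)) :
  icd0 A ∘ (intc η ∘ z) = bdl_x P0 ∘ (pr0 ∘ z).
Proof. by rewrite compA (intc_d0 η) /= comp1m compA. Qed.

Lemma prin_hom_d1 (η : prin_hom P0 P1) (T : C) (z : hom T (pb p0 p1)) :
  icd1 A ∘ (intc η ∘ z) = bdl_x P1 ∘ (pr1 ∘ z).
Proof. by rewrite compA (intc_d1 η) /= comp1m compA. Qed.

Lemma prin_hom_natural (η : prin_hom P0 P1) : natural (intc η).
Proof.
move=> T z z' h; have [h0 h1] := over_prod_eq h.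
have := @intc_nat _ _ _ _ _ η T (pbpair h).
have e0 : if1 (ifunctor_comp (cat_cocycle P0) (kp_proj1 P0 P1)) ∘ pbpair h
    = c0 (pr0 ∘ z) (pr0 ∘ z').
  by rewrite cc_pb pb1_pair pb2_pair cc_kp_map.
have e1 : if1 (ifunctor_comp (cat_cocycle P1) (kp_proj2 P0 P1)) ∘ pbpair h
    = c1 (pr1 ∘ z) (pr1 ∘ z').
  by rewrite cc_pb pb1_pair pb2_pair cc_kp_map.
have k : icd1 A ∘ (if1 (ifunctor_comp (cat_cocycle P0) (kp_proj1 P0 P1)) ∘ pbpair h)
    = icd0 A ∘ (intc η ∘ (icd1 (kernel_pair o) ∘ pbpair h)).
  by rewrite e0 /= pb2_pair prin_hom_d0 cc_d1 //= comp1m.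
have k' : icd1 A ∘ (intc η ∘ (icd0 (kernel_pair o) ∘ pbpair h))
    = icd0 A ∘ (if1 (ifunctor_comp (cat_cocycle P1) (kp_proj2 P0 P1)) ∘ pbpair h).
  by rewrite e1 /= pb1_pair prin_hom_d1 cc_d0 //= comp1m.
move=> /(_ k k'); rewrite !mulE e0 e1.
by rewrite [icd1 _ ∘ _]pb2_pair [icd0 _ ∘ _]pb1_pair.
Qed.

Lemma prin_hom_make (η : hom (pb p0 p1) (ic1 A)) :
  icd0 A ∘ η = bdl_x P0 ∘ pr0 -> icd1 A ∘ η = bdl_x P1 ∘ pr1 -> natural η ->
  exists ζ : prin_hom P0 P1, intc ζ = η.
Proof.
move=> h0 h1 nat.
have k0 : icd0 A ∘ η = if0 (ifunctor_comp (cat_cocycle P0) (kp_proj1 P0 P1)).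
  by rewrite /= comp1m.
have k1 : icd1 A ∘ η = if0 (ifunctor_comp (cat_cocycle P1) (kp_proj2 P0 P1)).
  by rewrite /= comp1m.
suff k : forall (T : C) (f : hom T (ic1 (kernel_pair o)))
    (h : icd1 A ∘ (if1 (ifunctor_comp (cat_cocycle P0) (kp_proj1 P0 P1)) ∘ f)
       = icd0 A ∘ (η ∘ (icd1 (kernel_pair o) ∘ f)))
    (h' : icd1 A ∘ (η ∘ (icd0 (kernel_pair o) ∘ f))
       = icd0 A ∘ (if1 (ifunctor_comp (cat_cocycle P1) (kp_proj2 P0 P1)) ∘ f)),
    mulc h = mulc h'.
  by exists (@INatTrans _ _ _ (ifunctor_comp (cat_cocycle P0) (kp_proj1 P0 P1))
    (ifunctor_comp (cat_cocycle P1) (kp_proj2 P0 P1)) η k0 k1 k).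
move=> T f h h'; rewrite !mulE !cc_pb !cc_kp_map; try exact: pb_elt.
exact: (nat _ _ _ (pb_elt f)).
Qed.

Lemma prin_hom_eq (η ζ : prin_hom P0 P1) : intc η = intc ζ -> η = ζ.
Proof.
case: η ζ => [f f0 f1 fn] [g g0 g1 gn] /= e; subst g.
by congr INatTrans; apply: Prop_irrelevance.
Qed.

Section Legs.
Variables (P : bundle (core (arrow A)) X).
Variables (t0 : hom (bdl P) (bdl P0)) (t1 : hom (bdl P) (bdl P1)).

(** For a triple [(β0, P, β1)], [t0] and [t1] are the composites of the comparison
    maps [P -> Σ_{D0} P] and [P -> Σ_{D1} P] with [β0^-1] and [β1]. *)
Record legs : Prop := Legs {
  leg0_p : p0 ∘ t0 = bdl_p P;
  leg0_x : bdl_x P0 ∘ t0 = icd0 A ∘ bdl_x P;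
  leg0_cc : forall (T : C) (w w' : hom T (bdl P)), bdl_p P ∘ w = bdl_p P ∘ w' ->
    cc (cocycle P0) (t0 ∘ w) (t0 ∘ w') = if1 (D0 A) ∘ cc (cocycle P) w w';
  leg1_p : p1 ∘ t1 = bdl_p P;
  leg1_x : bdl_x P1 ∘ t1 = icd1 A ∘ bdl_x P;
  leg1_cc : forall (T : C) (w w' : hom T (bdl P)), bdl_p P ∘ w = bdl_p P ∘ w' ->
    cc (cocycle P1) (t1 ∘ w) (t1 ∘ w') = if1 (D1 A) ∘ cc (cocycle P) w w' }.

(** [η(t0 w, t1 w) = x_P(w)]. *)
Definition restricts (η : hom (pb p0 p1) (ic1 A)) : Prop :=
  forall (T : C) (w : hom T (bdl P)) (z : hom T (pb p0 p1)),
    pr0 ∘ z = t0 ∘ w -> pr1 ∘ z = t1 ∘ w -> η ∘ z = bdl_x P ∘ w.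

(** By naturality, [f = η(z)] is determined by [η(t0 w, t1 w)] through this
    equation. *)
Definition transports (T : C) (w : hom T (bdl P)) (z : hom T (pb p0 p1))
    (f : hom T (ic1 A)) : Prop :=
  mul (c0 (t0 ∘ w) (pr0 ∘ z)) f = mul (bdl_x P ∘ w) (c1 (t1 ∘ w) (pr1 ∘ z)).

Hypothesis lg : legs.

Lemma leg0_pE (T : C) (w : hom T (bdl P)) : p0 ∘ (t0 ∘ w) = bdl_p P ∘ w.
Proof. by rewrite compA (leg0_p lg). Qed.
Lemma leg1_pE (T : C) (w : hom T (bdl P)) : p1 ∘ (t1 ∘ w) = bdl_p P ∘ w.
Proof. by rewrite compA (leg1_p lg). Qed.
Lemma leg0_xE (T : C) (w : hom T (bdl P)) :
  bdl_x P0 ∘ (t0 ∘ w) = icd0 A ∘ (bdl_x P ∘ w).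
Proof. by rewrite compA (leg0_x lg) -compA. Qed.
Lemma leg1_xE (T : C) (w : hom T (bdl P)) :
  bdl_x P1 ∘ (t1 ∘ w) = icd1 A ∘ (bdl_x P ∘ w).
Proof. by rewrite compA (leg1_x lg) -compA. Qed.

Lemma leg_pair (T : C) (w : hom T (bdl P)) :
  exists z : hom T (pb p0 p1), [/\ pr0 ∘ z = t0 ∘ w, pr1 ∘ z = t1 ∘ w
    & o ∘ z = bdl_p P ∘ w].
Proof.
have [|z [z0 z1]] := @prod_cover_pair _ _ _ _ p0 p1 _ (t0 ∘ w) (t1 ∘ w).
  by rewrite leg0_pE leg1_pE.
by exists z; rewrite over_prod0 z0 leg0_pE.
Qed.

Lemma transports_fun (T : C) (w : hom T (bdl P)) (z : hom T (pb p0 p1))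
    (f f' : hom T (ic1 A)) :
  bdl_p P ∘ w = o ∘ z -> icd0 A ∘ f = bdl_x P0 ∘ (pr0 ∘ z) ->
  icd0 A ∘ f' = bdl_x P0 ∘ (pr0 ∘ z) ->
  transports w z f -> transports w z f' -> f = f'.
Proof.
move=> h hf hf' tf tf'; have k : p0 ∘ (t0 ∘ w) = p0 ∘ (pr0 ∘ z).
  by rewrite leg0_pE h over_prod0.
by apply: (cat_cocycle_injl k hf hf'); rewrite tf -tf'.
Qed.

Lemma natural_transports (η : hom (pb p0 p1) (ic1 A)) :
  natural η -> restricts η ->
  forall (T : C) (w : hom T (bdl P)) (z : hom T (pb p0 p1)),
    bdl_p P ∘ w = o ∘ z -> transports w z (η ∘ z).
Proof.
move=> nat re T w z h; have [z' [z0 z1 hz]] := leg_pair w.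
have := nat _ z' z; rewrite hz h z0 z1 => /(_ erefl) e.
by rewrite /transports e (re _ w).
Qed.

(** This is the commuting square underlying [ψ^P(w, w')], an isomorphism of the arrow category whose
    two components are the cocycles along the legs. *)
Lemma leg_square (T : C) (w w' : hom T (bdl P)) : bdl_p P ∘ w = bdl_p P ∘ w' ->
  mul (bdl_x P ∘ w) (c1 (t1 ∘ w) (t1 ∘ w'))
  = mul (c0 (t0 ∘ w) (t0 ∘ w')) (bdl_x P ∘ w').
Proof.
move=> h; rewrite !cat_cocycleE ?leg0_pE ?leg1_pE //.
rewrite (leg0_cc lg h) (leg1_cc lg h).
by have := core_arrow_comm (cc (cocycle P) w w'); rewrite cc_d0 cc_d1.
Qed.

(** Independence of the local choice of [w]: both cocycles starting at [w] factor through [w'], and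
    [leg_square] carries [x_P] across. *)
Lemma transports_invariant (T : C) (w w' : hom T (bdl P)) (z : hom T (pb p0 p1))
    (f : hom T (ic1 A)) :
  bdl_p P ∘ w = bdl_p P ∘ w' -> bdl_p P ∘ w' = o ∘ z ->
  icd0 A ∘ f = bdl_x P0 ∘ (pr0 ∘ z) ->
  transports w' z f -> transports w z f.
Proof.
move=> h h' hf tf; have k0 : p0 ∘ (t0 ∘ w) = p0 ∘ (t0 ∘ w') by rewrite !leg0_pE.
have k1 : p1 ∘ (t1 ∘ w) = p1 ∘ (t1 ∘ w') by rewrite !leg1_pE.
have l0 : p0 ∘ (t0 ∘ w') = p0 ∘ (pr0 ∘ z) by rewrite leg0_pE h' over_prod0.
have l1 : p1 ∘ (t1 ∘ w') = p1 ∘ (pr1 ∘ z) by rewrite leg1_pE h' over_prod1.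
rewrite /transports -(cc_mul _ k0 l0) -(cc_mul _ k1 l1) -mulA.
- rewrite tf mulA.
  + by rewrite -leg_square // -mulA // ?cc_d0 ?cc_d1 //= comp1m leg1_xE.
  + by rewrite cc_d1 //= comp1m leg0_xE.
  + by rewrite cc_d0 /= comp1m leg1_xE.
- by rewrite cc_d0 ?cc_d1.
- by rewrite hf cc_d1 //= comp1m.
Qed.

Lemma transportsM (S T : C) (t : hom S T) (w : hom T (bdl P)) (z : hom T (pb p0 p1))
    (f : hom T (ic1 A)) : bdl_p P ∘ w = o ∘ z ->
  icd0 A ∘ f = bdl_x P0 ∘ (pr0 ∘ z) ->
  transports w z f -> transports (w ∘ t) (z ∘ t) (f ∘ t).
Proof.
move=> h hf /(congr1 (fun k => k ∘ t)) /=.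
have k0 : p0 ∘ (t0 ∘ w) = p0 ∘ (pr0 ∘ z) by rewrite leg0_pE h over_prod0.
have k1 : p1 ∘ (t1 ∘ w) = p1 ∘ (pr1 ∘ z) by rewrite leg1_pE h over_prod1.
rewrite /transports mulM; last by rewrite cc_d1 //= comp1m hf.
by rewrite mulM ?cc_d0 //= ?comp1m ?leg1_xE // !ccM // -!compA.
Qed.

Lemma transports_ex (T : C) (w : hom T (bdl P)) (z : hom T (pb p0 p1)) :
  bdl_p P ∘ w = o ∘ z -> exists f : hom T (ic1 A),
    [/\ icd0 A ∘ f = bdl_x P0 ∘ (pr0 ∘ z), icd1 A ∘ f = bdl_x P1 ∘ (pr1 ∘ z)
      & transports w z f].
Proof.
move=> h; have k0 : p0 ∘ (t0 ∘ w) = p0 ∘ (pr0 ∘ z) by rewrite leg0_pE h over_prod0.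
have k1 : p1 ∘ (t1 ∘ w) = p1 ∘ (pr1 ∘ z) by rewrite leg1_pE h over_prod1.
have hx : icd1 A ∘ (bdl_x P ∘ w) = icd0 A ∘ c1 (t1 ∘ w) (pr1 ∘ z).
  by rewrite cc_d0 /= comp1m leg1_xE.
have hg : icd1 A ∘ c0 (pr0 ∘ z) (t0 ∘ w)
    = icd0 A ∘ mul (bdl_x P ∘ w) (c1 (t1 ∘ w) (pr1 ∘ z)).
  by rewrite d0mul // cc_d1 //= comp1m leg0_xE.
exists (mul (c0 (pr0 ∘ z) (t0 ∘ w)) (mul (bdl_x P ∘ w) (c1 (t1 ∘ w) (pr1 ∘ z)))).
split; first by rewrite d0mul // cc_d0 /= comp1m.
  by rewrite !d1mul // cc_d1 //= comp1m.
rewrite /transports mulA //; last by rewrite cc_d1 ?cc_d0.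
rewrite cc_mul // cc_id mul1l // d0mul //= comp1m leg0_xE //.
Qed.

Lemma legs_prin_hom : exists η : prin_hom P0 P1, restricts (intc η).
Proof.
have dP := effective_descent_descent (bdl_descent P).
pose R (T : C) (z : hom T (pb p0 p1)) (f : hom T (ic1 A)) :=
  exists w : hom T (bdl P), [/\ bdl_p P ∘ w = o ∘ z,
    icd0 A ∘ f = bdl_x P0 ∘ (pr0 ∘ z), icd1 A ∘ f = bdl_x P1 ∘ (pr1 ∘ z)
    & transports w z f].
have R_ex (T : C) (z : hom T (pb p0 p1)) (w : hom T (bdl P)) :
    bdl_p P ∘ w = o ∘ z -> exists f, R T z f.
  by move=> h; have [f [f0 f1 tf]] := transports_ex h; exists f, w.
have [|||η ηP] := @descent_rel _ _ _ _ dP _ _ o R.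
- move=> S T t z f [w [h f0 f1 tf]]; exists (w ∘ t); split.
  + by rewrite !compA h.
  + by rewrite compA f0 -!compA.
  + by rewrite compA f1 -!compA.
  + exact: transportsM.
- move=> T z f f' [w [h f0 f1 tf]] [w' [h' f0' f1' tf']].
  apply: (transports_fun h f0 f0' tf).
  by apply: (transports_invariant _ h' f0' tf'); rewrite h h'.
- by move=> T z w; apply: R_ex.
have η0 : icd0 A ∘ η = bdl_x P0 ∘ pr0.
  apply: (descent_local dP (c := o)) => S t w /R_ex [f fR].
  by rewrite -!compA (ηP _ _ _ fR); case: fR => [w' []].
have η1 : icd1 A ∘ η = bdl_x P1 ∘ pr1.
  apply: (descent_local dP (c := o)) => S t w /R_ex [f fR].
  by rewrite -!compA (ηP _ _ _ fR); case: fR => [w' []].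
have η_tr (T : C) (z : hom T (pb p0 p1)) (w : hom T (bdl P)) :
    bdl_p P ∘ w = o ∘ z -> transports w z (η ∘ z).
  move=> h; have [f [f0 f1 tf]] := transports_ex h.
  by rewrite (ηP _ _ f) //; exists w.
have nat : natural η.
  move=> T z z' h; apply: (descent_local dP (c := o ∘ z)) => S t w.
  rewrite -compA => hw; have hw' : bdl_p P ∘ w = o ∘ (z' ∘ t).
    by rewrite hw !compA h.
  have [k0 k1] := over_prod_eq h.
  have [m0 m1] : p0 ∘ (pr0 ∘ (z ∘ t)) = p0 ∘ (pr0 ∘ (z' ∘ t)) /\
      p1 ∘ (pr1 ∘ (z ∘ t)) = p1 ∘ (pr1 ∘ (z' ∘ t)).
    by apply: over_prod_eq; rewrite -hw hw'.
  have l0 : p0 ∘ (t0 ∘ w) = p0 ∘ (pr0 ∘ (z ∘ t)) by rewrite leg0_pE hw over_prod0.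
  have l1 : p1 ∘ (t1 ∘ w) = p1 ∘ (pr1 ∘ (z ∘ t)) by rewrite leg1_pE hw over_prod1.
  have ηd0 (U : C) (u : hom U (pb p0 p1)) : icd0 A ∘ (η ∘ u) = bdl_x P0 ∘ (pr0 ∘ u).
    by rewrite compA η0 -compA.
  have ηd1 (U : C) (u : hom U (pb p0 p1)) : icd1 A ∘ (η ∘ u) = bdl_x P1 ∘ (pr1 ∘ u).
    by rewrite compA η1 -compA.
  rewrite !mulM ?ηd0 ?ηd1 ?cc_d0 ?cc_d1 //= ?comp1m // !ccM // -!compA.
  (* Preceded by [c0(t0 w, pr0 z)], both sides of the naturality square become [x_P(w)] followed by
     [c1(t1 w, pr1 z')]. *)
  apply: (cat_cocycle_injl l0).
  + by rewrite d0mul ?ηd0 ?cc_d0 ?cc_d1 //= comp1m.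
  + by rewrite d0mul ?ηd0 ?ηd1 ?cc_d0 //= comp1m.
  rewrite !mulA ?ηd0 ?ηd1 ?cc_d0 ?cc_d1 //= ?comp1m //.
  rewrite cc_mul // (η_tr _ _ _ hw') (η_tr _ _ _ hw) -mulA ?cc_mul //.
    by rewrite cc_d0 /= comp1m leg1_xE.
  by rewrite cc_d0 ?cc_d1.
have [ζ ζE] := prin_hom_make η0 η1 nat.
(* At [z = (t0 w, t1 w)] the two cocycles in [transports] are identities, which leaves
   [f = x_P(w)]. *)
exists ζ; rewrite ζE => T w z z0 z1; apply: ηP; exists w.
have h : bdl_p P ∘ w = o ∘ z by rewrite over_prod0 z0 leg0_pE.
split=> //; rewrite ?z0 ?z1 ?leg0_xE ?leg1_xE //.
rewrite /transports z0 z1 !cc_id mul1l ?mul1r //= ?comp1m ?leg0_xE ?leg1_xE //.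
Qed.

End Legs.

(** Given a local [w'] in [P'] over the same point as [w], naturality of [η] makes the cocycles from
    [t0' w'] to [t0 w] and from [t1' w'] to [t1 w] the components of an isomorphism [x(w') -> x(w)]
    of the arrow category; acting with it on [w'] gives the image of [w]. Uniqueness and
    equivariance both follow from [ccR], because such an isomorphism is determined by its ends and
    its components. *)
Lemma legs_iso (η : prin_hom P0 P1) (P P' : bundle (core (arrow A)) X)
    (t0 : hom (bdl P) (bdl P0)) (t1 : hom (bdl P) (bdl P1))
    (t0' : hom (bdl P') (bdl P0)) (t1' : hom (bdl P') (bdl P1)) :
  legs t0 t1 -> legs t0' t1' ->
  restricts t0 t1 (intc η) -> restricts t0' t1' (intc η) ->
  exists φ : bundle_hom P P', t0' ∘ φ = t0 /\ t1' ∘ φ = t1.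
Proof.
move=> lg lg' re re'.
have dP' := effective_descent_descent (bdl_descent P').
pose R (T : C) (w : hom T (bdl P)) (u : hom T (bdl P')) :=
  [/\ bdl_p P' ∘ u = bdl_p P ∘ w, bdl_x P' ∘ u = bdl_x P ∘ w,
      t0' ∘ u = t0 ∘ w & t1' ∘ u = t1 ∘ w].
have R_ex (T : C) (w : hom T (bdl P)) (w' : hom T (bdl P')) :
    bdl_p P' ∘ w' = bdl_p P ∘ w -> exists u, R T w u.
  move=> h; have [z [z0 z1 hz]] := leg_pair lg w.
  have tr := natural_transports lg' (@prin_hom_natural η) re' (w := w') (z := z).
  rewrite hz in tr; have {tr} := tr h; rewrite /transports z0 z1 (re _ w) // => e.
  have k0 : p0 ∘ (t0' ∘ w') = p0 ∘ (t0 ∘ w) by rewrite (leg0_pE lg) (leg0_pE lg').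
  have k1 : p1 ∘ (t1' ∘ w') = p1 ∘ (t1 ∘ w) by rewrite (leg1_pE lg) (leg1_pE lg').
  rewrite !cat_cocycleE // in e.
  have [||||s [s0 s1 sh sk]] := iso_square _ _ _ _ (esym e).
  - by rewrite cc_d0 /= (leg0_xE lg').
  - by rewrite cc_d1 //= (leg0_xE lg).
  - by rewrite cc_d0 /= (leg1_xE lg').
  - by rewrite cc_d1 //= (leg1_xE lg).
  have dv : cc (cocycle P') w' (act P' s w') = s by apply: dv_uniq.
  have pu : bdl_p P' ∘ w' = bdl_p P' ∘ act P' s w' by rewrite p_act.
  exists (act P' s w'); split; rewrite ?p_act ?x_act //.
  - apply: (act_injl (R := P0) (z := t0' ∘ w'));
      rewrite ?(leg0_pE lg') ?(leg0_pE lg) ?p_act //.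
    by rewrite (leg0_cc lg' pu) dv sh.
  - apply: (act_injl (R := P1) (z := t1' ∘ w'));
      rewrite ?(leg1_pE lg') ?(leg1_pE lg) ?p_act //.
    by rewrite (leg1_cc lg' pu) dv sk.
have ccR (T : C) (w1 w2 : hom T (bdl P)) (u1 u2 : hom T (bdl P')) :
    bdl_p P ∘ w1 = bdl_p P ∘ w2 -> R T w1 u1 -> R T w2 u2 ->
    cc (cocycle P') u1 u2 = cc (cocycle P) w1 w2.
  move=> h [p1' x1 a1 b1] [p2' x2 a2 b2].
  have hu : bdl_p P' ∘ u1 = bdl_p P' ∘ u2 by rewrite p1' p2'.
  apply: core_arrow_ext; rewrite ?cc_d0 ?cc_d1 //.
    by rewrite -(leg0_cc lg' hu) -(leg0_cc lg h) a1 a2.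
  by rewrite -(leg1_cc lg' hu) -(leg1_cc lg h) b1 b2.
have [|||φ φP] := @descent_rel _ _ _ _ dP' _ _ (bdl_p P) R.
- move=> S T t w u [e1 e2 e3 e4]; split; by rewrite !compA ?e1 ?e2 ?e3 ?e4.
- move=> T w u u' r r'; have [e _ _ _] := r; have [e' _ _ _] := r'.
  apply: (act_injl (R := P') (z := u)); rewrite ?e ?e' //.
  by rewrite (ccR _ w w) // (ccR _ w w).
- by move=> T w w'; apply: R_ex.
have φR (S : C) (t : hom S (bdl P)) (w' : hom S (bdl P')) :
    bdl_p P' ∘ w' = bdl_p P ∘ t -> R S t (φ ∘ t).
  by move=> /R_ex [u uR]; rewrite (φP _ _ _ uR).
have pφ : bdl_p P' ∘ φ = bdl_p P.
  by apply: (descent_local dP' (c := bdl_p P)) => S t w /φR []; rewrite compA.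
have xφ : bdl_x P' ∘ φ = bdl_x P.
  by apply: (descent_local dP' (c := bdl_p P)) => S t w /φR [_]; rewrite compA.
have φ0 : t0' ∘ φ = t0.
  by apply: (descent_local dP' (c := bdl_p P)) => S t w /φR [_ _]; rewrite compA.
have φ1 : t1' ∘ φ = t1.
  by apply: (descent_local dP' (c := bdl_p P)) => S t w /φR [_ _ _]; rewrite compA.
have [|h hE] := bundle_hom_make pφ xφ; last by exists h; rewrite hE.
move=> T z z' e; apply: ccR => //; by rewrite /R !compA pφ xφ φ0 φ1.
Qed.

(** The cocycle has [η] as its object part and the naturality squares, which are invertible by
    [iso_square], as its morphism part; it is multiplicative because its [D0] and [D1] components
    are cocycles. *)
Lemma legs_exist (η : prin_hom P0 P1) :
  exists (P : bundle (core (arrow A)) X) (t0 : hom (bdl P) (bdl P0))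
    (t1 : hom (bdl P) (bdl P1)), legs t0 t1 /\ restricts t0 t1 (intc η).
Proof.
have d : descent o.
  by apply: descent_prod; apply: effective_descent_descent; apply: bdl_descent.
have [h0 h1] := over_prod_eq (pb_sq o o).
have [|||||s [s0 s1 sh sk]] := @iso_square _ A _ (intc η ∘ pb1 o o) (intc η ∘ pb2 o o)
    (cc (cocycle P0) (pr0 ∘ pb1 o o) (pr0 ∘ pb2 o o))
    (cc (cocycle P1) (pr1 ∘ pb1 o o) (pr1 ∘ pb2 o o)).
- by rewrite cc_d0 prin_hom_d0.
- by rewrite cc_d1 // prin_hom_d0.
- by rewrite cc_d0 prin_hom_d1.
- by rewrite cc_d1 // prin_hom_d1.
- by rewrite -!cat_cocycleE // prin_hom_natural // pb_sq.
have sD0 (T : C) (u : hom T (pb o o)) : if1 (D0 A) ∘ (s ∘ u)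
    = cc (cocycle P0) (pr0 ∘ (pb1 o o ∘ u)) (pr0 ∘ (pb2 o o ∘ u)).
  by rewrite !(compA pr0) -(ccM _ _ h0) -sh; exact: compA.
have sD1 (T : C) (u : hom T (pb o o)) : if1 (D1 A) ∘ (s ∘ u)
    = cc (cocycle P1) (pr1 ∘ (pb1 o o ∘ u)) (pr1 ∘ (pb2 o o ∘ u)).
  by rewrite !(compA pr1) -(ccM _ _ h1) -sk; exact: compA.
have [|ψ [ψ0 ψ1]] := @cocycle_make _ _ _ o (core (arrow A)) (intc η) s s0 s1.
  move=> T u v w e1 e2 e3.
  have k : icd1 (core (arrow A)) ∘ (s ∘ u) = icd0 (core (arrow A)) ∘ (s ∘ v).
    by rewrite compA s1 compA s0 -!compA e1.
  have [u0 u1] := over_prod_eq (pb_elt u); have [v0 v1] := over_prod_eq (pb_elt v).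
  apply: core_arrow_ext.
  - by rewrite d0mul // compA s0 compA s0 -!compA e2.
  - by rewrite d1mul // compA s1 compA s1 -!compA e3.
  - by rewrite if1_mul // !sD0 -e1 -e2 -e3 cc_mul // e1.
  - by rewrite if1_mul // !sD1 -e1 -e2 -e3 cc_mul // e1.
have ccψ (T : C) (v v' : hom T (pb p0 p1)) : o ∘ v = o ∘ v' ->
    if1 (D0 A) ∘ cc ψ v v' = cc (cocycle P0) (pr0 ∘ v) (pr0 ∘ v') /\
    if1 (D1 A) ∘ cc ψ v v' = cc (cocycle P1) (pr1 ∘ v) (pr1 ∘ v').
  by move=> h; rewrite -(ccE ψ h) ψ1 sD0 sD1 pb1_pair pb2_pair.
have [Q] := bundle_of_exists ψ d.
have [|||t0 [b0 l0 x0 e0]] := @bundle_of_extend _ _ _ _ (D0 A) _ _ ψ Q P0 pr0 d.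
- by [].
- by rewrite ψ0 (intc_d0 η) /= comp1m.
- by move=> T v v' /ccψ [].
have [|||t1 [b1 l1 x1 e1]] := @bundle_of_extend _ _ _ _ (D1 A) _ _ ψ Q P1 pr1 d.
- exact: esym (pb_sq _ _).
- by rewrite ψ0 (intc_d1 η) /= comp1m.
- by move=> T v v' /ccψ [].
exists Q, t0, t1; split; first by split.
move=> T w z z0 z1; apply: (descent_local d (c := bdl_p Q ∘ w)) => S t v.
rewrite -!compA => hv; have hz : o ∘ v = o ∘ (z ∘ t).
  by rewrite over_prod0 hv over_prod0 (compA pr0) z0 !compA l0.
have sv : bdl_p Q ∘ (bof_map Q ∘ v) = bdl_p Q ∘ (w ∘ t).
  by rewrite compA bof_map_p over_prod0.
have [k0 k1] := over_prod_eq hz.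
have zt0 : pr0 ∘ (z ∘ t) = t0 ∘ (w ∘ t) by rewrite !compA z0.
have zt1 : pr1 ∘ (z ∘ t) = t1 ∘ (w ∘ t) by rewrite !compA z1.
have hx : bdl_x P0 ∘ (pr0 ∘ (z ∘ t)) = icd0 A ∘ (bdl_x Q ∘ (w ∘ t)).
  by rewrite zt0 compA x0 -compA.
apply: (cat_cocycle_injl k0); rewrite ?prin_hom_d0 ?hx //.
have xs : if0 (cocycle Q) ∘ (bof_map Q ∘ v) = intc η ∘ v.
  by rewrite compA (bof_map_x Q) ψ0.
have ts0 : t0 ∘ (bof_map Q ∘ v) = pr0 ∘ v by rewrite compA b0.
have ts1 : t1 ∘ (bof_map Q ∘ v) = pr1 ∘ v by rewrite compA b1.
(* On the image of the comparison map [x_Q] equals [η] by construction. The square from there to [w]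
   and the naturality square of [η] share all sides but the last, which are [x_Q(w)] and
   [η(t0 w, t1 w)]. *)
have := core_arrow_comm (cc (cocycle Q) (bof_map Q ∘ v) (w ∘ t)).
rewrite -(e0 _ _ _ sv) -(e1 _ _ _ sv) cc_d0 cc_d1 // xs ts0 ts1 -zt0 -zt1.
rewrite -!cat_cocycleE // => <-.
exact: prin_hom_natural.
Qed.

End PrinHom.

(** * Triples up to isomorphism *)

Section Triples.
Variables (C : cartesian) (A : icat C) (X : C) (P0 P1 : bundle (core A) X).

Lemma bundle_hom_inj (G : igroupoid C) (P Q : bundle G X) (h : bundle_hom P Q)
    (T : C) (f g : hom T (bdl P)) : h ∘ f = h ∘ g -> f = g.
Proof.
move=> /(congr1 (comp (bundle_hom_inv_map h))).
by rewrite !compA bundle_hom_inv_mapK !comp1m.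
Qed.

Lemma Sigma_cocycle (H G : igroupoid C) (F : ifunctor H G) (P : bundle H X)
    (R : bundle G X) (t : hom (bdl P) (bdl R)) (tp : bdl_p R ∘ t = bdl_p P) :
  (forall (T : C) (z z' : hom T (bdl P)), bdl_p P ∘ z = bdl_p P ∘ z' ->
     cc (cocycle R) (t ∘ z) (t ∘ z') = if1 F ∘ cc (cocycle P) z z') ->
  if1 (cocycle R) ∘ if1 (kp_map tp) = if1 (ifunctor_comp F (cocycle P)).
Proof.
by move=> tcc; apply: cocycle_kp_map => T v v' h; rewrite cc_comp // tcc.
Qed.

(** The correspondence as a relation. The condition on [t0] is written with [β0] on the other side,
    so that no inverse appears. *)
Definition classifies (η : prin_hom P0 P1) (t : triple P0 P1) : Prop :=
  exists (t0 : hom (bdl (tr_P t)) (bdl P0)) (t1 : hom (bdl (tr_P t)) (bdl P1)),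
    [/\ legs t0 t1, tr_beta0 t ∘ t0 = bof_map (tr_S0 t),
        tr_beta1 t ∘ bof_map (tr_S1 t) = t1 & restricts t0 t1 (intc η)].

Lemma triple_classified (t : triple P0 P1) : exists η, classifies η t.
Proof.
case: t => P S0 S1 β0 β1.
pose t0 := bundle_inv β0 ∘ bof_map S0; pose t1 := β1 ∘ bof_map S1.
have lg : legs t0 t1.
  have sp0 (T : C) (w : hom T (bdl P)) : bdl_p S0 ∘ (bof_map S0 ∘ w) = bdl_p P ∘ w.
    by rewrite compA bof_map_p.
  have sp1 (T : C) (w : hom T (bdl P)) : bdl_p S1 ∘ (bof_map S1 ∘ w) = bdl_p P ∘ w.
    by rewrite compA bof_map_p.
  split.
  - by rewrite compA bmap_p bof_map_p.
  - by rewrite compA bmap_x bof_map_x.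
  - move=> T w w' h; rewrite -!(compA (bundle_inv β0)) bundle_hom_cc ?sp0 //.
    by rewrite bof_map_cc // cc_comp.
  - by rewrite compA bmap_p bof_map_p.
  - by rewrite compA bmap_x bof_map_x.
  - move=> T w w' h; rewrite -!(compA β1) bundle_hom_cc ?sp1 //.
    by rewrite bof_map_cc // cc_comp.
have [η re] := legs_prin_hom lg.
exists η, t0, t1; split=> //=.
by rewrite compA bundle_hom_inv_mapKr comp1m.
Qed.

(** The legs satisfy exactly the conditions on a comparison map, so [P0] and [P1] represent the two
    [Sigma]s and [β0], [β1] can be identities. *)
Lemma classifying_triple (η : prin_hom P0 P1) : exists t, classifies η t.
Proof.
have [P [t0 [t1 [lg re]]]] := legs_exist η.
pose S0 : Sigma (D0 A) P := @BundleOf _ _ _ _ _ (ifunctor_comp (D0 A) (cocycle P))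
  P0 t0 (leg0_p lg) (leg0_x lg) (Sigma_cocycle (leg0_p lg) (leg0_cc lg)).
pose S1 : Sigma (D1 A) P := @BundleOf _ _ _ _ _ (ifunctor_comp (D1 A) (cocycle P))
  P1 t1 (leg1_p lg) (leg1_x lg) (Sigma_cocycle (leg1_p lg) (leg1_cc lg)).
exists (@Triple _ _ _ P0 P1 P S0 S1 (bundle_id P0) (bundle_id P1)), t0, t1.
by split; rewrite //= comp1m.
Qed.

Lemma classified_iso (η : prin_hom P0 P1) (t t' : triple P0 P1) :
  classifies η t -> classifies η t' -> triple_iso t t'.
Proof.
move=> [t0 [t1 [lg e0 e1 re]]] [t0' [t1' [lg' e0' e1' re']]].
have [φ [φ0 φ1]] := legs_iso lg lg' re re'.
exists φ, (bundle_comp (tr_beta0 t') (bundle_inv (tr_beta0 t))),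
  (bundle_comp (bundle_inv (tr_beta1 t')) (tr_beta1 t)).
split; rewrite /is_Sigma_map /=.
- rewrite -e0 -e0' -!compA φ0; congr comp.
  by rewrite compA bundle_hom_inv_mapK comp1m.
- apply: (bundle_hom_inj (h := tr_beta1 t')); rewrite !compA.
  by rewrite bundle_hom_inv_mapKr comp1m e1' φ1 e1.
- by rewrite -compA bundle_hom_inv_mapK compm1.
- by rewrite compA bundle_hom_inv_mapKr comp1m.
Qed.

(** An isomorphism of triples commutes with the legs and with [x]. Locally, the values of [η] and
    [η'] at [z] are thus transported from the same element [w], and [transports_fun] identifies
    them. *)
Lemma classified_unique (η η' : prin_hom P0 P1) (t t' : triple P0 P1) :
  classifies η t -> classifies η' t' -> triple_iso t t' -> η = η'.
Proof.
move=> [t0 [t1 [lg e0 e1 re]]] [t0' [t1' [lg' e0' e1' re']]].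
move=> [φ [φ0 [φ1 [s0 s1 b0 b1]]]]; rewrite /is_Sigma_map in s0 s1.
have tφ0 : t0' ∘ φ = t0.
  apply: (bundle_hom_inj (h := tr_beta0 t')).
  by rewrite compA e0' -s0 -e0 compA b0.
have tφ1 : t1' ∘ φ = t1 by rewrite -e1' -compA -s1 compA b1 e1.
apply: prin_hom_eq.
have dP := effective_descent_descent (bdl_descent (tr_P t)).
apply: (descent_local dP (c := over_prod P0 P1)) => S z w h.
have h' : bdl_p (tr_P t') ∘ (φ ∘ w) = over_prod P0 P1 ∘ z by rewrite compA bmap_p.
have tr := natural_transports lg (@prin_hom_natural _ _ _ _ _ η) re h.
have tr' := natural_transports lg' (@prin_hom_natural _ _ _ _ _ η') re' h'.
apply: (transports_fun lg h) tr _; rewrite ?prin_hom_d0 //.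
by move: tr'; rewrite /transports !compA tφ0 tφ1 bmap_x.
Qed.

End Triples.

Theorem proposition3p2 (C : cartesian) (A : icat C) (X : C)
    (P0 P1 : bundle (core A) X) :
  exists Phi : prin_hom P0 P1 -> triple_class P0 P1, bijective Phi.
Proof.
(* A triple is chosen for each [η]; by [classified_iso] its class does not depend on the choice. *)
pose tr (η : prin_hom P0 P1) := sval (cid (classifying_triple η)).
have trP η : classifies η (tr η) by rewrite /tr; case: cid.
pose Phi (η : prin_hom P0 P1) : triple_class P0 P1 :=
  exist _ (triple_iso (tr η)) (ex_intro _ (tr η) erefl).
exists Phi; apply: inj_surj_bij => [η η' e|[K [t Kt]]].
  apply: classified_unique (trP η) (trP η') _.
  have /= -> := congr1 sval e; exact: triple_iso_refl.
have [η ηt] := triple_classified t.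
exists η; apply: sig_eq; rewrite /= Kt; have i := classified_iso (trP η) ηt.
apply: funext => u; apply: propext; split=> ?.
  exact: triple_iso_trans (triple_iso_sym i) _.
exact: triple_iso_trans i _.
Qed.
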